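(* Assume $\hat{\mathbb P}_x=\mathcal N(\hat\mu_x,\hat\Sigma_x)$ and $\hat{\mathbb P}_w=\mathcal N(\hat\mu_w,\hat\Sigma_w)$. Then $\sup_{\mathbb Q\in\mathbb B_{\mathcal N}(\hat{\mathbb P})}\inf_{\psi\in\mathcal F}\mathcal R(\psi,\mathbb Q)$ equals the optimal value of $$\begin{array}{cl}\sup & \mathrm{Tr}\big[\Sigma_x-\Sigma_xH^\top(H\Sigma_xH^\top+\Sigma_w)^{-1}H\Sigma_x\big]\\ \text{s.t.} & \Sigma_x\in\mathbb S^n_+,\ \Sigma_w\in\mathbb S^m_{++},\\ & \mathrm{Tr}[\Sigma_x+\hat\Sigma_x-2(\hat\Sigma_x^{1/2}\Sigma_x\hat\Sigma_x^{1/2})^{1/2}]\le\rho_x^2,\\ & \mathrm{Tr}[\Sigma_w+\hat\Sigma_w-2(\hat\Sigma_w^{1/2}\Sigma_w\hat\Sigma_w^{1/2})^{1/2}]\le\rho_w^2.\end{array}\qquad(\ast\ast)$$ If moreover $\hat\Sigma_w\succ0$, then $(\ast\ast)$ is solvable, it has a maximizer $(\Sigma_x^\star,\Sigma_w^\star)$ with $\Sigma_x^\star\succeq\lambda_{\min}(\hat\Sigma_x)I_n$ and $\Sigma_w^\star\succeq\lambda_{\min}(\hat\Sigma_w)I_m$, and for any maximizer $(\Sigma_x^\star,\Sigma_w^\star)$ of $(\ast\ast)$ the supremum over $\mathbb B_{\mathcal N}(\hat{\mathbb P})$ is attained by $\mathbb Q^\star=\mathcal N(\hat\mu_x,\Sigma_x^\star)\times\mathcal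 N(\hat\mu_w,\Sigma_w^\star)$.
   Context: Standing setup. Fix $n,m\in\mathbb N$ and $H\in\mathbb R^{m\times n}$. For $d\in\mathbb N$, $\mathcal M(\mathbb R^d)$ is the set of Borel probability distributions on $\mathbb R^d$ with finite second moments; $\mathbb W$ is the type-2 Wasserstein distance $\mathbb W(\mathbb Q_1,\mathbb Q_2)=\inf_{\pi\in\Pi(\mathbb Q_1,\mathbb Q_2)}(\int\|\xi_1-\xi_2\|^2d\pi)^{1/2}$ over couplings. $\mathcal N(\mu,\Sigma)$ denotes the (possibly degenerate) normal distribution with mean $\mu$ and covariance $\Sigma\in\mathbb S^d_+$. The signal $x\in\mathbb R^n$ and noise $w\in\mathbb R^m$ have joint distribution $\mathbb Q$; $\mathcal F$ is the set of measurable $\psi:\mathbb R^m\to\mathbb R^n$ with $\|\psi(y)\|\le C(1+\|y\|)$ for some $C>0$; $\mathcal R(\psi,\mathbb Q)=\mathbb E_{\mathbb Q}[\|x-\psi(Hx+w)\|^2]$. The nominal distribution is $\hat{\mathbb P}=\hat{\mathbb P}_x\times\hat{\mathbb P}_w$ with means $\hat\mu_x,\hat\mu_w$ and covariances $\hat\Sigma_x\in\mathbb S^n_+,\hat\Sigma_w\in\mathbb S^m_+$; radii $\rho_x,\rho_w\ge0$. The restricted normal ambiguity set is $\mathbb B_{\mathcal N}(\hat{\mathbb P})=\{\mathcal N(\hat\mu_x,\Sigma_x)\times\mathcal N(\hat\mu_w,\Sigma_w):\Sigma_x\in\mathbb S^n_+,\ \Sigma_w\in\mathbb S^m_{++},\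 \mathbb W(\mathcal N(\hat\mu_x,\Sigma_x),\hat{\mathbb P}_x)\le\rho_x,\ \mathbb W(\mathcal N(\hat\mu_w,\Sigma_w),\hat{\mathbb P}_w)\le\rho_w\}$. $\mathbb S^d_{++}$ denotes positive definite matrices and $\lambda_{\min}$ the smallest eigenvalue. *)

(* Defs.v *)
From HB Require Import structures.
From mathcomp Require Import all_boot all_order all_algebra.
From mathcomp Require Import all_classical all_reals all_analysis.
Set Implicit Arguments.
Unset Strict Implicit.
Unset Printing Implicit Defensive.
Import Order.TTheory GRing.Theory Num.Theory.
Import numFieldTopology.Exports numFieldNormedType.Exports.
Local Open Scope classical_set_scope.
Local Open Scope ring_scope.

Definition vecR (R : realType) (d : nat) :=
  g_sigma_algebraType (open : set (set 'cV[R]_d)).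

Definition sqnorm (R : realType) (d : nat) (v : 'cV[R]_d) : R :=
  \sum_(i < d) (v i 0) ^+ 2.

Definition psd (R : realType) (d : nat) (A : 'M[R]_d) : Prop :=
  A^T = A /\ forall x : 'cV[R]_d, 0 <= (x^T *m A *m x) 0 0.
Definition pd (R : realType) (d : nat) (A : 'M[R]_d) : Prop :=
  A^T = A /\ forall x : 'cV[R]_d, x != 0 -> 0 < (x^T *m A *m x) 0 0.

Definition sqrtm (R : realType) (d : nat) (A : 'M[R]_d) : 'M[R]_d :=
  match pselect (exists B : 'M[R]_d, psd B /\ B *m B = A) with
  | left P => projT1 (cid P)
  | right _ => 0
  end.

Definition lambda_min (R : realType) (d : nat) (A : 'M[R]_d) : R :=
  inf [set a : R | eigenvalue A a].

Definition normal1 (R : realType) (mu v : R) : set R -> \bar R :=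
  fun A => if v == 0 then \d_mu A else normal_prob mu (Num.sqrt v) A.

Definition is_normal (R : realType) (d : nat) (P : set (vecR R d) -> \bar R)
    (mu : 'cV[R]_d) (S : 'M[R]_d) : Prop :=
  forall (u : 'cV[R]_d) (A : set R), measurable A ->
    P [set x : vecR R d | A ((u^T *m (x : 'cV[R]_d)) 0 0)] =
    normal1 ((u^T *m mu) 0 0) ((u^T *m S *m u) 0 0) A.

Definition wass_normal (R : realType) (d : nat)
    (mu1 : 'cV[R]_d) (S1 : 'M[R]_d) (mu2 : 'cV[R]_d) (S2 : 'M[R]_d) : \bar R :=
  ereal_inf [set sqrte (\int[pi]_z (sqnorm ((z.1 : 'cV[R]_d) - z.2))%:E)%E
            | pi in [set pi : probability (vecR R d * vecR R d)%type R |
                     is_normal (fun A => pi (A `*` setT)) mu1 S1 /\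
                     is_normal (fun A => pi (setT `*` A)) mu2 S2]].

Definition is_normal_prod (R : realType) (n m : nat)
    (Q : probability (vecR R n * vecR R m)%type R)
    (mux : 'cV[R]_n) (Sx : 'M[R]_n) (muw : 'cV[R]_m) (Sw : 'M[R]_m) : Prop :=
  [/\ is_normal (fun A => Q (A `*` setT)) mux Sx,
      is_normal (fun B => Q (setT `*` B)) muw Sw &
      forall (A : set (vecR R n)) (B : set (vecR R m)),
        measurable A -> measurable B ->
        Q (A `*` B) = (Q (A `*` setT) * Q (setT `*` B))%E].

Definition amb_set (R : realType) (n m : nat)
    (muhx : 'cV[R]_n) (Shx : 'M[R]_n) (muhw : 'cV[R]_m) (Shw : 'M[R]_m)
    (rhox rhow : R) : set (probability (vecR R n * vecR R m)%type R) :=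
  [set Q | exists (Sx : 'M[R]_n) (Sw : 'M[R]_m),
     [/\ psd Sx, pd Sw, is_normal_prod Q muhx Sx muhw Sw,
         (wass_normal muhx Sx muhx Shx <= rhox%:E)%E &
         (wass_normal muhw Sw muhw Shw <= rhow%:E)%E]].

Definition estimators (R : realType) (n m : nat) : set (vecR R m -> vecR R n) :=
  [set psi : vecR R m -> vecR R n | measurable_fun setT psi /\
     exists C : R, 0 < C /\ forall y : vecR R m,
       Num.sqrt (sqnorm (psi y)) <= C * (1 + Num.sqrt (sqnorm y))].

Definition risk (R : realType) (n m : nat) (H : 'M[R]_(m, n))
    (psi : vecR R m -> vecR R n) (Q : probability (vecR R n * vecR R m)%type R)
    : \bar R :=
  (\int[Q]_z (sqnorm ((z.1 : 'cV[R]_n) -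
                      psi (H *m (z.1 : 'cV[R]_n) + (z.2 : 'cV[R]_m))))%:E)%E.

Definition dro_value (R : realType) (n m : nat) (H : 'M[R]_(m, n))
    (muhx : 'cV[R]_n) (Shx : 'M[R]_n) (muhw : 'cV[R]_m) (Shw : 'M[R]_m)
    (rhox rhow : R) : \bar R :=
  ereal_sup [set ereal_inf [set risk H psi Q | psi in @estimators R n m]
            | Q in amb_set muhx Shx muhw Shw rhox rhow].

Definition mmse_obj (R : realType) (n m : nat) (H : 'M[R]_(m, n))
    (Sx : 'M[R]_n) (Sw : 'M[R]_m) : R :=
  \tr (Sx - Sx *m H^T *m invmx (H *m Sx *m H^T + Sw) *m H *m Sx).

Definition gelbrich_le (R : realType) (d : nat) (S Sh : 'M[R]_d) (rho : R) : Prop :=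
  \tr (S + Sh - 2%:R *: sqrtm (sqrtm Sh *m S *m sqrtm Sh)) <= rho ^+ 2.

Definition feasible (R : realType) (n m : nat) (Shx : 'M[R]_n) (Shw : 'M[R]_m)
    (rhox rhow : R) : set ('M[R]_n * 'M[R]_m) :=
  [set p | [/\ psd p.1, pd p.2, gelbrich_le p.1 Shx rhox & gelbrich_le p.2 Shw rhow]].

Definition opt_value (R : realType) (n m : nat) (H : 'M[R]_(m, n))
    (Shx : 'M[R]_n) (Shw : 'M[R]_m) (rhox rhow : R) : \bar R :=
  ereal_sup [set (mmse_obj H p.1 p.2)%:E | p in feasible Shx Shw rhox rhow].

(* Main.v *)
Require Import Defs.
From HB Require Import structures.
From mathcomp Require Import all_boot all_order all_algebra.
From mathcomp Require Import all_classical all_reals all_analysis measurable_realfun.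
From mathcomp Require Import ring lra.
Set Implicit Arguments.
Unset Strict Implicit.
Unset Printing Implicit Defensive.
Import Order.TTheory GRing.Theory Num.Theory.
Import numFieldTopology.Exports numFieldNormedType.Exports.
Local Open Scope classical_set_scope.
Local Open Scope ring_scope.

(** For normal signal and noise, the error of the optimal affine estimator is
    uncorrelated with the observation; by uniqueness of characteristic functions
    its reflection then leaves the joint law unchanged, so the error is orthogonal
    to every square integrable function of the observation and the inner infimum
    is [mmse_obj].  A matrix [C] is the cross covariance of some coupling of two
    normal laws exactly when the block matrix [S C; C^T Sh] is positive
    semidefinite, and the largest [\tr C] is the trace of
    [sqrtm (sqrtm Sh *m S *m sqrtm Sh)]; this turns the Wasserstein constraints
    into the Gelbrich constraints.  Finally [mmse_obj] is the infimum over the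
    gains [K] of functions linear in the covariances, and the feasible sets are
    projections of compact spectrahedra.  A maximizer over the covariances bounded
    below by [lambda_min] thus exists, and it is global since a linear function
    with a positive semidefinite weight has a maximizer of that kind. *)

(** [is_normal] prescribes the one-dimensional projections of a law. Covariances may be singular, so
    densities are used on the line only, and laws of vectors are compared through the functions
    [cos (t *d y + a)], whose phase [a] covers the sines as well. The couplings in [wass_normal]
    need not be jointly normal; only their second moments enter the lower bound on the cost.
    Singular covariances also rule out the inverses in the optimal transport map. The regularized
    inverse of [X + e%:M] replaces them and costs an error of order [e]; letting [e] tend to 0
    removes it from the lower bound, and compactness of the set of admissible cross covariances
    removes it from the upper bound. The constraint [pd Sw] is open, so compactness is only
    available after imposing the lower bounds by [lambda_min]. Comparing the maximizer of that
    smaller problem with all feasible pairs rests on a first order condition along segments,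
    [mmse_saddle], made quantitative so that no derivative of [mmse_obj] is computed. Spectral facts
    are obtained from Cauchy-Schwarz and traces in place of diagonalization. *)

Local Notation "u *d y" := ((u^T *m (y : 'cV[_]_(_))) 0 0) (at level 40).

(** * Positive semidefinite matrices *)

Section matrix_entries.
Variable R : realType.

Lemma mxDE d e (A B : 'M[R]_(d, e)) i j : (A + B) i j = A i j + B i j.
Proof. by rewrite mxE. Qed.

Lemma mxNE d e (A : 'M[R]_(d, e)) i j : (- A) i j = - A i j.
Proof. by rewrite mxE. Qed.

Lemma mxZE d e c (A : 'M[R]_(d, e)) i j : (c *: A) i j = c * A i j.
Proof. by rewrite mxE. Qed.

End matrix_entries.

Local Notation mxLE := (mxDE, mxNE, mxZE).

Section psd_theory.
Variable R : realType.

Lemma mx11_tr (A : 'M[R]_1) : A 0 0 = \tr A.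
Proof. by rewrite /mxtrace big_ord1. Qed.

Lemma bform_tr d e (A : 'M[R]_(d, e)) (u : 'cV[R]_d) (v : 'cV[R]_e) :
  (u^T *m A *m v) 0 0 = \tr (A *m (v *m u^T)).
Proof. by rewrite mx11_tr mxtrace_mulC !mulmxA mxtrace_mulC mulmxA. Qed.

Lemma bformC d e (A : 'M[R]_(d, e)) (u : 'cV[R]_d) (v : 'cV[R]_e) :
  (u^T *m A *m v) 0 0 = (v^T *m A^T *m u) 0 0.
Proof. by rewrite [RHS]mx11_tr -mxtrace_tr !trmx_mul !trmxK mulmxA -mx11_tr. Qed.

Lemma sqnormE d (x : 'cV[R]_d) : sqnorm x = (x^T *m x) 0 0.
Proof. by rewrite /sqnorm mxE; apply: eq_bigr => i _; rewrite mxE expr2. Qed.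

Lemma sqnorm_ge0 d (x : 'cV[R]_d) : 0 <= sqnorm x.
Proof. by apply: sumr_ge0 => i _; exact: sqr_ge0. Qed.

Lemma sqnorm_eq0 d (x : 'cV[R]_d) : sqnorm x = 0 -> x = 0.
Proof.
move=> /eqP; rewrite psumr_eq0 => [/allP h|i _]; last exact: sqr_ge0.
apply/colP => i; rewrite mxE; apply/eqP.
by have := h i (mem_index_enum _); rewrite sqrf_eq0.
Qed.

Lemma tr_gram d e (U : 'M[R]_(d, e)) : \tr (U *m U^T) = \sum_i \sum_j U i j ^+ 2.
Proof.
apply: eq_bigr => i _; rewrite mxE; apply: eq_bigr => j _.
by rewrite mxE expr2.
Qed.

Lemma tr_gram_ge0 d e (U : 'M[R]_(d, e)) : 0 <= \tr (U *m U^T).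
Proof.
by rewrite tr_gram; apply: sumr_ge0 => i _; apply: sumr_ge0 => j _; apply: sqr_ge0.
Qed.

Lemma tr_gram_eq0 d e (U : 'M[R]_(d, e)) : \tr (U *m U^T) = 0 -> U = 0.
Proof.
rewrite tr_gram => /eqP; rewrite psumr_eq0 => [/allP h|i _]; last first.
  by apply: sumr_ge0 => j _; apply: sqr_ge0.
apply/matrixP => i j; rewrite mxE; apply/eqP.
have := h i (mem_index_enum _); rewrite psumr_eq0 => [/allP h'|k _]; last exact: sqr_ge0.
by have := h' j (mem_index_enum _); rewrite sqrf_eq0.
Qed.

Lemma psd0 d : psd (0 : 'M[R]_d).
Proof. by split=> [|x]; rewrite ?trmx0// mulmx0 mul0mx mxE. Qed.

Lemma psd1 d : psd (1%:M : 'M[R]_d).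
Proof. by split=> [|x]; rewrite ?trmx1// mulmx1 -sqnormE sqnorm_ge0. Qed.

Lemma psdD d (A B : 'M[R]_d) : psd A -> psd B -> psd (A + B).
Proof.
move=> [sA hA] [sB hB]; split=> [|x]; first by rewrite linearD /= sA sB.
by rewrite mulmxDr mulmxDl mxE addr_ge0.
Qed.

Lemma psdZ d (A : 'M[R]_d) c : 0 <= c -> psd A -> psd (c *: A).
Proof.
move=> c0 [sA hA]; split=> [|x]; first by rewrite linearZ /= sA.
by rewrite -scalemxAr -scalemxAl mxE mulr_ge0.
Qed.

Lemma psd_scalar d (c : R) : 0 <= c -> psd (c%:M : 'M[R]_d).
Proof. by move=> c0; rewrite -scalemx1; apply: psdZ => //; exact: psd1. Qed.

Lemma psd_congr d e (A : 'M[R]_d) (U : 'M[R]_(e, d)) : psd A -> psd (U *m A *m U^T).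
Proof.
move=> [sA hA]; split=> [|x]; first by rewrite !trmx_mul trmxK sA mulmxA.
by have := hA (U^T *m x); rewrite trmx_mul trmxK !mulmxA.
Qed.

Lemma psd_congrT d e (A : 'M[R]_d) (U : 'M[R]_(d, e)) : psd A -> psd (U^T *m A *m U).
Proof. by move=> /(psd_congr U^T); rewrite trmxK. Qed.

Lemma psd_gram d e (U : 'M[R]_(d, e)) : psd (U *m U^T).
Proof. by have := psd_congr U (psd1 e); rewrite mulmx1. Qed.

Lemma psd_sum d (I : Type) (r : seq I) (P : pred I) (F : I -> 'M[R]_d) :
  (forall i, P i -> psd (F i)) -> psd (\sum_(i <- r | P i) F i).
Proof. by move=> h; elim/big_ind : _ => //; [exact: psd0|exact: psdD]. Qed.

Lemma psd_tr_ge0 d (A : 'M[R]_d) : psd A -> 0 <= \tr A.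
Proof.
move=> [_ hA]; apply: sumr_ge0 => i _.
have := hA (delta_mx i 0); rewrite -mulmxA -colE trmx_delta -rowE !mxE.
by [].
Qed.

(** The form at [u + t *: v] is a nonnegative polynomial in [t]; the inequality is its value at the
    minimum. *)
Lemma psd_CS d (A : 'M[R]_d) (u v : 'cV[R]_d) : psd A ->
  ((u^T *m A *m v) 0 0) ^+ 2 <= (u^T *m A *m u) 0 0 * (v^T *m A *m v) 0 0.
Proof.
move=> [sA hA].
set b := (u^T *m A *m v) 0 0; set a := (u^T *m A *m u) 0 0.
set c := (v^T *m A *m v) 0 0.
have hq t : 0 <= a + 2 * t * b + t ^+ 2 * c.
  have := hA (u + t *: v).
  rewrite [X in X *m _ *m _](_ : _ = u^T + t *: v^T); last by rewrite linearD linearZ.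
  rewrite !mulmxDl !mulmxDr -!scalemxAl -!scalemxAr.
  rewrite !mxLE -/a -/b -/c (bformC A v u) sA -/b => h.
  by apply: (le_trans h); rewrite le_eqVlt; apply/orP; left; apply/eqP; ring.
have a0 : 0 <= a by exact: hA.
have c0 : 0 <= c by exact: hA.
have [c00|cn0] := eqVneq c 0.
  rewrite c00 mulr0; have [->|bn0] := eqVneq b 0; first by rewrite expr0n.
  (* For [c = 0] the polynomial is affine in [t], and at this point it would equal -1. *)
  have := hq (- (a + 1) / (2 * b)); rewrite c00 mulr0 addr0.
  have -> : a + 2 * (- (a + 1) / (2 * b)) * b = -1 by field.
  by rewrite ler0N1.
have cp : 0 < c by rewrite lt_def cn0.
have := hq (- b / c).
have -> : a + 2 * (- b / c) * b + (- b / c) ^+ 2 * c = a - b ^+ 2 / c by field.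
by rewrite subr_ge0 ler_pdivrMr.
Qed.

Lemma psd_ker d (A : 'M[R]_d) (x : 'cV[R]_d) : psd A -> (x^T *m A *m x) 0 0 = 0 -> A *m x = 0.
Proof.
move=> pA h; apply: sqnorm_eq0; rewrite sqnormE trmx_mul pA.1.
have := psd_CS (A *m x) x pA; rewrite h mulr0 trmx_mul pA.1.
by move=> h2; apply/eqP; rewrite -sqrf_eq0 eq_le sqr_ge0 andbT -[X in X ^+ 2]/((_ *m (A *m x)) 0 0) mulmxA.
Qed.

Lemma psd_anti d (A : 'M[R]_d) : psd A -> psd (- A) -> A = 0.
Proof.
move=> pA [_ hN]; have h0 (x : 'cV[R]_d) : A *m x = 0.
  apply: psd_ker => //; apply/eqP; rewrite eq_le pA.2 andbT.
  by have := hN x; rewrite mulmxN mulNmx mxE oppr_ge0.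
apply/matrixP => i j; have := congr1 (fun M : 'cV[R]_d => M i 0) (h0 (delta_mx j 0)).
by rewrite -colE !mxE.
Qed.

(** With [u = A x], Cauchy-Schwarz for [A] bounds the square of [sqnorm u] by the product of the
    forms of [A] at [u] and at [x], and the first is at most [c * sqnorm u]. No square root of [A]
    is involved, since this serves to construct square roots. *)
Lemma psd_sqr_le d (A : 'M[R]_d) c (x : 'cV[R]_d) : 0 <= c -> psd A -> psd (c%:M - A) ->
  (x^T *m (A *m A) *m x) 0 0 <= c * (x^T *m A *m x) 0 0.
Proof.
move=> c0 pA [_ hc]; set u := A *m x.
have uE : (x^T *m (A *m A) *m x) 0 0 = sqnorm u.
  by rewrite sqnormE /u trmx_mul pA.1 !mulmxA.
have bE : (u^T *m A *m x) 0 0 = sqnorm u.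
  by rewrite sqnormE /u -!mulmxA.
have := psd_CS u x pA; rewrite bE uE => h.
have hu : (u^T *m A *m u) 0 0 <= c * sqnorm u.
  have := hc u; rewrite mulmxBr mulmxBl -scalemx1 -scalemxAr mulmx1 -scalemxAl.
  by rewrite !mxLE subr_ge0 sqnormE.
have [->|n0] := eqVneq (sqnorm u) 0; first by rewrite mulr_ge0 // pA.2.
have n1 : 0 < sqnorm u by rewrite lt_def n0 sqnorm_ge0.
rewrite -(ler_pM2l n1) -expr2 (le_trans h)// mulrCA mulrA ler_wpM2r ?pA.2//.
Qed.

Lemma pd_psd d (A : 'M[R]_d) : pd A -> psd A.
Proof.
move=> [sA hA]; split=> // x; have [->|x0] := eqVneq x 0; last exact/ltW/hA.
by rewrite mulmx0 mxE.
Qed.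

Lemma psd_pdD d (A B : 'M[R]_d) : psd A -> pd B -> pd (A + B).
Proof.
move=> [sA hA] [sB hB]; split=> [|x x0]; first by rewrite linearD /= sA sB.
by rewrite mulmxDr mulmxDl mxE ltr_wpDl ?hB.
Qed.

Lemma pd_scalar d (c : R) : 0 < c -> pd (c%:M : 'M[R]_d).
Proof.
move=> c0; split=> [|x x0]; first by rewrite tr_scalar_mx.
rewrite -scalemx1 -scalemxAr mulmx1 -scalemxAl mxE mulr_gt0// -sqnormE.
by rewrite lt_def sqnorm_ge0 andbT; apply: contra_neq x0; exact: sqnorm_eq0.
Qed.

Lemma pd_unit d (A : 'M[R]_d) : pd A -> A \in unitmx.
Proof.
move=> [sA hA]; rewrite -row_free_unit -kermx_eq0; apply/eqP/row_matrixP => i.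
rewrite row0; set v := row i (kermx A).
have vA : v *m A = 0 by rewrite /v -row_mul mulmx_ker row0.
apply: trmx_inj; apply/eqP; rewrite trmx0; apply/negP => /negP /hA.
by rewrite trmxK vA mul0mx mxE ltxx.
Qed.

Lemma psd_inv d (A : 'M[R]_d) : A \in unitmx -> psd A -> psd (invmx A).
Proof.
move=> uA pA; have := psd_congr (invmx A) pA.
by rewrite mulVmx// mul1mx trmx_inv pA.1.
Qed.

Lemma psd_notpd d (A : 'M[R]_d) : psd A -> ~ pd A -> exists2 x : 'cV[R]_d, x != 0 & A *m x = 0.
Proof.
move=> pA npA; apply: contra_notP npA => h; split; first exact: pA.1.
move=> x x0; rewrite lt_def pA.2 andbT; apply/eqP => xAx; apply: h.
by exists x => //; exact: psd_ker.
Qed.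

(** Cauchy-Schwarz for the inverse, between a basis vector and [A x], bounds each squared coordinate
    of [x] by a diagonal entry of the inverse times the form of [A] at [x]. Summation gives the
    constant [\tr (invmx A)]; the added 1 keeps the denominator positive. *)
Lemma pd_lower d (A : 'M[R]_d) : pd A ->
  exists2 e : R, 0 < e & psd (A - e%:M).
Proof.
move=> pA; have uA := pd_unit pA; have psA := pd_psd pA.
have pI := psd_inv uA psA.
set t := \tr (invmx A).
have t0 : 0 <= t by exact: psd_tr_ge0.
exists (t + 1)^-1; first by rewrite invr_gt0 ltr_wpDl.
split=> [|x]; first by rewrite linearB /= tr_scalar_mx pA.1.
rewrite mulmxBr mulmxBl -scalemx1 -scalemxAr mulmx1 -scalemxAl
    !mxLE.
rewrite -sqnormE subr_ge0 ler_pdivrMl ?ltr_wpDl//.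
apply: (@le_trans _ _ (t * (x^T *m A *m x) 0 0)); last first.
  by apply: ler_wpM2r; [exact: psA.2|rewrite lerDl].
rewrite /sqnorm /t /mxtrace mulr_suml; apply: ler_sum => i _.
have := psd_CS (delta_mx i 0) (A *m x) pI.
rewrite (_ : _ *m _ *m (A *m x) = (delta_mx i 0)^T *m x); last by rewrite -mulmxA mulKmx.
rewrite (_ : (A *m x)^T *m _ *m _ = x^T *m A *m x); last first.
  by rewrite trmx_mul pA.1 mulmxA mulmxK.
by rewrite trmx_delta -!rowE -colE !mxE.
Qed.

End psd_theory.

(** * Square roots of positive semidefinite matrices *)

Lemma cvgr_sum (R : realType) (I : Type) (T : Type) (F : set_system T) (r : seq I)
    (f : I -> T -> R) (a : I -> R) : Filter F ->
  (forall i, f i x @[x --> F] --> a i) ->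
  \sum_(i <- r) f i x @[x --> F] --> \sum_(i <- r) a i.
Proof. by move=> FF h; apply: cvg_big => //; exact: add_continuous. Qed.

Section sqrt_matrix.
Variable R : realType.

Section iteration.
Variables (d : nat) (B : 'M[R]_d.+1).
Hypotheses (pB : psd B) (pB1 : psd (1%:M - B)).

Lemma psd_expr i : psd (B ^+ i).
Proof.
have [H _] : psd (B ^+ i) /\ psd (B ^+ i.+1); last exact: H.
elim: i => [|i [IH1 IH2]]; first by split; [rewrite expr0; exact: psd1|rewrite expr1].
split=> //; rewrite exprS exprSr mulrA.
by have := psd_congr B IH1; rewrite pB.1.
Qed.

Let nneg (p : {poly R}) := forall i, 0 <= p`_i.

Let nnegD p q : nneg p -> nneg q -> nneg (p + q).
Proof. by move=> hp hq i; rewrite coefD addr_ge0. Qed.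

Let nnegM p q : nneg p -> nneg q -> nneg (p * q).
Proof. by move=> hp hq i; rewrite coefM; apply: sumr_ge0 => j _; exact: mulr_ge0. Qed.

Lemma psd_horner_mx p : nneg p -> psd (horner_mx B p).
Proof.
move=> hp; rewrite -[p]coefK poly_def rmorph_sum; apply: psd_sum => i _.
rewrite /= horner_mxZ rmorphXn /= horner_mx_X; apply: psdZ => //; exact: psd_expr.
Qed.

(* The iteration [Y <- (B + Y^2) / 2] increases to [1 - (1 - B)^(1/2)]; keeping
   the iterates as polynomials with nonnegative coefficients makes all the
   increments positive semidefinite. *)
Let y := fix y k : {poly R} := if k is k'.+1 then 2^-1 *: ('X + y k' ^+ 2) else 0.

Let y_nneg k : nneg (y k).
Proof.
elim: k => [|k IH] i; first by rewrite coef0.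
rewrite /= coefZ mulr_ge0 ?invr_ge0// coefD addr_ge0 ?coefX ?ler0n//.
by rewrite expr2; exact: nnegM.
Qed.

Let y_incr k : nneg (y k.+1 - y k).
Proof.
elim: k => [|k IH]; first by rewrite /= subr0; exact: (y_nneg 1).
have -> : y k.+2 - y k.+1 = 2^-1 *: ((y k.+1 - y k) * (y k.+1 + y k)).
  by rewrite -subr_sqr /= -scalerBr opprD addrACA subrr add0r.
by move=> i; rewrite coefZ mulr_ge0 ?invr_ge0//; apply: nnegM => //; exact: nnegD.
Qed.

Let Y k := horner_mx B (y k).

Let YS k : Y k.+1 = 2^-1 *: (B + Y k *m Y k).
Proof. by rewrite /Y /= horner_mxZ rmorphD /= rmorphXn /= horner_mx_X expr2. Qed.

Let psdY k : psd (Y k). Proof. exact: psd_horner_mx. Qed.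

Let psdY1 k : psd (1%:M - Y k).
Proof.
elim: k => [|k IH]; first by rewrite /Y rmorph0 subr0; exact: psd1.
have -> : 1%:M - Y k.+1 = 2^-1 *: ((1%:M - B) + (1%:M - Y k *m Y k)).
  by apply/matrixP => i j; rewrite YS !mxLE; field.
apply: psdZ; first by rewrite invr_ge0.
apply: psdD => //; split=> [|x].
  by rewrite linearB /= trmx1 trmx_mul (psdY k).1.
rewrite mulmxBr mulmxBl !mxLE subr_ge0.
(* [Y^2 <= Y <= 1] in the semidefinite order. *)
have := psd_sqr_le x ler01 (psdY k) IH; rewrite mul1r => /le_trans; apply.
by have := IH.2 x; rewrite mulmxBr mulmxBl !mxLE subr_ge0.
Qed.

Let qYcvg (x : 'cV[R]_d.+1) : cvgn (fun k => (x^T *m Y k *m x) 0 0).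
Proof.
apply: nondecreasing_is_cvgn.
  apply/nondecreasing_seqP => k.
  have := (psd_horner_mx (@y_incr k)).2 x.
  by rewrite rmorphB /= mulmxBr mulmxBl !mxLE subr_ge0.
exists (sqnorm x) => _ [k _ <-].
have := (psdY1 k).2 x.
by rewrite mulmxBr mulmxBl !mxLE subr_ge0 mulmx1 sqnormE.
Qed.

Let Ycvg i j : cvgn (fun k => Y k i j).
Proof.
pose q (x : 'cV[R]_d.+1) k := (x^T *m Y k *m x) 0 0.
pose e i : 'cV[R]_d.+1 := delta_mx i 0.
(* Polarization: entries are combinations of quadratic forms, and these converge by monotonicity. *)
have -> : (fun k => Y k i j) = (fun k => 2^-1 * (q (e i + e j) k - q (e i) k - q (e j) k)).
  apply/funext => k; rewrite /q.
  rewrite (_ : (e i + e j)^T = (e i)^T + (e j)^T); last by rewrite linearD.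
  rewrite !mulmxDl !mulmxDr !mxLE (bformC _ (e j) (e i)) (psdY k).1.
  have -> : ((e i)^T *m Y k *m e j) 0 0 = Y k i j.
    by rewrite /e trmx_delta -rowE -colE !mxE.
  by field.
apply: is_cvgMl_tmp; apply: is_cvgB; last exact: qYcvg.
by apply: is_cvgB; exact: qYcvg.
Qed.

Lemma psd_onem_sqrt : exists Z, psd Z /\ Z *m Z = 1%:M - B.
Proof.
pose L : 'M[R]_d.+1 := \matrix_(i, j) limn (fun k => Y k i j).
have cL i j : Y k i j @[k --> \oo] --> L i j by rewrite mxE; exact: Ycvg.
have cq (x : 'cV[R]_d.+1) : (x^T *m Y k *m x) 0 0 @[k --> \oo] --> (x^T *m L *m x) 0 0.
  have E M : (x^T *m M *m x) 0 0 = \sum_j (\sum_i x i 0 * M i j) * x j 0 :> R.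
    by rewrite mxE; apply: eq_bigr => j _; rewrite mxE; congr (_ * _);
       apply: eq_bigr => i _; rewrite mxE.
  rewrite E; under eq_fun do rewrite E.
  apply: (cvgr_sum (f := fun j k => (\sum_i x i 0 * Y k i j) * x j 0)) => j.
  apply: cvgMr_tmp; apply: (cvgr_sum (f := fun i k => x i 0 * Y k i j)) => i.
  by apply: cvgMl_tmp; exact: cL.
(* The limit inherits the recursion, which rearranges to [(1 - L)^2 = 1 - B]. *)
have LS : L = 2^-1 *: (B + L *m L).
  apply/matrixP => i j; rewrite !mxE.
  apply/cvg_lim => //; rewrite -(cvg_shiftS (fun k => Y k i j)).
  under eq_fun do rewrite YS !mxE.
  apply: cvgMl_tmp; apply: cvgD; first exact: cvg_cst.
  by apply: (cvgr_sum (f := fun l k => Y k i l * Y k l j)) => l; apply: cvgM; exact: cL.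
have sL : L^T = L.
  apply/matrixP => i j; rewrite !mxE; congr (limn _); apply/funext => k.
  by rewrite -[in LHS](psdY k).1 mxE.
exists (1%:M - L); split.
  split=> [|x]; first by rewrite linearB /= trmx1 sL.
  rewrite mulmxBr mulmxBl !mxLE subr_ge0.
  apply: (cvgr_to_le (cq x)); apply: nearW => k.
  by have := (psdY1 k).2 x; rewrite mulmxBr mulmxBl !mxLE subr_ge0.
apply/matrixP => i j; rewrite mulmxBl mul1mx mulmxBr mulmx1 !mxLE.
by rewrite {1 2}LS !mxLE; field.
Qed.

End iteration.

(** Let [q] be the form of [A] at [x]. Cauchy-Schwarz in each coordinate gives
    [sqnorm (A *m x) <= \tr A * q], and [q ^+ 2 <= sqnorm x * sqnorm (A *m x)]; dividing by [q]
    concludes. *)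
Lemma psd_le_tr d (A : 'M[R]_d) : psd A -> psd ((\tr A)%:M - A).
Proof.
move=> pA; split=> [|x]; first by rewrite linearB /= tr_scalar_mx pA.1.
rewrite mulmxBr mulmxBl !mxLE subr_ge0 -scalemx1 -scalemxAr mulmx1 -scalemxAl !mxLE.
rewrite -sqnormE.
have t0 := psd_tr_ge0 pA.
have h : sqnorm (A *m x) <= \tr A * (x^T *m A *m x) 0 0.
  rewrite /sqnorm /mxtrace mulr_suml; apply: ler_sum => i _.
  have := psd_CS (delta_mx i 0) x pA.
  by rewrite trmx_delta -!rowE -colE -row_mul !mxE.
have := psd_CS x (A *m x) (psd1 R d); rewrite mulmx1 -sqnormE mulmx1 -sqnormE mulmxA => h2.
have q0 := pA.2 x; set q := (x^T *m A *m x) 0 0 in h h2 q0 *.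
have [->|qn0] := eqVneq q 0; first by rewrite mulr_ge0// sqnorm_ge0.
have qp : 0 < q by rewrite lt_def qn0.
rewrite -(ler_pM2l qp) -expr2 (le_trans h2)//.
rewrite (_ : q * _ = sqnorm x * (\tr A * q)); last by ring.
by apply: ler_wpM2l => //; exact: sqnorm_ge0.
Qed.

(** Division by the trace brings [A] between 0 and 1, where the iteration applies to
    [1 - A / \tr A]; the square root of the trace then rescales the result. *)
Lemma psd_sqrt d (A : 'M[R]_d) : psd A -> exists B, psd B /\ B *m B = A.
Proof.
case: d A => [|d] A pA.
  by exists 0; split; [exact: psd0|apply/matrixP => -[]].
have [tr0|trn0] := eqVneq (\tr A) 0.
  exists 0; split; first exact: psd0.
  rewrite mulmx0; apply/esym/psd_anti => //.
  by have := psd_le_tr pA; rewrite tr0 raddf0 sub0r.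
have trp : 0 < \tr A by rewrite lt_def trn0 psd_tr_ge0.
have ti : 0 <= (\tr A)^-1 by rewrite invr_ge0 ltW.
have E : (\tr A)^-1 *: A = 1%:M - (1%:M - (\tr A)^-1 *: A) by rewrite opprB addrC subrK.
have pB : psd (1%:M - (\tr A)^-1 *: A).
  have -> : 1%:M - (\tr A)^-1 *: A = (\tr A)^-1 *: ((\tr A)%:M - A).
    by rewrite scalerBr scale_scalar_mx mulVf.
  by apply: psdZ => //; exact: psd_le_tr.
have [|Z [pZ Z2]] := psd_onem_sqrt pB; first by rewrite -E; exact: psdZ.
exists (Num.sqrt (\tr A) *: Z); split; first by apply: psdZ; rewrite ?sqrtr_ge0.
rewrite -scalemxAl -scalemxAr scalerA -expr2 sqr_sqrtr ?ltW// Z2 -E scalerA.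
by rewrite mulfV// scale1r.
Qed.

Lemma sqrtmP d (A : 'M[R]_d) : psd A -> psd (sqrtm A) /\ sqrtm A *m sqrtm A = A.
Proof.
move=> pA; rewrite /sqrtm; case: pselect => [P|]; last by have := psd_sqrt pA.
exact: projT2 (cid P).
Qed.

Lemma psd_mulmx_tr_ge0 d (A B : 'M[R]_d) : psd A -> psd B -> 0 <= \tr (A *m B).
Proof.
move=> /sqrtmP[pS {1}<-] pB; rewrite -mulmxA mxtrace_mulC.
by have := psd_congr (sqrtm A) pB; rewrite pS.1; exact: psd_tr_ge0.
Qed.

End sqrt_matrix.

(** * The Gelbrich distance *)

Section lambda_min.
Variable R : realType.

Lemma qformB_scalar d (A : 'M[R]_d) c (x : 'cV[R]_d) :
  (x^T *m (A - c%:M) *m x) 0 0 = (x^T *m A *m x) 0 0 - c * sqnorm x.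
Proof.
rewrite mulmxBr mulmxBl !mxLE -scalemx1 -scalemxAr mulmx1 -scalemxAl !mxLE.
by rewrite -sqnormE.
Qed.

Lemma sqnorm_gt0 d (x : 'cV[R]_d) : x != 0 -> 0 < sqnorm x.
Proof.
by move=> x0; rewrite lt_def sqnorm_ge0 andbT; apply: contra_neq x0; exact: sqnorm_eq0.
Qed.

(** Let [l] be the largest number with [A - l%:M] positive semidefinite. This matrix is not positive
    definite, as [pd_lower] would leave room above the supremum; hence it has a kernel vector, and
    [l] is an eigenvalue. Evaluating the form at eigenvectors shows that no eigenvalue is
    smaller. *)
Lemma lambda_minP d (A : 'M[R]_d) : (0 < d)%N -> psd A ->
  psd (A - (lambda_min A)%:M) /\ eigenvalue A (lambda_min A).
Proof.
move=> d0 pA; pose S := [set l : R | psd (A - l%:M)].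
have S0 : S 0 by rewrite /S /= raddf0 subr0.
have Sub x l : x != 0 -> S l -> l <= (x^T *m A *m x) 0 0 / sqnorm x.
  move=> x0 [_ /(_ x)]; rewrite qformB_scalar subr_ge0 => h.
  by rewrite ler_pdivlMr ?sqnorm_gt0.
have nzd : (delta_mx (Ordinal d0) 0 : 'cV[R]_d) != 0.
  apply/eqP => /matrixP /(_ (Ordinal d0) 0); rewrite !mxE !eqxx => /eqP.
  by rewrite oner_eq0.
have hS : has_sup S.
  by split; [exists 0|eexists => l Sl; exact: (Sub _ _ nzd Sl)].
set l := sup S.
have pl : psd (A - l%:M).
  split=> [|x]; first by rewrite linearB /= tr_scalar_mx pA.1.
  rewrite qformB_scalar subr_ge0; have [->|x0] := eqVneq x 0.
    by rewrite mulmx0 /sqnorm big1 ?mulr0 ?mxE// => i _; rewrite mxE expr0n.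
  rewrite -ler_pdivlMr ?sqnorm_gt0//; apply: sup_le_ub; first by exists 0.
  by move=> k; exact: Sub.
have npl : ~ pd (A - l%:M).
  move=> /pd_lower[e e0]; rewrite -addrA -opprD -raddfD => h.
  have := sup_upper_bound hS h; rewrite -/l gerDl leNgt e0//.
have [x x0 lx] := psd_notpd pl npl.
have el : eigenvalue A l.
  apply/eigenvalueP; exists x^T; last by rewrite trmx_eq0.
  apply: trmx_inj; rewrite trmx_mul linearZ /= trmxK pA.1.
  by move/eqP: lx; rewrite mulmxBl subr_eq0 mul_scalar_mx => /eqP.
suff -> : lambda_min A = l by [].
rewrite /lambda_min; apply/eqP; rewrite eq_le; apply/andP; split.
  apply: ge_inf => //; exists l => a /eigenvalueP[v va v0].
  have := pl.2 v^T; rewrite qformB_scalar trmxK va -scalemxAl mxLE subr_ge0.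
  rewrite -[X in (X *m _) 0 0]trmxK -sqnormE ler_pM2r// sqnorm_gt0//.
  by rewrite trmx_eq0.
apply: lb_le_inf; first by exists l.
move=> a /eigenvalueP[v va v0].
have := pl.2 v^T; rewrite qformB_scalar trmxK va -scalemxAl mxLE subr_ge0.
rewrite -[X in (X *m _) 0 0]trmxK -sqnormE ler_pM2r// sqnorm_gt0//.
by rewrite trmx_eq0.
Qed.

Lemma eigenvalue_psd_ge0 d (A : 'M[R]_d) a : psd A -> eigenvalue A a -> 0 <= a.
Proof.
move=> pA /eigenvalueP[v va v0]; have := pA.2 v^T.
rewrite trmxK va -scalemxAl mxLE -[X in (X *m _) 0 0]trmxK -sqnormE.
by rewrite pmulr_lge0// sqnorm_gt0// trmx_eq0.
Qed.

Lemma eigenvalue_pd_gt0 d (A : 'M[R]_d) a : pd A -> eigenvalue A a -> 0 < a.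
Proof.
move=> [_ pA] /eigenvalueP[v va v0]; have := pA v^T.
rewrite trmx_eq0 trmxK va -scalemxAl mxLE -[X in (X *m _) 0 0]trmxK -sqnormE.
by move=> /(_ v0); rewrite pmulr_lgt0// sqnorm_gt0// trmx_eq0.
Qed.

End lambda_min.

Section regularized_inverse.
Variables (R : realType) (d : nat) (X : 'M[R]_d) (e : R).
Hypotheses (pX : psd X) (e0 : 0 < e).

Let G := invmx (X + e%:M).

Lemma reg_pd : pd (X + e%:M). Proof. by apply: psd_pdD => //; exact: pd_scalar. Qed.

Let uP := pd_unit reg_pd.

Lemma reg_psd : psd G. Proof. by apply: psd_inv => //; exact/pd_psd/reg_pd. Qed.

Lemma reg_mulr : X *m G = 1%:M - e *: G.
Proof. by rewrite -[X](addrK e%:M) mulmxBl mulmxV// mul_scalar_mx. Qed.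

Lemma reg_mull : G *m X = 1%:M - e *: G.
Proof. by rewrite -[X](addrK e%:M) mulmxBr mulVmx// mul_mx_scalar. Qed.

(** [G] stands in for the inverse of a possibly singular [X]: with a true inverse the difference
    would be 0, and regularization only makes it larger. *)
Lemma reg_contraction : psd (1%:M - G *m (X *m X) *m G).
Proof.
have -> : 1%:M - G *m (X *m X) *m G = e *: G + e *: (G *m X *m G).
  rewrite mulmxA -mulmxA reg_mulr reg_mull !(mulmxBl, mulmxBr).
  rewrite -!(scalemxAl, scalemxAr) !(mul1mx, mulmx1).
  by apply/matrixP => i j; rewrite !mxLE; ring.
have pG := reg_psd.
apply: psdD; apply: psdZ => //; rewrite ?(ltW e0)//.
by have := psd_congr G pX; rewrite pG.1.
Qed.

End regularized_inverse.

Section gelbrich.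
Variables (R : realType) (d : nat).
Implicit Types (S Sh C : 'M[R]_d).

(** Trace of the congruence by the stacked matrices [U] and [V]. Each choice of them is a dual
    certificate that bounds [\tr C]. *)
Lemma block_psd_tr S C Sh (U V : 'M[R]_d) : psd (block_mx S C C^T Sh) ->
  0 <= \tr (U^T *m S *m U) + 2 * \tr (U^T *m C *m V) + \tr (V^T *m Sh *m V).
Proof.
move=> /(psd_congrT (col_mx U V)) /psd_tr_ge0.
rewrite tr_col_mx mul_row_block mul_row_col !mulmxDl !linearD /=.
suff -> : \tr (V^T *m C^T *m U) = \tr (U^T *m C *m V) by lra.
by rewrite -mxtrace_tr !trmx_mul !trmxK mulmxA.
Qed.

(** Weak duality. If [A] and [T] were invertible, the test matrices [A T^(-1/2)] and
    [- A^-1 T^(1/2)] would give diagonal traces [\tr T] each and the cross trace [- \tr C], hence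
    [\tr C <= \tr T]. The proof runs this with [T + e] and [A + e] and controls the defect by a
    second test. *)
Lemma gelbrich_lower S C Sh : psd S -> psd Sh -> psd (block_mx S C C^T Sh) ->
  \tr C <= \tr (sqrtm (sqrtm Sh *m S *m sqrtm Sh)).
Proof.
move=> pS pSh pB; have [pA A2] := sqrtmP pSh; set A := sqrtm Sh in pA A2 *.
have pASA : psd (A *m S *m A) by have := psd_congr A pS; rewrite pA.1.
have [pT T2] := sqrtmP pASA; set T := sqrtm _ in pT T2 *.
suff h (e : R) : 0 < e -> 2 * \tr C <= 2 * \tr T + e * (2 * d%:R + \tr S).
  rewrite -(ler_pM2l (ltr0Sn R 1)); apply/ler_addgt0Pr => e e0.
  have c0 : 0 < 2 * d%:R + \tr S + 1 :> R.
    by rewrite ltr_wpDl// addr_ge0 ?mulr_ge0// psd_tr_ge0.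
  apply: (le_trans (h (e / (2 * d%:R + \tr S + 1)) (divr_gt0 e0 c0))).
  rewrite lerD2l -mulrA ger_pMr// ler_pdivrMl// mulr1 lerDl//.
move=> e0; set P := T + e%:M; set D := A + e%:M; set G := invmx D.
have pdP := reg_pd pT e0; have pdD := reg_pd pA e0.
have pG : psd G by exact: reg_psd.
have [pR R2] := sqrtmP (pd_psd pdP); set r := sqrtm _ in pR R2.
have ur : r \in unitmx.
  have := pd_unit pdP; rewrite -R2 unitmx_mul => /andP[]//.
have RP : r *m r = P by [].
have iP : invmx P = invmx r *m invmx r.
  rewrite -[LHS]mulmx1 -(mulmxV ur) -[X in _ *m (X *m _)](mulmxK ur) RP.
  by rewrite -!mulmxA mulKmx ?mulmxA//; exact: pd_unit.
have pc := reg_contraction pA e0; rewrite -/G in pc.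
(* The regularized certificate; its cross trace is [- \tr (A *m C *m G)], which misses [- \tr C] by
   [e * \tr (C *m G)]. *)
have h1 := block_psd_tr (A *m invmx r) (- (G *m r)) pB.
(* This test bounds the defect: [2 * \tr (C *m G) <= \tr S + d%:R], uniformly in [e]. *)
have h2 := block_psd_tr 1%:M (- G) pB.
have trP : \tr P = \tr T + d%:R * e by rewrite linearD /= mxtrace_scalar mulr_natl.
have E1 : \tr ((A *m invmx r)^T *m S *m (A *m invmx r)) <= \tr T.
  have -> : \tr ((A *m invmx r)^T *m S *m (A *m invmx r)) =
            \tr (invmx P *m (T *m T)).
    rewrite T2 iP trmx_mul trmx_inv pR.1 pA.1.
    by rewrite [RHS]mxtrace_mulC !mulmxA [RHS]mxtrace_mulC !mulmxA.
  rewrite mulmxA /P reg_mull// mulmxBl mul1mx linearB /= gerBl -scalemxAl linearZ /=.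
  apply: mulr_ge0; first exact: ltW.
  by apply: psd_mulmx_tr_ge0 => //; exact: reg_psd.
have E2 : \tr ((- (G *m r))^T *m Sh *m (- (G *m r))) <= \tr P.
  have -> : \tr ((- (G *m r))^T *m Sh *m (- (G *m r))) =
            \tr (P *m (G *m (A *m A) *m G)).
    rewrite A2 -{1}RP [(- _)^T]linearN /= !mulNmx mulmxN opprK.
    by rewrite trmx_mul pR.1 pG.1 mulmxA mxtrace_mulC !mulmxA.
  rewrite -subr_ge0 -linearB /= -{1}[P]mulmx1 -mulmxBr.
  by apply: psd_mulmx_tr_ge0 => //; exact: pd_psd.
have E3 : \tr ((A *m invmx r)^T *m C *m (- (G *m r))) = - \tr (A *m C *m G).
  rewrite mulmxN [LHS]linearN /=; congr (- _).
  rewrite trmx_mul trmx_inv pR.1 pA.1 -!mulmxA mxtrace_mulC -!mulmxA mulmxV//.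
  by rewrite mulmx1.
have E4 : \tr C = \tr (A *m C *m G) + e * \tr (C *m G).
  rewrite -mulmxA mxtrace_mulC -mxtraceZ -mxtraceD -mul_mx_scalar -mulmxDr.
  by rewrite -mulmxA mulVmx ?mulmx1//; exact: pd_unit.
rewrite [(- G)^T]linearN /= pG.1 in h2.
have E5 : \tr (- G *m Sh *m - G) <= d%:R.
  rewrite -A2 !mulNmx mulmxN opprK -subr_ge0.
  by have := psd_tr_ge0 pc; rewrite linearB /= mxtrace1.
rewrite trmx1 !mul1mx mulmx1 mulmxN [\tr (- _)]linearN /= in h2.
rewrite E3 in h1.
have h3 : 2 * \tr (C *m G) <= \tr S + d%:R by lra.
have h4 : 2 * \tr (A *m C *m G) <= 2 * \tr T + d%:R * e by lra.
have h5 : e * (2 * \tr (C *m G)) <= e * (\tr S + d%:R) by rewrite ler_pM2l.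
rewrite E4; lra.
Qed.

Lemma psd_block_dr (X : 'M[R]_d) : psd X -> psd (block_mx 0 0 0 X : 'M[R]_(d + d)).
Proof.
move=> /(psd_congr (col_mx 0 1%:M : 'M[R]_(d + d, d))).
by rewrite mul_col_mx mul0mx mul1mx tr_col_mx trmx0 trmx1 mul_col_row !mul0mx mulmx0 mulmx1.
Qed.

Lemma psd_block_ul (X : 'M[R]_d) : psd X -> psd (block_mx X 0 0 0 : 'M[R]_(d + d)).
Proof.
move=> /(psd_congr (col_mx 1%:M 0 : 'M[R]_(d + d, d))).
by rewrite mul_col_mx mul0mx mul1mx tr_col_mx trmx0 trmx1 mul_col_row !mul0mx mulmx0 mulmx1.
Qed.

Lemma psd_block_gram (L1 L2 : 'M[R]_d) (X : 'M[R]_d) : psd X ->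
  psd (block_mx (L1 *m X *m L1^T) (L1 *m X *m L2^T)
    (L2 *m X *m L1^T) (L2 *m X *m L2^T)).
Proof.
move=> /(psd_congr (col_mx L1 L2)).
by rewrite mul_col_mx tr_col_mx mul_col_row.
Qed.

(** The optimal transport map between the centered normal laws is [A T^-1 A]. With [iP] in place of
    the inverse of [T], the witness is the covariance of a vector with its image under this map. *)
Lemma gelbrich_upper S Sh (e : R) : psd S -> psd Sh -> 0 < e ->
  exists C, psd (block_mx S C C^T Sh) /\
    \tr (sqrtm (sqrtm Sh *m S *m sqrtm Sh)) - e * d%:R <= \tr C.
Proof.
move=> pS pSh e0; have [pA A2] := sqrtmP pSh; set A := sqrtm Sh in pA A2 *.
have [pB B2] := sqrtmP pS; set B := sqrtm S in pB B2 *.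
have pASA : psd (A *m S *m A) by have := psd_congr A pS; rewrite pA.1.
have [pT T2] := sqrtmP pASA; set T := sqrtm _ in pT T2 *.
set iP := invmx (T + e%:M).
have piP : psd iP by exact: reg_psd.
have pc := reg_contraction pT e0; rewrite -/iP T2 in pc.
exists (S *m A *m iP *m A); split.
  (* The regularized map produces too small a covariance; the missing part of [Sh] is added in the
     lower right corner and is positive semidefinite by [reg_contraction]. *)
  have := psdD (psd_block_gram B (A *m iP *m A *m B) (psd1 R d))
    (psd_block_dr (psd_congr A pc)).
  rewrite add_block_mx !addr0 !mulmx1 !trmx_mul pA.1 pB.1 piP.1 B2.
  rewrite (_ : B *m (B *m _) = S *m A *m iP *m A); last by rewrite -B2 !mulmxA.
  rewrite (_ : A *m iP *m A *m B *m B = A *m (iP *m (A *m S))); last first.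
    by rewrite -B2 !mulmxA.
  rewrite pS.1.
  suff -> : A *m iP *m A *m B *m (B *m (A *m (iP *m A))) +
      A *m (1%:M - iP *m (A *m S *m A) *m iP) *m A = Sh by [].
  by rewrite mulmxBr mulmxBl mulmx1 A2 -B2 !mulmxA addrC subrK.
rewrite -!mulmxA mxtrace_mulC -!mulmxA mxtrace_mulC -!mulmxA.
rewrite (_ : iP *m _ = iP *m (T *m T)); last by rewrite T2 !mulmxA.
rewrite mulmxA reg_mull// mulmxBl mul1mx linearB /= lerD2l lerN2.
rewrite -scalemxAl linearZ /= ler_pM2l// reg_mull// linearB /= mxtrace1 gerBl.
by rewrite linearZ /= mulr_ge0 ?(ltW e0)// psd_tr_ge0.
Qed.

End gelbrich.

(** * Compactness of sets of positive semidefinite matrices *)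

Section matrix_compactness.
Variable R : realType.

Lemma rV_scalar_continuous k (f : 'rV[R]_k -> R) : scalar f -> continuous f.
Proof.
move=> lf; have fD u v : f (u + v) = f u + f v by rewrite -{1}[u]scale1r lf mul1r.
have f0 : f 0 = 0 by apply: (addrI (f 0)); rewrite -fD !addr0.
have fZ a u : f (a *: u) = a * f u by rewrite -[a *: u]addr0 lf f0 addr0.
have -> : f = fun v => \sum_j v 0 j * f (delta_mx 0 j).
  apply/funext => v; rewrite {1}(row_sum_delta v).
  by elim/big_rec2 : _ => // j y1 y2 _ <-; rewrite fD fZ.
apply: continuous_big => [|j _ v]; first exact: add_continuous.
by apply: cvgMr_tmp; [exact: (nbhs_filter v)|exact: (@coord_continuous R 1 k 0 j)].
Qed.

Lemma closed_scalar_le k (f : 'rV[R]_k -> R) c : scalar f -> closed [set v | f v <= c].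
Proof.
move=> lf; apply: (@closed_comp _ _ f [set y | y <= c]); last exact: closed_le.
by move=> x _; exact: rV_scalar_continuous.
Qed.

Lemma closed_scalar_ge k (f : 'rV[R]_k -> R) c : scalar f -> closed [set v | c <= f v].
Proof.
move=> lf; apply: (@closed_comp _ _ f [set y | c <= y]); last exact: closed_ge.
by move=> x _; exact: rV_scalar_continuous.
Qed.

Lemma closed_scalar_eq k (f : 'rV[R]_k -> R) c : scalar f -> closed [set v | f v = c].
Proof.
move=> lf; apply: (@closed_comp _ _ f [set y | y = c]); last exact: closed_eq.
by move=> x _; exact: rV_scalar_continuous.
Qed.

Lemma closed_mx_eq k p q (f : 'rV[R]_k -> 'M[R]_(p, q)) (A : 'M[R]_(p, q)) :
  linear f -> closed [set v | f v = A].
Proof.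
move=> lf; have -> : [set v | f v = A] =
    \bigcap_i [set v | f v i.1 i.2 = A i.1 i.2].
  apply/seteqP; split=> v /=.
    by move=> <- i _.
  by move=> h; apply/matrixP => i j; have := h (i, j) I.
apply: closed_bigI => i _; apply: closed_scalar_eq => a u v.
by rewrite lf !mxLE.
Qed.

Lemma closed_psd k d (f : 'rV[R]_k -> 'M[R]_d) (A : 'M[R]_d) :
  linear f -> closed [set v | psd (f v - A)].
Proof.
move=> lf; have -> : [set v | psd (f v - A)] =
  [set v | (f v)^T - f v = A^T - A] `&`
  \bigcap_(x : 'cV[R]_d) [set v | (x^T *m A *m x) 0 0 <= (x^T *m f v *m x) 0 0].
  apply/seteqP; split=> v /=.
    move=> [sf hf]; split.
      have -> : (f v)^T = f v - A + A^T by rewrite -sf -linearD /= subrK.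
      by rewrite addrC !addrA addNr add0r addrC.
    by move=> x _; have := hf x; rewrite mulmxBr mulmxBl !mxLE subr_ge0.
  move=> [sf hf]; split.
    rewrite linearB /= -[(f v)^T](subrK (f v)) sf.
    by apply/matrixP => i j; rewrite !mxLE; ring.
  by move=> x; have := hf x I; rewrite mulmxBr mulmxBl !mxLE subr_ge0.
apply: closedI.
  apply: closed_mx_eq => a u v; rewrite lf linearP /= scalerBr.
  by rewrite opprD addrACA.
apply: closed_bigI => x _; apply: closed_scalar_ge => a u v.
by rewrite lf mulmxDr mulmxDl -scalemxAr -scalemxAl !mxLE.
Qed.

Lemma psd_entry_le d (N : 'M[R]_d) i j : psd N -> `|N i j| <= \tr N.
Proof.
move=> pN; have e i' j' : ((delta_mx i' 0)^T *m N *m delta_mx j' 0 : 'M[R]_1) 0 0 = N i' j'.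
  by rewrite trmx_delta -rowE -colE !mxE.
have di k : 0 <= N k k by rewrite -e; exact: pN.2.
have dt k : N k k <= \tr N.
  rewrite /mxtrace (bigD1 k)//= lerDl; apply: sumr_ge0 => l _; exact: di.
have := psd_CS (delta_mx i 0) (delta_mx j 0) pN; rewrite !e => h.
rewrite -(@ler_pXn2r _ 2)// ?nnegrE ?psd_tr_ge0//.
rewrite real_normK ?num_real// (le_trans h)// expr2.
by apply: ler_pM.
Qed.

(** A trace bound dominates all entries of a positive semidefinite matrix, so it bounds the
    flattened matrix in the maximum norm. *)
Lemma psd_compact d (t : R) (K : set 'M[R]_d) :
  (forall N, K N -> psd N /\ \tr N <= t) ->
  closed [set v | K (vec_mx v)] -> compact [set v | K (vec_mx v)].
Proof.
move=> hK cK; apply: bounded_closed_compact => //.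
exists `|t|; split; first exact: num_real.
move=> M tM v /= /hK[pv tv].
rewrite [`|v|]mx_normrE; apply: bigmax_le => [|[i k] _ /=].
  by rewrite (le_trans _ (ltW tM)).
rewrite ord1 -[v]vec_mxK; case/mxvec_indexP : k => a b; rewrite mxvecE.
apply: (le_trans (psd_entry_le a b pv)); rewrite (le_trans tv)//.
by rewrite (le_trans (ler_norm _))// ltW.
Qed.

End matrix_compactness.

(** * Gelbrich balls as projections of spectrahedra *)

Section sdp.
Variables (R : realType) (d : nat).
Implicit Types (S Sh C : 'M[R]_d) (rho l : R).

(** The Gelbrich ball as a linear matrix inequality; [C] plays the part of the cross covariance of a
    coupling. Convexity is immediate in this form. *)
Definition sdp_le S Sh rho := exists C : 'M[R]_d,
  psd (block_mx S C C^T Sh) /\ \tr S + \tr Sh - 2 * \tr C <= rho ^+ 2.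

(** The lift of the ball to block matrices, cut by a lower bound on the covariance block. It is
    described by closed conditions and is compact, and [sdp_le] is its projection to the upper left
    block. *)
Definition sdp_set Sh rho l : set 'M[R]_(d + d) :=
  [set N | [/\ psd N, drsubmx N = Sh,
     \tr (ulsubmx N) + \tr Sh - 2 * \tr (ursubmx N) <= rho ^+ 2 &
     psd (ulsubmx N - l%:M)]].

Lemma ulsubmx_linear : linear (fun v => ulsubmx (vec_mx v : 'M[R]_(d + d))).
Proof. by move=> a u v; rewrite linearP; apply/matrixP => i j; rewrite !mxE. Qed.

Lemma ursubmx_linear : linear (fun v => ursubmx (vec_mx v : 'M[R]_(d + d))).
Proof. by move=> a u v; rewrite linearP; apply/matrixP => i j; rewrite !mxE. Qed.

Lemma drsubmx_linear : linear (fun v => drsubmx (vec_mx v : 'M[R]_(d + d))).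
Proof. by move=> a u v; rewrite linearP; apply/matrixP => i j; rewrite !mxE. Qed.

Lemma psd_submx (N : 'M[R]_(d + d)) : psd N ->
  block_mx (ulsubmx N) (ursubmx N) (ursubmx N)^T (drsubmx N) = N.
Proof. by move=> pN; rewrite trmx_ursub pN.1 submxK. Qed.

Lemma psd_blockP S C Sh : psd (block_mx S C C^T Sh) -> psd S /\ psd Sh.
Proof.
move=> pN; split.
  have := psd_congrT (col_mx 1%:M 0) pN.
  by rewrite tr_col_mx trmx1 trmx0 mul_row_block mul_row_col !(mul1mx, mul0mx, mulmx1, mulmx0, addr0).
have := psd_congrT (col_mx 0 1%:M) pN.
by rewrite tr_col_mx trmx1 trmx0 mul_row_block mul_row_col !(mul1mx, mul0mx, mulmx1, mulmx0, addr0, add0r).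
Qed.

Lemma sdp_leP S Sh rho l : psd (S - l%:M) ->
  sdp_le S Sh rho <-> exists2 N, sdp_set Sh rho l N & ulsubmx N = S.
Proof.
move=> pl; split.
  move=> [C [pN h]]; exists (block_mx S C C^T Sh); last by rewrite block_mxKul.
  by split; rewrite ?block_mxKul ?block_mxKdr ?block_mxKur.
move=> [N [pN <- h _] <-]; exists (ursubmx N); split=> //.
by rewrite psd_submx.
Qed.

Lemma sdp_tr_le Sh rho S C : psd (block_mx S C C^T Sh) ->
  \tr S + \tr Sh - 2 * \tr C <= rho ^+ 2 -> \tr S <= 2 * rho ^+ 2 + 2 * \tr Sh.
Proof.
(* The weight -2 bounds [2 * \tr C] by half of [\tr S] plus [2 * \tr Sh], and that half is absorbed
   on the left. *)
move=> pN; have := block_psd_tr 1%:M ((-2)%:M) pN.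
rewrite trmx1 !mul1mx mulmx1 tr_scalar_mx !mul_mx_scalar mul_scalar_mx !mxtraceZ.
lra.
Qed.

Lemma sdp_set_compact Sh rho l : compact [set v | sdp_set Sh rho l (vec_mx v)].
Proof.
apply: (@psd_compact _ _ (2 * rho ^+ 2 + 2 * \tr Sh + \tr Sh)) => [N [pN dN tN _]|].
  split=> //; rewrite -[N]submxK mxtrace_block dN lerD2r.
  by apply: (sdp_tr_le (C := ursubmx N)) => //; rewrite -dN psd_submx.
have -> : [set v | sdp_set Sh rho l (vec_mx v)] =
  [set v | psd (vec_mx v - (0 : 'M[R]_(d + d)))] `&`
  [set v | drsubmx (vec_mx v) = Sh] `&`
  [set v | \tr (ulsubmx (vec_mx v)) - 2 * \tr (ursubmx (vec_mx v)) <= rho ^+ 2 - \tr Sh] `&`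
  [set v | psd (ulsubmx (vec_mx v) - l%:M)].
  apply/seteqP; split=> v /=.
    by move=> [h1 h2 h3 h4]; rewrite subr0; split => //; split => //; lra.
  by move=> [[[]]]; rewrite subr0 => h1 h2 h3 h4; split => //; lra.
apply: closedI; first apply: closedI; first apply: closedI.
- by apply: closed_psd => a u v; rewrite linearP.
- exact: closed_mx_eq drsubmx_linear.
- apply: closed_scalar_le => a u v.
  by rewrite ulsubmx_linear ursubmx_linear !mxtraceD !mxtraceZ; ring.
- exact: closed_psd ulsubmx_linear.
Qed.

(** The admissible [C] form a compact set, so [\tr C] attains its maximum there, and the error
    [e * d%:R] of [gelbrich_upper] disappears. *)
Lemma sdp_exact S Sh : psd S -> psd Sh -> exists C, psd (block_mx S C C^T Sh) /\
  \tr C = \tr (sqrtm (sqrtm Sh *m S *m sqrtm Sh)).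
Proof.
move=> pS pSh.
pose K := [set N : 'M[R]_(d + d) | [/\ psd N, ulsubmx N = S & drsubmx N = Sh]].
have cK : compact [set v | K (vec_mx v)].
  apply: (@psd_compact _ _ (\tr S + \tr Sh)) => [N [pN uN dN]|].
    by split => //; rewrite -[N]submxK mxtrace_block uN dN.
  have -> : [set v | K (vec_mx v)] = [set v | psd (vec_mx v - (0 : 'M[R]_(d + d)))] `&`
      [set v | ulsubmx (vec_mx v) = S] `&` [set v | drsubmx (vec_mx v) = Sh].
    apply/seteqP; split=> v /=; first by move=> []; rewrite subr0.
    by move=> [[]]; rewrite subr0.
  apply: closedI; first apply: closedI.
  - by apply: closed_psd => a u v; rewrite linearP.
  - exact: closed_mx_eq ulsubmx_linear.
  - exact: closed_mx_eq drsubmx_linear.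
have KC C : psd (block_mx S C C^T Sh) -> K (vec_mx (mxvec (block_mx S C C^T Sh))).
  by move=> ?; rewrite mxvecK; split=> //; rewrite ?block_mxKul ?block_mxKdr.
have [C0 [pC0 _]] := gelbrich_upper pS pSh ltr01.
have [||c] := @compact_EVT_max _ R (fun v => \tr (ursubmx (vec_mx v : 'M[R]_(d + d)))) _ _ cK.
- by exists (mxvec (block_mx S C0 C0^T Sh)); exact: KC.
- apply: continuous_subspaceT; apply: rV_scalar_continuous => a u v.
  by rewrite ursubmx_linear !mxtraceD !mxtraceZ.
rewrite inE => -[pc uc dc] hc; exists (ursubmx (vec_mx c : 'M[R]_(d + d))).
have pb : psd (block_mx S (ursubmx (vec_mx c : 'M[R]_(d + d))) (ursubmx (vec_mx c : 'M[R]_(d + d)))^T Sh).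
  by rewrite -uc -dc psd_submx.
split => //; apply/eqP; rewrite eq_le gelbrich_lower//=.
apply/ler_addgt0Pr => e e0.
have d0 : 0 < d%:R + 1 :> R by rewrite ltr_wpDl.
have [C [pC hC]] := gelbrich_upper pS pSh (divr_gt0 e0 d0).
have := hc (mxvec (block_mx S C C^T Sh)); rewrite inE => /(_ (KC _ pC)).
rewrite mxvecK block_mxKur => hC2.
rewrite -lerBlDr; apply: le_trans hC2; apply: le_trans hC.
by rewrite lerD2l lerN2 -mulrA ger_pMr// ler_pdivrMl// mulr1 lerDl.
Qed.

Lemma gelbrich_sdp S Sh rho : psd S -> psd Sh ->
  gelbrich_le S Sh rho <-> sdp_le S Sh rho.
Proof.
move=> pS pSh; rewrite /gelbrich_le !linearB !linearD /= linearZ /=; split.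
  have [C [pC tC]] := sdp_exact pS pSh.
  by move=> h; exists C; rewrite tC.
move=> [C [pC hC]]; have := gelbrich_lower pS pSh pC; lra.
Qed.

Lemma sdp_convex S1 S2 Sh rho t : 0 <= t <= 1 -> sdp_le S1 Sh rho ->
  sdp_le S2 Sh rho -> sdp_le ((1 - t) *: S1 + t *: S2) Sh rho.
Proof.
move=> /andP[t0 t1] [C1 [p1 h1]] [C2 [p2 h2]]; exists ((1 - t) *: C1 + t *: C2).
have t1' : 0 <= 1 - t by rewrite subr_ge0.
split.
  have := psdD (psdZ t1' p1) (psdZ t0 p2).
  rewrite !scale_block_mx add_block_mx.
  rewrite (_ : _ *: Sh + _ *: Sh = Sh); last by rewrite -scalerDl subrK scale1r.
  by rewrite [(_ + _)^T]linearD /= ![(_ *: _)^T]linearZ.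
rewrite !mxtraceD !mxtraceZ.
have := lerD (ler_wpM2l t1' h1) (ler_wpM2l t0 h2); lra.
Qed.

End sdp.

(** * Maximal estimation error over the covariances *)

Section linear_maximization.
Variables (R : realType) (d : nat).
Implicit Types (G S Sh : 'M[R]_d).

Lemma mxtrace_nondegenerate p q (X : 'M[R]_(p, q)) :
  (forall D, \tr (D *m X) = 0) -> X = 0.
Proof.
move=> h; apply: trmx_inj; rewrite trmx0; apply: tr_gram_eq0.
by rewrite trmxK h.
Qed.

Lemma sdp_le_self Sh rho : psd Sh -> sdp_le Sh Sh rho.
Proof.
move=> pSh; exists Sh; split; last first.
  by have := sqr_ge0 rho; lra.
have := psd_block_gram 1%:M 1%:M pSh.
by rewrite trmx1 !mul1mx !mulmx1 pSh.1.
Qed.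

Lemma linear_maximizer_exists Sh G rho : psd Sh ->
  exists2 S, sdp_le S Sh rho & forall S', sdp_le S' Sh rho -> \tr (G *m S') <= \tr (G *m S).
Proof.
move=> pSh; have pl S : psd S -> psd (S - (0 : R)%:M) by rewrite raddf0 subr0.
have [||c] := @compact_EVT_max _ R
    (fun v => \tr (G *m ulsubmx (vec_mx v : 'M[R]_(d + d)))) _ _ (@sdp_set_compact R d Sh rho 0).
- have /(sdp_leP Sh rho (pl _ pSh))[N KN _] := sdp_le_self rho pSh.
  by exists (mxvec N); rewrite /= mxvecK.
- apply: continuous_subspaceT; apply: rV_scalar_continuous => a u v.
  by rewrite ulsubmx_linear mulmxDr -scalemxAr mxtraceD mxtraceZ.
rewrite inE /= => Kc hc; exists (ulsubmx (vec_mx c : 'M[R]_(d + d))).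
  by apply/(sdp_leP _ _ (l := 0)); [case: Kc|exists (vec_mx c)].
move=> S' hS'; have [C [/psd_blockP[pS' _] _]] := hS'.
have [N KN <-] := (sdp_leP Sh rho (pl _ pS')).1 hS'.
have := hc (mxvec N); rewrite inE /= mxvecK; exact.
Qed.

Section variation.
Variables (Sh G S : 'M[R]_d) (rho l : R).
Hypotheses (pdSh : pd Sh) (l0 : 0 < l) (pl : psd (Sh - l%:M)).
Hypotheses (pG : psd G) (G0 : G != 0).
Hypotheses (hS : sdp_le S Sh rho)
  (Smax : forall S', sdp_le S' Sh rho -> \tr (G *m S') <= \tr (G *m S)).

(* Writing the cross covariance as [M Sh] splits [S] as [M Sh M^T + E] with [E]
   positive semidefinite; [(M, E)] is then perturbed in the directions [(D, F)].
   The first order conditions are [G <= g] and [(g - G) M = g] for a multiplier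
   [g > 0], whence [M = g (g - G)^-1 >= 1]. *)
Lemma linear_maximizer_lower : psd (S - l%:M).
Proof.
have pSh := pd_psd pdSh; have uSh := pd_unit pdSh.
have [C [pN hC]] := hS.
have [M MSh] : exists M, M *m Sh = C by exists (C *m invmx Sh); rewrite mulmxKV.
have ShM : Sh *m M^T = C^T by rewrite -MSh trmx_mul pSh.1.
pose E := S - M *m Sh *m M^T.
have pE : psd E.
  have := psd_congrT (col_mx 1%:M (- M^T)) pN.
  rewrite tr_col_mx trmx1 [(- _)^T]linearN /= trmxK mul_row_block mul_row_col.
  rewrite !mul1mx mulmx1 !mulNmx MSh subrr mul0mx addr0.
  by rewrite -ShM /E mulmxA.
have SE : S = M *m Sh *m M^T + E by rewrite /E addrC subrK.
(* First order changes in the direction [(D, F)]: [a] of the transport cost, [b] of the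
   objective. *)
pose a (D F : 'M[R]_d) := 2 * \tr (D *m Sh *m (M - 1%:M)^T) + \tr F.
pose b (D F : 'M[R]_d) := 2 * \tr (G *m D *m Sh *m M^T) + \tr (G *m F).
have key D F : psd F -> a D F < 0 -> b D F <= 0.
  move=> pF aneg; pose q := \tr (D *m Sh *m D^T).
  have q0 : 0 <= q by apply/psd_tr_ge0/psd_congr.
  pose t := - a D F / (q + 1).
  have t0 : 0 < t by rewrite divr_gt0 ?oppr_gt0// ltr_wpDl.
  have tq : t * q <= - a D F.
    by rewrite /t mulrAC ler_pdivrMr ?ltr_wpDl// ler_wpM2l ?lerDl// oppr_ge0 ltW.
  pose Mt := M + t *: D; pose St := Mt *m Sh *m Mt^T + (E + t *: F).
  have MtT : Mt^T = M^T + t *: D^T by rewrite /Mt linearD /= linearZ.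
  have StE : St = S + t *: (D *m Sh *m M^T + M *m Sh *m D^T + F) + t ^+ 2 *: (D *m Sh *m D^T).
    rewrite /St MtT /Mt !mulmxDl !mulmxDr -!(scalemxAl, scalemxAr) SE.
    by apply/matrixP => i j; rewrite !mxLE; ring.
  have trDM : \tr (M *m Sh *m D^T) = \tr (D *m Sh *m M^T).
    by rewrite -mxtrace_tr !trmx_mul trmxK pSh.1 mulmxA.
  have Sfeas : sdp_le St Sh rho.
    exists (Mt *m Sh); split.
      have := psdD (psd_block_gram Mt 1%:M pSh) (psd_block_ul (psdD pE (psdZ (ltW t0) pF))).
      by rewrite add_block_mx !addr0 trmx1 !mul1mx !mulmx1 trmx_mul pSh.1.
    apply: le_trans hC; rewrite StE /Mt mulmxDl MSh -scalemxAl !(mxtraceD, mxtraceZ).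
    rewrite -[in C *m _]MSh trDM -/q.
    have : t * (a D F + t * q) <= 0.
      by rewrite pmulr_rle0//; lra.
    rewrite /a [(M - _)^T]linearB /= trmx1 mulmxBr mulmx1 linearB /=.
    move: (\tr (D *m Sh *m M^T)) (\tr (D *m Sh)) => x y; nra.
  have := Smax Sfeas; rewrite StE !mulmxDr -!scalemxAr !mulmxDr !mxtraceD !mxtraceZ !mxtraceD.
  have -> : \tr (G *m (M *m Sh *m D^T)) = \tr (G *m (D *m Sh *m M^T)).
    by rewrite -mxtrace_tr !trmx_mul trmxK pSh.1 pG.1 mxtrace_mulC !mulmxA.
  have : 0 <= t ^+ 2 * \tr (G *m (D *m Sh *m D^T)).
    apply: mulr_ge0; first exact: sqr_ge0.
    by apply: psd_mulmx_tr_ge0 => //; exact: psd_congr.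
  rewrite /b !mulmxA => h1 h2.
  have : t * (2 * \tr (G *m D *m Sh *m M^T) + \tr (G *m F)) <= 0 by lra.
  by rewrite pmulr_rle0.
have aD D D' F s : a (D + s *: D') F = a D F + s * a D' 0.
  by rewrite /a !mulmxDl -!scalemxAl mxtraceD mxtraceZ linear0 /=; ring.
have bD D D' F s : b (D + s *: D') F = b D F + s * b D' 0.
  rewrite /b mulmxDr !mulmxDl -!scalemxAr -!scalemxAl mxtraceD mxtraceZ.
  by rewrite mulmx0 linear0 /=; ring.
have [M1|Mn1] := eqVneq M 1%:M.
  have -> : S - l%:M = Sh - l%:M + E by rewrite SE M1 trmx1 mul1mx mulmx1 addrAC.
  exact: psdD.
(* Moving [M] towards the identity strictly lowers the cost: this is a Slater direction, and the
   quotient of the two derivatives along it is the multiplier [g]. *)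
pose D0 := - (M - 1%:M).
have a0 : a D0 0 < 0.
  rewrite /a /D0 linear0 addr0 !mulNmx linearN /= pmulr_rlt0// oppr_lt0.
  rewrite lt_def psd_tr_ge0 ?andbT; last exact: psd_congr.
  apply/eqP => t0.
  have [r [pr r2]] := psd_sqrt pSh.
  have : (M - 1%:M) *m r = 0.
    by apply: tr_gram_eq0; rewrite trmx_mul pr.1 mulmxA -(mulmxA _ r r) r2.
  move/(congr1 (mulmx^~ r)); rewrite mul0mx -mulmxA r2.
  move/(congr1 (mulmx^~ (invmx Sh))); rewrite mul0mx mulmxK//.
  by move/eqP; rewrite subr_eq0 (negPf Mn1).
have b0 : b D0 0 <= 0 by apply: key => //; exact: psd0.
pose g := b D0 0 / a D0 0.
have g0 : 0 <= g by rewrite /g -mulrNN -invrN divr_ge0// oppr_ge0// ltW.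
have bound D F : psd F -> b D F <= g * a D F.
  move=> pF; apply/ler_addgt0Pr => e e0.
  have g1 : 0 < g + 1 by rewrite ltr_wpDl.
  set e' := e / (g + 1).
  have e'0 : 0 < e' by exact: divr_gt0.
  (* A multiple of the Slater direction brings the first order cost to [- e'], so that [key] applies
     to an arbitrary direction. *)
  pose s := - (a D F + e') / a D0 0.
  have sa : s * a D0 0 = - (a D F + e') by rewrite /s divfK// lt_eqF.
  have := key (D + s *: D0) F pF; rewrite aD bD sa opprD addrA subrr sub0r.
  rewrite oppr_lt0 => /(_ e'0).
  have -> : s * b D0 0 = - (a D F + e') * g.
    by rewrite /s /g mulrAC mulrA.
  move=> h; have ge : g * e' <= e.
    rewrite /e' mulrA ler_pdivrMr// [leLHS]mulrC ler_wpM2l ?lerDl// ltW//.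
  nra.
have pgG : psd (g%:M - G).
  split=> [|x]; first by rewrite linearB /= tr_scalar_mx pG.1.
  have := bound 0 (x *m x^T) (psd_gram x).
  rewrite /a /b mulmx0 !mul0mx linear0 mulr0 !add0r -bform_tr => h.
  rewrite mulmxBr mulmxBl !mxLE subr_ge0 (le_trans h)//.
  by rewrite bform_tr mul_scalar_mx mxtraceZ.
have GM : G *m M = g *: (M - 1%:M).
  have h D : \tr (D *m (Sh *m (M^T *m G - g *: (M - 1%:M)^T))) = 0.
    have h1 D1 : 2 * \tr (D1 *m Sh *m (M^T *m G)) <= g * (2 * \tr (D1 *m Sh *m (M - 1%:M)^T)).
      have := bound D1 0 (psd0 R d); rewrite /a /b mulmx0 linear0 !addr0.
      by rewrite -!mulmxA mxtrace_mulC -!mulmxA.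
    have := h1 D; have := h1 (- D); rewrite !mulNmx ![\tr (- _)]linearN /= => h2 h3.
    rewrite mulmxA mulmxBr -scalemxAr linearB /= mxtraceZ; lra.
  have := mxtrace_nondegenerate h.
  move/(congr1 (mulmx (invmx Sh))); rewrite mulKmx// mulmx0 => /eqP.
  rewrite subr_eq0 => /eqP/(congr1 trmx).
  by rewrite trmx_mul pG.1 trmxK linearZ /= trmxK.
have gp : 0 < g.
  rewrite lt_def g0 andbT; apply: contra_neq G0 => g00.
  by apply: psd_anti => //; move: pgG; rewrite g00 raddf0 sub0r.
have PM : (g%:M - G) *m (g^-1 *: M) = 1%:M.
  rewrite -scalemxAr mulmxBl mul_scalar_mx GM -scalerBr opprB addrC subrK.
  by rewrite scalerA mulVf ?scale1r// gt_eqF.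
have MP := mulmx1C PM.
split=> [|v]; first by rewrite linearB /= tr_scalar_mx (psd_blockP pN).1.1.
have PMT : (g%:M - G) *m (g^-1 *: M^T) = 1%:M.
  have := congr1 trmx MP; rewrite trmx1 trmx_mul pgG.1 [(_ *: _)^T]linearZ; exact.
(* With [v = (g - G) w] and [M^T v = g w], both sides become forms in [w]; [0 <= g - G <= g] yields
   [sqnorm v <= g ^+ 2 * sqnorm w]. *)
pose w := (g^-1 *: M^T) *m v.
have Pw : (g%:M - G) *m w = v by rewrite /w mulmxA PMT mul1mx.
have wM : M^T *m v = g *: w by rewrite /w -scalemxAl scalerA mulfV ?scale1r// gt_eqF.
clearbody w.
have h1 : sqnorm v <= g ^+ 2 * sqnorm w.
  have pGG : psd (g%:M - (g%:M - G)) by rewrite opprB addrC subrK.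
  have := psd_sqr_le w g0 pgG pGG.
  have -> : (w^T *m ((g%:M - G) *m (g%:M - G)) *m w) 0 0 = sqnorm v.
    by rewrite sqnormE -{1 2}Pw trmx_mul pgG.1 !mulmxA.
  move=> h; apply: (le_trans h); rewrite expr2 -mulrA ler_wpM2l//.
  have := pG.2 w.
  rewrite -[G in X in X -> _](subKr g%:M) mulmxBr mulmxBl !mxLE subr_ge0 => h'.
  by apply: (le_trans h'); rewrite bform_tr mul_scalar_mx mxtraceZ -mxtrace_mulC -mx11_tr -sqnormE.
rewrite qformB_scalar subr_ge0 SE mulmxDr mulmxDl !mxLE.
apply: ler_wpDr; first exact: pE.2.
have -> : (v^T *m (M *m Sh *m M^T) *m v) 0 0 = g ^+ 2 * (w^T *m Sh *m w) 0 0.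
  have -> : v^T *m (M *m Sh *m M^T) *m v = (M^T *m v)^T *m Sh *m (M^T *m v).
    by rewrite trmx_mul trmxK !mulmxA.
  by rewrite wM [(_ *: _)^T]linearZ /= -!(scalemxAl, scalemxAr) !mxLE expr2 mulrA.
have := pl.2 w; rewrite qformB_scalar subr_ge0 => h2.
apply: (@le_trans _ _ (l * (g ^+ 2 * sqnorm w))); first by rewrite ler_wpM2l// ltW.
by rewrite mulrCA ler_wpM2l// sqr_ge0.
Qed.

End variation.

Lemma linear_maximizer Sh G rho : (0 < d)%N -> psd Sh -> psd G ->
  exists S, [/\ sdp_le S Sh rho, psd (S - (lambda_min Sh)%:M) &
    forall S', sdp_le S' Sh rho -> \tr (G *m S') <= \tr (G *m S)].
Proof.
move=> d0 pSh pG; have [pl el] := lambda_minP d0 pSh.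
have [G0|G0] := eqVneq G 0.
  exists Sh; split => // [|S' _]; first exact: sdp_le_self.
  by rewrite G0 !mul0mx.
have [S hS mS] := linear_maximizer_exists G rho pSh.
exists S; split => //.
have [C [pN _]] := hS.
(* For singular [Sh] the lower bound only says that [S] is positive semidefinite. *)
have [l0|ln0] := eqVneq (lambda_min Sh) 0.
  by rewrite l0 raddf0 subr0; have [] := psd_blockP pN.
have lp : 0 < lambda_min Sh by rewrite lt_def ln0 (eigenvalue_psd_ge0 pSh el).
apply: (linear_maximizer_lower _ _ _ pG G0 hS mS) => //.
have := psd_pdD pl (pd_scalar d lp); by rewrite subrK.
Qed.

End linear_maximization.

(** * Affine estimators and the saddle point inequality *)

Section mmse.
Variables (R : realType) (n m : nat) (H : 'M[R]_(m, n)).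
Implicit Types (K : 'M[R]_(n, m)) (Sx : 'M[R]_n) (Sw : 'M[R]_m).

(** Mean squared error of the affine estimator with gain [K] and matched means; the error is the
    centered [(1 - K H) x - K w]. *)
Definition lin_risk K Sx Sw : R :=
  \tr ((1%:M - K *m H) *m Sx *m (1%:M - K *m H)^T) + \tr (K *m Sw *m K^T).

(** The Kalman gain. *)
Definition gain Sx Sw : 'M[R]_(n, m) := Sx *m H^T *m invmx (H *m Sx *m H^T + Sw).

Lemma pd_innovation Sx Sw : psd Sx -> pd Sw -> pd (H *m Sx *m H^T + Sw).
Proof. by move=> px pw; apply: psd_pdD => //; exact: psd_congr. Qed.

Lemma gain_innovation Sx Sw : psd Sx -> pd Sw ->
  gain Sx Sw *m (H *m Sx *m H^T + Sw) = Sx *m H^T.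
Proof. by move=> px pw; rewrite /gain mulmxKV// pd_unit//; exact: pd_innovation. Qed.

Lemma lin_riskE K Sx Sw : Sx^T = Sx -> lin_risk K Sx Sw =
  \tr Sx - 2 * \tr (K *m (H *m Sx)) + \tr (K *m (H *m Sx *m H^T + Sw) *m K^T).
Proof.
move=> sx; rewrite /lin_risk [(1%:M - _)^T]linearB /= trmx1 !(mulmxBl, mulmxBr).
rewrite !mul1mx !mulmx1 mulmxDr mulmxDl !linearB linearD /=.
have -> : \tr (Sx *m (K *m H)^T) = \tr (K *m (H *m Sx)).
  by rewrite -mxtrace_tr trmx_mul trmxK sx mulmxA.
by rewrite trmx_mul !mulmxA; ring.
Qed.

(** Completion of the square in [K]. *)
Lemma lin_risk_gain K Sx Sw : psd Sx -> pd Sw ->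
  lin_risk K Sx Sw = mmse_obj H Sx Sw +
    \tr ((K - gain Sx Sw) *m (H *m Sx *m H^T + Sw) *m (K - gain Sx Sw)^T).
Proof.
move=> px pw; rewrite lin_riskE ?px.1//; have gV := gain_innovation px pw.
have pV := pd_innovation px pw.
have mE : mmse_obj H Sx Sw = \tr Sx - \tr (gain Sx Sw *m (H *m Sx)).
  by rewrite /mmse_obj /gain linearB /= !mulmxA.
move: (H *m Sx *m H^T + Sw) pV gV => V pV gV.
have Vg : V *m (gain Sx Sw)^T = H *m Sx.
  by rewrite -pV.1 -trmx_mul gV trmx_mul trmxK px.1.
rewrite mE [(K - _)^T]linearB /= !(mulmxBl, mulmxBr) gV !linearB /=.
rewrite -(mulmxA K V (gain Sx Sw)^T) Vg.
have -> : \tr (Sx *m H^T *m K^T) = \tr (K *m (H *m Sx)).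
  by rewrite -mxtrace_tr !trmx_mul !trmxK px.1 !mulmxA.
have -> : \tr (Sx *m H^T *m (gain Sx Sw)^T) = \tr (gain Sx Sw *m (H *m Sx)).
  by rewrite -mxtrace_tr !trmx_mul !trmxK px.1 !mulmxA.
by ring.
Qed.

Lemma mmse_le_lin_risk K Sx Sw : psd Sx -> pd Sw -> mmse_obj H Sx Sw <= lin_risk K Sx Sw.
Proof.
move=> px pw; rewrite lin_risk_gain// lerDl; apply/psd_tr_ge0/psd_congr.
exact/pd_psd/pd_innovation.
Qed.

Lemma lin_risk_mmse Sx Sw : psd Sx -> pd Sw -> lin_risk (gain Sx Sw) Sx Sw = mmse_obj H Sx Sw.
Proof. by move=> px pw; rewrite lin_risk_gain// subrr !mul0mx linear0 addr0. Qed.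

Lemma lin_risk_convex K Sx Sw Sx' Sw' t :
  lin_risk K ((1 - t) *: Sx + t *: Sx') ((1 - t) *: Sw + t *: Sw') =
  (1 - t) * lin_risk K Sx Sw + t * lin_risk K Sx' Sw'.
Proof.
rewrite /lin_risk !mulmxDr !mulmxDl -!(scalemxAr, scalemxAl) !mxtraceD !mxtraceZ.
by ring.
Qed.

Lemma lin_risk_tr K Sx Sw : lin_risk K Sx Sw =
  \tr ((1%:M - K *m H)^T *m (1%:M - K *m H) *m Sx) + \tr (K^T *m K *m Sw).
Proof.
by rewrite /lin_risk mxtrace_mulC mulmxA [\tr (K *m _ *m _)]mxtrace_mulC !mulmxA.
Qed.

Lemma tr_gram_add_ge0 (D : 'M[R]_(n, m)) (B : 'M[R]_(m, n)) s :
  0 <= \tr (D *m D^T) + 2 * s * \tr (D *m B) + s ^+ 2 * \tr (B *m B^T).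
Proof.
have := tr_gram_ge0 (D + s *: B^T).
rewrite [(_ + _)^T]linearD /= [(_ *: _)^T]linearZ /= trmxK !(mulmxDl, mulmxDr).
rewrite -!(scalemxAl, scalemxAr) !mxtraceD !mxtraceZ.
have -> : \tr (B^T *m D^T) = \tr (D *m B) by rewrite -trmx_mul mxtrace_tr.
have -> : \tr (B^T *m B) = \tr (B *m B^T) by rewrite mxtrace_mulC.
by move=> h; apply: (le_trans h); rewrite le_eqVlt; apply/orP; left; apply/eqP; ring.
Qed.

(** An envelope argument: as [mmse_obj] is a minimum over gains, its slope towards the primed pair
    is [lin_risk K Sx' Sw'] minus its value, with [K] the gain at the start. The optimal gain at
    time [t] is [K + D]. Strong convexity with modulus [l] at the start point charges
    [l * \tr (D *m D^T)] for the shift, which limits the gain from [D] to order [t ^+ 2]; dividing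
    by [t] and letting it tend to 0 gives the claim. *)
Lemma mmse_saddle Sx Sw Sx' Sw' (l : R) :
  0 < l -> psd Sx -> psd Sx' -> psd (Sw - l%:M) -> psd (Sw' - l%:M) ->
  (forall t, 0 < t <= 2^-1 ->
    mmse_obj H ((1 - t) *: Sx + t *: Sx') ((1 - t) *: Sw + t *: Sw') <= mmse_obj H Sx Sw) ->
  lin_risk (gain Sx Sw) Sx' Sw' <= mmse_obj H Sx Sw.
Proof.
move=> l0 px px' lw lw' hmax.
have pdl := pd_scalar m l0.
have pw : pd Sw by rewrite -[Sw](subrK l%:M); exact: psd_pdD.
have pw' : pd Sw' by rewrite -[Sw'](subrK l%:M); exact: psd_pdD.
set K := gain Sx Sw; set f := mmse_obj H Sx Sw.
set V' := H *m Sx' *m H^T + Sw'.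
have pV' : psd V' by exact/pd_psd/pd_innovation.
(* Half the gradient in the gain, at [K], of the risk for the primed covariances. *)
pose B := V' *m K^T - H *m Sx'.
pose c := \tr (B *m B^T) / l.
have c0 : 0 <= c by rewrite divr_ge0 ?tr_gram_ge0// ltW.
have LD D : lin_risk (K + D) Sx' Sw' >= lin_risk K Sx' Sw' + 2 * \tr (D *m B).
  rewrite /B !lin_riskE ?px'.1// -/V'; move: (V') pV' => W pW.
  rewrite [(K + D)^T]linearD /= !(mulmxDl, mulmxDr) !mxtraceD mulmxN !mulmxA [\tr (- _)]linearN /=.
  have -> : \tr (K *m W *m D^T) = \tr (D *m W *m K^T).
    by rewrite -mxtrace_tr !trmx_mul trmxK pW.1 mulmxA.
  have := psd_tr_ge0 (psd_congr D pW); lra.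
suff h t : 0 < t <= 2^-1 -> lin_risk K Sx' Sw' <= f + t * (2 * c).
  apply/ler_addgt0Pr => e e0.
  have c1 : 0 < 2 * c + 1 by rewrite ltr_wpDl// mulr_ge0.
  pose t := Num.min 2^-1 (e / (2 * c + 1)).
  have t0 : 0 < t by rewrite lt_min invr_gt0 ltr0Sn divr_gt0.
  have t2 : t <= 2^-1 by rewrite ge_min lexx.
  apply: (le_trans (h t _)); first by rewrite t0.
  rewrite lerD2l (@le_trans _ _ (e / (2 * c + 1) * (2 * c)))//.
    by apply: ler_wpM2r; [exact: mulr_ge0|rewrite /t ge_min lexx orbT].
  by rewrite mulrAC ler_pdivrMr// ler_wpM2l ?lerDl// ltW.
move=> /andP[t0 t2]; have t1 : 0 < 1 - t by lra.
have := hmax t; rewrite t0 t2 => /(_ isT).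
set Sxt := (1 - t) *: Sx + t *: Sx'; set Swt := (1 - t) *: Sw + t *: Sw'.
have pxt : psd Sxt by apply: psdD; apply: psdZ; rewrite // ltW.
have pwt : pd Swt.
  have -> : Swt = ((1 - t) *: (Sw - l%:M) + t *: (Sw' - l%:M)) + l%:M.
    by rewrite /Swt -scalemx1; apply/matrixP => i j; rewrite !mxLE; ring.
  by apply: psd_pdD => //; apply: psdD; apply: psdZ; rewrite // ltW.
rewrite -(lin_risk_mmse pxt pwt) lin_risk_convex -/f.
set D := gain Sxt Swt - K.
have -> : gain Sxt Swt = K + D by rewrite /D addrC subrK.
have h1 := LD D.
have h2 : lin_risk (K + D) Sx Sw >= f + l * \tr (D *m D^T).
  rewrite lin_risk_gain// -/f -/K lerD2l (addrC K) addrK.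
  have -> : H *m Sx *m H^T + Sw = l%:M + (H *m Sx *m H^T + (Sw - l%:M)).
    by apply/matrixP => i j; rewrite !mxLE; ring.
  rewrite mulmxDr mulmxDl mxtraceD mul_mx_scalar -scalemxAl mxtraceZ lerDl.
  by apply/psd_tr_ge0/psd_congr; apply: psdD => //; exact: psd_congr.
(* The factor for which the square of [D + s *: B^T], times [(1 - t) * l], has the linear term
   [2 * t * \tr (D *m B)]. The bound [t <= 2^-1] then replaces [1 / (1 - t)] by 2. *)
pose s := t / ((1 - t) * l).
have h3 : 0 <= \tr (D *m D^T) + 2 * s * \tr (D *m B) + s ^+ 2 * \tr (B *m B^T).
  exact: tr_gram_add_ge0.
have tl : 0 < (1 - t) * l by rewrite mulr_gt0.
have h4 : 0 <= (1 - t) * l * \tr (D *m D^T) + 2 * t * \tr (D *m B) + t * (2 * t * c).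
  have E : (1 - t) * l * (\tr (D *m D^T) + 2 * s * \tr (D *m B) + s ^+ 2 * \tr (B *m B^T))
      = (1 - t) * l * \tr (D *m D^T) + 2 * t * \tr (D *m B) + t * (t / (1 - t) * c).
    by rewrite /s /c; field; rewrite !gt_eqF.
  have : 0 <= (1 - t) * l * (\tr (D *m D^T) + 2 * s * \tr (D *m B) + s ^+ 2 * \tr (B *m B^T)).
    by rewrite mulr_ge0// ltW.
  rewrite E => /le_trans; apply; rewrite lerD2l ler_pM2l// ler_wpM2r//.
  rewrite ler_pdivrMr//; nra.
have h5 := ler_wpM2l (ltW t1) h2; have h6 := ler_wpM2l (ltW t0) h1.
move=> h7; rewrite -(ler_pM2l t0); nra.
Qed.

End mmse.

(** * Existence of a maximizer *)

Section maximizer.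
Variables (R : realType) (n m : nat) (H : 'M[R]_(m, n)).
Variables (Shx : 'M[R]_n) (Shw : 'M[R]_m) (rhox rhow : R).
Hypotheses (n0 : (0 < n)%N) (m0 : (0 < m)%N) (pShx : psd Shx) (pdShw : pd Shw).

Let lx := lambda_min Shx.
Let lw := lambda_min Shw.
Let pShw := pd_psd pdShw.

Let lx0 : 0 <= lx.
Proof. by have [_ /(eigenvalue_psd_ge0 pShx)] := lambda_minP n0 pShx. Qed.

Let lw0 : 0 < lw.
Proof. by have [_ /(eigenvalue_pd_gt0 pdShw)] := lambda_minP m0 pShw. Qed.

(** Since [lw] is positive, the last condition is a closed substitute for the open condition [pd];
    the set is convex and the image of a compact set. *)
Let X0 (p : 'M[R]_n * 'M[R]_m) := [/\ sdp_le p.1 Shx rhox, sdp_le p.2 Shw rhow,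
  psd (p.1 - lx%:M) & psd (p.2 - lw%:M)].

Let X0_psd p : X0 p -> psd p.1 /\ pd p.2.
Proof.
move=> [_ _ p1 p2]; split.
  by rewrite -[p.1](subrK lx%:M); apply: psdD => //; exact: psd_scalar.
by rewrite -[p.2](subrK lw%:M); apply: psd_pdD => //; exact: pd_scalar.
Qed.

Let X0_center : X0 (Shx, Shw).
Proof.
split=> /=; [exact: sdp_le_self|exact: sdp_le_self| |].
  by have [] := lambda_minP n0 pShx.
by have [] := lambda_minP m0 pShw.
Qed.

Let X0_convex p q t : 0 <= t <= 1 -> X0 p -> X0 q ->
  X0 ((1 - t) *: p.1 + t *: q.1, (1 - t) *: p.2 + t *: q.2).
Proof.
move=> /[dup] t01 /andP[t0 t1] [p1 p2 p3 p4] [q1 q2 q3 q4].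
have t1' : 0 <= 1 - t by rewrite subr_ge0.
split=> /=; [exact: sdp_convex|exact: sdp_convex| |].
  have -> : (1 - t) *: p.1 + t *: q.1 - lx%:M = (1 - t) *: (p.1 - lx%:M) + t *: (q.1 - lx%:M).
    by apply/matrixP => i j; rewrite !mxLE; ring.
  by apply: psdD; exact: psdZ.
have -> : (1 - t) *: p.2 + t *: q.2 - lw%:M = (1 - t) *: (p.2 - lw%:M) + t *: (q.2 - lw%:M).
  by apply/matrixP => i j; rewrite !mxLE; ring.
by apply: psdD; exact: psdZ.
Qed.

Let vx (v : 'rV[R]_((n + n) * (n + n)) * 'rV[R]_((m + m) * (m + m))) : 'M[R]_n :=
  ulsubmx (vec_mx v.1 : 'M[R]_(n + n)).
Let vw (v : 'rV[R]_((n + n) * (n + n)) * 'rV[R]_((m + m) * (m + m))) : 'M[R]_m :=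
  ulsubmx (vec_mx v.2 : 'M[R]_(m + m)).

Let lin_risk_continuous K : continuous (fun v => lin_risk H K (vx v) (vw v)).
Proof.
rewrite /lin_risk => v; apply: cvgD.
  apply: (@continuous_comp _ _ _ fst
    (fun u => \tr ((1%:M - K *m H) *m ulsubmx (vec_mx u : 'M[R]_(n + n)) *m (1%:M - K *m H)^T))).
    exact: cvg_fst.
  apply: rV_scalar_continuous => a u w.
  by rewrite ulsubmx_linear mulmxDr mulmxDl -!(scalemxAl, scalemxAr) mxtraceD mxtraceZ.
apply: (@continuous_comp _ _ _ snd
    (fun u => \tr (K *m ulsubmx (vec_mx u : 'M[R]_(m + m)) *m K^T))).
  exact: cvg_snd.
apply: rV_scalar_continuous => a u w.
by rewrite ulsubmx_linear mulmxDr mulmxDl -!(scalemxAl, scalemxAr) mxtraceD mxtraceZ.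
Qed.

Let f p := mmse_obj H p.1 p.2.

(* [mmse_obj] is upper semicontinuous, as the infimum over the gains of
   functions that are linear in the covariances. *)
Let X0_max : exists2 p, X0 p & forall q, X0 q -> f q <= f p.
Proof.
pose A := [set f p | p in X0].
have fle p : X0 p -> f p <= 2 * rhox ^+ 2 + 2 * \tr Shx.
  move=> Xp; have [pp1 pp2] := X0_psd Xp.
  apply: (le_trans (mmse_le_lin_risk H 0 pp1 pp2)).
  rewrite /lin_risk !mul0mx subr0 mul1mx trmx1 mulmx1 linear0 addr0.
  by case: Xp => -[C [pN h]] _ _ _; exact: (sdp_tr_le pN h).
have hA : has_sup A.
  split; first by exists (f (Shx, Shw)); exists (Shx, Shw).
  by exists (2 * rhox ^+ 2 + 2 * \tr Shx) => _ [p Xp <-]; exact: fle.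
set s := sup A; apply: contrapT => nomax.
have flt p : X0 p -> f p < s.
  move=> Xp; rewrite lt_neqAle; apply/andP; split; last first.
    by apply: sup_upper_bound => //; exists p.
  apply/eqP => fs; apply: nomax; exists p => // q Xq.
  by rewrite fs; apply: sup_upper_bound => //; exists q.
pose Kx := [set v | sdp_set Shx rhox lx (vec_mx v)].
pose Kw := [set v | sdp_set Shw rhow lw (vec_mx v)].
have KX v : (Kx `*` Kw) v -> X0 (vx v, vw v).
  move=> [kx kw].
  have [_ _ _ h1] := kx; have [_ _ _ h2] := kw.
  split=> //=.
    by apply/(sdp_leP _ _ h1); exists (vec_mx v.1).
  by apply/(sdp_leP _ _ h2); exists (vec_mx v.2).
have XK p : X0 p -> exists2 v, (Kx `*` Kw) v & (vx v, vw v) = p.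
  move=> [p1 p2 p3 p4].
  have [N1 K1 e1] := (sdp_leP Shx rhox p3).1 p1.
  have [N2 K2 e2] := (sdp_leP Shw rhow p4).1 p2.
  exists (mxvec N1, mxvec N2); first by split; rewrite /Kx /Kw /= mxvecK.
  by rewrite /vx /vw /= !mxvecK e1 e2; case: (p).
have cK : compact (Kx `*` Kw).
  by apply: compact_setX; exact: sdp_set_compact.
(* If the supremum [s] is not attained, each point has a neighborhood on which the objective stays
   below [s - e] for small [e]. Compactness makes [e] uniform, against the choice of [s]. *)
have h : \forall e \near (0 : R)^'+,
    (Kx `*` Kw) `<=` (fun v => (Kx `*` Kw) v -> f (vx v, vw v) <= s - e).
  apply: ((compact_near_coveringP _).1 cK R (0 : R)^'+
   (fun e v => (Kx `*` Kw) v -> f (vx v, vw v) <= s - e)) => v Kv.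
  have Xv := KX _ Kv; have [p1 p2] := X0_psd Xv.
  pose K := gain H (vx v) (vw v).
  have E : lin_risk H K (vx v) (vw v) = f (vx v, vw v) by exact: lin_risk_mmse.
  set d := (s - f (vx v, vw v)) / 2.
  have d0 : 0 < d by rewrite divr_gt0// subr_gt0 flt.
  have h1 : \forall w \near v, lin_risk H K (vx w) (vw w) < s - d.
    apply: (cvgr_lt _ (@lin_risk_continuous K v)).
    by rewrite E; rewrite /d; have := flt _ Xv; lra.
  exists ([set w | lin_risk H K (vx w) (vw w) < s - d], [set e | e < d]).
    split => //; exact: nbhs_right_lt.
  move=> [w e] /= [h2 ed] Kw'.
  have [q1 q2] := X0_psd (KX _ Kw').
  apply: (le_trans (mmse_le_lin_risk H K q1 q2)).
  by apply/ltW/(lt_le_trans h2); rewrite lerD2l lerN2 ltW.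
near (0 : R)^'+ => e.
have e0 : 0 < e by near: e; exact: nbhs_right_gt.
have he : (Kx `*` Kw) `<=` (fun v => (Kx `*` Kw) v -> f (vx v, vw v) <= s - e).
  by near: e.
have : s <= s - e.
  apply: sup_le_ub => [|_ [p Xp <-]]; first by exists (f (Shx, Shw)); exists (Shx, Shw).
  by have [v Kv <-] := XK _ Xp; exact: (he _ Kv Kv).
by rewrite lerBrDr gerDl leNgt e0.
Unshelve. all: by end_near. Qed.

Lemma mmse_maximizer : exists p, [/\ feasible Shx Shw rhox rhow p,
  psd (p.1 - lx%:M), psd (p.2 - lw%:M) &
  forall q, feasible Shx Shw rhox rhow q -> mmse_obj H q.1 q.2 <= mmse_obj H p.1 p.2].
Proof.
have [p Xp maxp] := X0_max; have [p1 p2] := X0_psd Xp.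
have [sx sw lp1 lp2] := Xp.
exists p; split => //.
  split => //; [exact/(gelbrich_sdp _ p1)|exact/(gelbrich_sdp _ (pd_psd p2))].
move=> q [q1 q2 /(gelbrich_sdp _ q1 pShx) gx /(gelbrich_sdp _ (pd_psd q2) pShw) gw].
(* With the gain of [p] frozen, the risk is linear in the covariances and splits into two traces.
   Their maximizers [Tx] and [Tw] over the full balls lie in [X0], so the segment from [p] to them
   stays where [p] is optimal. *)
pose K := gain H p.1 p.2.
have pGx : psd ((1%:M - K *m H)^T *m (1%:M - K *m H)).
  by have := psd_gram (1%:M - K *m H)^T; rewrite trmxK.
have pGw : psd (K^T *m K) by have := psd_gram K^T; rewrite trmxK.
have [Tx [tx ltx mx]] := linear_maximizer rhox n0 pShx pGx.
have [Tw [tw ltw mw]] := linear_maximizer rhow m0 pShw pGw.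
have XT : X0 (Tx, Tw) by [].
have [pT1 pT2] := X0_psd XT.
apply: (le_trans (mmse_le_lin_risk H K q1 q2)).
apply: (@le_trans _ _ (lin_risk H K Tx Tw)).
  by rewrite !lin_risk_tr lerD ?mx ?mw.
apply: (mmse_saddle lw0) => // t /andP[t0 t2].
have t01 : 0 <= t <= 1 by rewrite ltW//=; lra.
exact: (maxp _ (X0_convex t01 Xp XT)).
Qed.

End maximizer.

(** * Borel sets of vectors *)

Lemma natSinv_lt (R : realType) (e : R) : 0 < e -> exists k, k.+1%:R^-1 < e.
Proof.
move=> e0; have [k _ hk] := near_infty_natSinv_lt (PosNum e0).
by exists k; exact: (hk k (leqnn k)).
Qed.

Section borel_vectors.
Variables (R : realType) (d : nat).

Section generation.
Variable G : set (set 'cV[R]_d).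
Hypothesis sG : sigma_algebra setT G.
Hypothesis half : forall i b, G [set y : 'cV[R]_d | y i 0 <= b].

Let G0 : G set0. Proof. by case: sG. Qed.

Let GC A : G A -> G (~` A).
Proof. by case: sG => _ + _ => /[apply]; rewrite setTD. Qed.

Let Gcup (A : nat -> set 'cV[R]_d) : (forall k, G (A k)) -> G (\bigcup_k A k).
Proof. by case: sG => _ _; exact. Qed.

Let Gcap (A : nat -> set 'cV[R]_d) : (forall k, G (A k)) -> G (\bigcap_k A k).
Proof.
by move=> h; rewrite -[X in G X]setCK setC_bigcap; apply/GC/Gcup => k; exact: GC.
Qed.

Let Gslab i (c r : R) : G [set y : 'cV[R]_d | `|y i 0 - c| < r].
Proof.
(* An intersection of two sets, written as a countable one that is constant from index 1 on. The
   strict upper bound is a union of closed half-spaces. *)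
pose A (k : nat) : set 'cV[R]_d :=
  match k with
  | 0 => ~` [set y : 'cV[R]_d | y i 0 <= c - r]
  | _.+1 => \bigcup_j [set y : 'cV[R]_d | y i 0 <= c + r - j.+1%:R^-1]
  end.
have -> : [set y : 'cV[R]_d | `|y i 0 - c| < r] = \bigcap_k A k.
  apply/seteqP; split=> y /=.
    rewrite ltr_norml => /andP[h1 h2] [_|k _] /=.
      by apply/negP; rewrite -ltNge; lra.
    have h : 0 < c + r - y i 0 by lra.
    have [j hj] := natSinv_lt h; exists j => //=; rewrite lerBrDr -lerBrDl; exact: ltW.
  move=> h; have := h 0%N I; have [j _ /=] := h 1%N I.
  move=> h1 /negP; rewrite -ltNge => h2; rewrite ltr_norml.
  have : 0 < j.+1%:R^-1 :> R by rewrite invr_gt0.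
  by move: (_^-1) h1 => z h1 z0; apply/andP; split; lra.
apply: Gcap => -[|k] /=; first exact/GC/half.
by apply: Gcup => j; exact: half.
Qed.

Let Gbox (c : 'cV[R]_d) r : G [set y : 'cV[R]_d | forall i, `|y i 0 - c i 0| < r].
Proof.
pose A (k : nat) : set 'cV[R]_d :=
  if insub k is Some i then [set y : 'cV[R]_d | `|y i 0 - c i 0| < r] else setT.
have -> : [set y : 'cV[R]_d | forall i, `|y i 0 - c i 0| < r] = \bigcap_k A k.
  apply/seteqP; split=> y /= h.
    by move=> k _; rewrite /A; case: insubP => [i _ _|//]; exact: h.
  by move=> i; have := h i I; rewrite /A valK; exact.
apply: Gcap => k; rewrite /A; case: insubP => [i _ _|_]; first exact: Gslab.
by rewrite -setC0; exact: GC.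
Qed.

(** Half-spaces yield slabs, slabs yield boxes, and an open set is the union of the countably many
    rational boxes inside it. The class [G] is arbitrary because it is instantiated both with sets
    having measurable preimages and with sets whose indicator belongs to a class of functions. *)
Lemma half_space_generate B : measurable (B : set (vecR R d)) -> G B.
Proof.
apply: smallest_sub => // U oU.
pose box (p : 'cV[rat]_d * nat) : set 'cV[R]_d :=
  [set y : 'cV[R]_d | forall i, `|y i 0 - (map_mx ratr p.1 : 'cV[R]_d) i 0| < p.2.+1%:R^-1].
pose A (k : nat) := if unpickle k is Some p then
  (if pselect (box p `<=` U) then box p else set0) else set0.
have -> : U = \bigcup_k A k.
  apply/seteqP; split=> x; last first.
    move=> [k _]; rewrite /A; case: unpickle => [p|//].
    by case: pselect => // h; exact: h.
  move=> Ux; have : nbhs x U by exact: open_nbhs_nbhs.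
  move=> /nbhs_ballP[e /= e0 eU].
  (* Two points of a box differ in each coordinate by less than twice its radius, hence the radius
     below [e / 2]. *)
  have e2 : 0 < e / 2 by rewrite divr_gt0.
  have [k hk] := natSinv_lt e2.
  have k0 : 0 < k.+1%:R^-1 :> R by rewrite invr_gt0.
  have hq i : exists q : rat, `|x i 0 - ratr q| < k.+1%:R^-1 :> R.
    move: (_^-1) k0 => z z0; have : x i 0 - z < x i 0 + z by lra.
    move=> /rat_in_itvoo[q]; rewrite in_itv /= => /andP[h1 h2].
    by exists q; rewrite ltr_norml; apply/andP; split; lra.
  pose q : 'cV[rat]_d := \col_i sval (cid (hq i)).
  have xb : box (q, k) x.
    by move=> i; rewrite /= !mxE; exact: svalP (cid (hq i)).
  have bU : box (q, k) `<=` U.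
    move=> y yb; apply: eU; split => // i j; rewrite ord1 /ball /=.
    have := xb i; have := yb i; rewrite /= => h1 h2.
    rewrite (_ : x i 0 - y i 0 = (x i 0 - (map_mx ratr q : 'cV[R]_d) i 0) - (y i 0 - (map_mx ratr q : 'cV[R]_d) i 0)); last by ring.
    rewrite (le_lt_trans (ler_normB _ _))//; move: (_^-1) h1 h2 hk => z; lra.
  exists (pickle (q, k)) => //; rewrite /A pickleK.
  by case: pselect.
apply: Gcup => k; rewrite /A; case: unpickle => [p|]; last exact: G0.
by case: pselect => h /=; [exact: Gbox|exact: G0].
Qed.

End generation.

Lemma measurable_vecR dd (T : measurableType dd) (f : T -> vecR R d) :
  (forall i, measurable_fun setT (fun t => (f t : 'cV[R]_d) i 0)) ->
  measurable_fun setT f.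
Proof.
move=> hf _ B mB; rewrite setTI.
apply: (@half_space_generate [set B | measurable (f @^-1` B)]) => //; last first.
  move=> i b /=; have := hf i measurableT _ (measurable_itv `]-oo, b]).
  by rewrite setTI; congr measurable; apply/seteqP; split=> t /=; rewrite in_itv.
split => /=.
- by rewrite preimage_set0.
- by move=> A mA; rewrite setTD preimage_setC; exact: measurableC.
- by move=> A mA; rewrite preimage_bigcup; exact: bigcup_measurable.
Qed.

Lemma measurable_coord i : measurable_fun setT (fun y : vecR R d => (y : 'cV[R]_d) i 0).
Proof.
apply: (measurability _ (measurable_realfun.RGenOInfty.measurableE R)) => /= _ [_ [x ->] <-].
rewrite setTI; apply: sub_sigma_algebra.
have := @open_comp _ _ (fun y : 'cV[R]_d => y i 0) [set z | x < z].
move=> /(_ (fun y _ => @coord_continuous _ _ _ i 0 y) (@open_gt _ x)).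
by congr open; apply/seteqP; split=> y /=; rewrite in_itv /= andbT.
Qed.

End borel_vectors.

(** * Integrals of real functions *)

Local Notation integrableR mu f := (mu.-integrable setT (EFin \o (f))).

Section real_integrals.
Context d (T : measurableType d) (R : realType) (mu : {measure set T -> \bar R}).
Implicit Types f g h : T -> R.

Lemma integrableR_meas f : integrableR mu f -> measurable_fun setT f.
Proof. by move=> /integrableP[/measurable_EFinP]. Qed.

Lemma integrableRD f g : integrableR mu f -> integrableR mu g ->
  integrableR mu (fun x => f x + g x).
Proof. by move=> hf hg; exact: (integrableD measurableT hf hg). Qed.

Lemma integrableRZ c f : integrableR mu f -> integrableR mu (fun x => c * f x).
Proof. by move=> hf; exact: (integrableZl measurableT c hf). Qed.

Lemma integrableR0 : integrableR mu (fun=> 0).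
Proof. exact: integrable0. Qed.

Lemma integrableR_sum (I : Type) (r : seq I) (F : I -> T -> R) :
  (forall i, integrableR mu (F i)) -> integrableR mu (fun x => \sum_(i <- r) F i x).
Proof.
move=> h; elim: r => [|i r IH].
  by under [X in EFin \o X]eq_fun do rewrite big_nil; exact: integrableR0.
under [X in EFin \o X]eq_fun do rewrite big_cons.
exact: integrableRD.
Qed.

Lemma integrableR_le f g : measurable_fun setT f -> integrableR mu g ->
  (forall x, `|f x| <= g x) -> integrableR mu f.
Proof.
move=> mf ig fg; apply: (le_integrable measurableT _ _ ig); first exact/measurable_EFinP.
by move=> x _ /=; rewrite lee_fin (le_trans (fg x))// ler_norm.
Qed.

Lemma RintD f g : integrableR mu f -> integrableR mu g ->
  \int[mu]_x (f x + g x) = \int[mu]_x f x + \int[mu]_x g x.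
Proof. exact: RintegralD. Qed.

Lemma RintZ c f : integrableR mu f -> \int[mu]_x (c * f x) = c * \int[mu]_x f x.
Proof. exact: RintegralZl. Qed.

Lemma Rint_zero : \int[mu]_x (0 : R) = 0.
Proof. by rewrite /Rintegral integral0. Qed.

Lemma Rint_sum (I : Type) (r : seq I) (F : I -> T -> R) :
  (forall i, integrableR mu (F i)) ->
  \int[mu]_x (\sum_(i <- r) F i x) = \sum_(i <- r) \int[mu]_x F i x.
Proof.
move=> h; elim: r => [|i r IH].
  by rewrite big_nil -[RHS]Rint_zero; apply: eq_Rintegral => x _; rewrite big_nil.
rewrite big_cons -IH -RintD//; last exact: integrableR_sum.
by apply: eq_Rintegral => x _; rewrite big_cons.
Qed.

Lemma Rint_EFin f : integrableR mu f ->
  (\int[mu]_x (f x)%:E)%E = (\int[mu]_x f x)%:E.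
Proof. by move=> hf; rewrite /Rintegral fineK//; exact: integrable_fin_num. Qed.

Lemma Rint_dominated (f_ : nat -> T -> R) f g :
  (forall k, measurable_fun setT (f_ k)) -> integrableR mu g ->
  (forall k x, `|f_ k x| <= g x) ->
  (forall x, f_ k x @[k --> \oo] --> f x) ->
  \int[mu]_x f_ k x @[k --> \oo] --> \int[mu]_x f x.
Proof.
move=> mf ig fg cf.
have mlim : measurable_fun setT f.
  by apply: (measurable_fun_cvg (h := f_)) => // x _; exact: cf.
have glim x : `|f x| <= g x.
  by apply: (cvgr_to_le (cvg_norm (cf x))); apply: nearW => k; exact: fg.
have [||||_ _ h] := @dominated_convergence _ _ _ mu setT measurableT
  (fun k x => (f_ k x)%:E) (EFin \o f) (EFin \o g) _ _ _ ig _.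
- by move=> k; exact/measurable_EFinP.
- exact/measurable_EFinP.
- by apply: aeW => x _; apply: cvg_EFin; [exact: nearW|exact: cf].
- by apply: aeW => x k _; rewrite /= lee_fin.
apply: (fine_cvg (f := fun k => (\int[mu]_x (f_ k x)%:E)%E)).
rewrite fineK//; apply: integrable_fin_num => //.
exact: (integrableR_le mlim ig).
Qed.

Lemma integrableR_mul f g : measurable_fun setT f -> measurable_fun setT g ->
  integrableR mu (fun x => f x ^+ 2) -> integrableR mu (fun x => g x ^+ 2) ->
  integrableR mu (fun x => f x * g x).
Proof.
move=> mf mg hf hg; apply: (integrableR_le _ (integrableRD hf hg)).
  exact: measurable_funM.
move=> x; have := sqr_ge0 (f x + g x); have := sqr_ge0 (f x - g x).
by rewrite ler_norml => h1 h2; apply/andP; split; nra.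
Qed.

End real_integrals.

Section finite_measures.
Context d (T : measurableType d) (R : realType) (P : {finite_measure set T -> \bar R}).

Lemma integrableR_cst c : integrableR P (fun=> c).
Proof.
by apply: finite_measure_integrable_cst.
Qed.

Lemma integrableR_bounded (f : T -> R) M : measurable_fun setT f ->
  (forall x, `|f x| <= M) -> integrableR P f.
Proof. by move=> mf fM; apply: (integrableR_le mf (integrableR_cst M)). Qed.

Lemma integrableR_sqr (f : T -> R) : measurable_fun setT f ->
  integrableR P (fun x => f x ^+ 2) -> integrableR P f.
Proof.
move=> mf hf; apply: (integrableR_le mf (integrableRD (integrableR_cst 1) hf)).
move=> x; have := sqr_ge0 (f x + 1); have := sqr_ge0 (f x - 1).
by rewrite ler_norml => h1 h2; apply/andP; split; nra.
Qed.

End finite_measures.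

Lemma Rint_cst d (T : measurableType d) (R : realType) (P : probability T R) (c : R) :
  \int[P]_x c = c.
Proof.
rewrite Rintegral_cst//; transitivity (c * fine (1%E : \bar R)); last exact: mulr1.
by congr (_ * fine _); exact: probability_setT.
Qed.

Section laws.
Context d1 d2 (X : measurableType d1) (Y : measurableType d2) (R : realType).
Variables (mu : {measure set X -> \bar R}) (nu : {measure set Y -> \bar R}).
Variables (phi : X -> Y) (mphi : measurable_fun setT phi).
Hypothesis law : forall A, measurable A -> mu (phi @^-1` A) = nu A.

Lemma ge0_law_integral (f : Y -> \bar R) : measurable_fun setT f ->
  (forall y, 0 <= f y)%E -> (\int[mu]_x f (phi x) = \int[nu]_y f y)%E.
Proof.
move=> mf f0; have := ge0_integral_pushforward mphi mu measurableT mf (fun y _ => f0 y).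
rewrite preimage_setT => <-.
by apply: eq_measure_integral => A mA _; rewrite -law.
Qed.

Lemma law_integrableR (f : Y -> R) : measurable_fun setT f ->
  integrableR nu f -> integrableR mu (fun x => f (phi x)).
Proof.
move=> mf /integrableP[_ h]; apply/integrableP; split.
  by apply/measurable_EFinP; exact: measurableT_comp.
apply: le_lt_trans h; rewrite (ge0_law_integral (f := fun y => `|(f y)%:E|%E))//.
by apply: measurableT_comp => //; exact/measurable_EFinP.
Qed.

Lemma law_Rint (f : Y -> R) : integrableR nu f ->
  \int[mu]_x f (phi x) = \int[nu]_y f y.
Proof.
move=> hf; have mf := integrableR_meas hf.
have hm := law_integrableR mf hf.
have := integral_pushforward mphi (mu := mu) (D := setT) (f := EFin \o f).
rewrite preimage_setT => /(_ (measurable_int _ hf) hm measurableT) E.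
rewrite /Rintegral; congr fine; rewrite -[LHS]E.
by apply: eq_measure_integral => A mA _; rewrite -law.
Qed.

End laws.

Lemma cvg_cst_eq (R : realType) (u : nat -> R) a b :
  (forall k, u k = a) -> u k @[k --> \oo] --> b -> b = a.
Proof.
move=> ua ub; have <- : lim (u k @[k --> \oo]) = b by exact/cvg_lim.
have -> : u = fun=> a by exact/funext.
exact: lim_cst.
Qed.

(** * Functionals vanishing on indicators *)

Section bounded_functionals.
Context d (T : measurableType d) (R : realType).

Definition bdd_meas (f : T -> R) :=
  measurable_fun setT f /\ exists M, forall y, `|f y| <= M.

Lemma bdd_measD f g : bdd_meas f -> bdd_meas g -> bdd_meas (fun y => f y + g y).
Proof.
move=> [mf [M fM]] [mg [N gN]]; split; first exact: measurable_funD.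
by exists (M + N) => y; rewrite (le_trans (ler_normD _ _))// lerD.
Qed.

Lemma bdd_measM f g : bdd_meas f -> bdd_meas g -> bdd_meas (fun y => f y * g y).
Proof.
move=> [mf [M fM]] [mg [N gN]]; split; first exact: measurable_funM.
by exists (M * N) => y; rewrite normrM ler_pM.
Qed.

Lemma bdd_meas_cst c : bdd_meas (fun=> c).
Proof. by split; [exact: measurable_cst|exists `|c|]. Qed.

Lemma bdd_meas_indic B : measurable B -> bdd_meas \1_B.
Proof.
move=> mB; split; first exact: measurable_indic.
by exists 1 => y; rewrite indicE; case: (_ \in _); rewrite ?normr1 ?normr0.
Qed.

Variable L : (T -> R) -> R.
Hypothesis L_lin : forall a f g, bdd_meas f -> bdd_meas g ->
  L (fun y => a * f y + g y) = a * L f + L g.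
Hypothesis L_cvg : forall (f_ : nat -> T -> R) f M,
  (forall k, measurable_fun setT (f_ k)) -> (forall k y, `|f_ k y| <= M) ->
  (forall y, f_ k y @[k --> \oo] --> f y) -> L (f_ k) @[k --> \oo] --> L f.
Hypothesis L_indic : forall B, measurable B -> L (\1_B : T -> R) = 0.

Let L0 : L (fun=> 0) = 0.
Proof.
have := L_lin 1 (bdd_meas_cst 0) (bdd_meas_cst 0).
have -> : (fun _ : T => 1 * 0 + 0) = (fun=> 0 : R) by apply/funext => y; rewrite mulr0 addr0.
by rewrite mul1r => /eqP; rewrite -subr_eq subrr eq_sym => /eqP.
Qed.

(* Removing the leading binary digit of a function with values in [0, 1]
   does not change [L]. *)
Let L_unit (f : T -> R) : measurable_fun setT f -> (forall y, 0 <= f y <= 1) -> L f = 0.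
Proof.
move=> mf f01.
pose A (g : T -> R) := [set y | 2^-1 <= g y].
have mA g : measurable_fun setT g -> measurable (A g).
  move=> mg; have := mg measurableT _ (measurable_itv `[2^-1, +oo[).
  by rewrite setTI; congr measurable; apply/seteqP; split=> y /=; rewrite in_itv /= andbT.
pose digit (g : T -> R) y : R := 2 * g y - \1_(A g) y.
pose f_ k := iter k digit f.
have fS k y : f_ k.+1 y = 2 * f_ k y - \1_(A (f_ k)) y by [].
have m_ k : measurable_fun setT (f_ k).
  elim: k => [//|k IH]; apply: measurable_funB; first exact: measurable_funM.
  by apply: measurable_indic; exact: (mA (f_ k) IH).
have b_ k y : 0 <= f_ k y <= 1.
  elim: k => [//|k]; rewrite fS indicE => /andP[h1 h2].
  have [yA|yA] := boolP (y \in A (f_ k)).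
    by have := set_mem yA; rewrite /A /= mulr1n => h3; apply/andP; split; lra.
  have : ~~ (2^-1 <= f_ k y) by apply: contra yA => ?; exact: mem_set.
  by rewrite -ltNge mulr0n => h3; apply/andP; split; lra.
have bm_ k : bdd_meas (f_ k).
  by split=> //; exists 1 => y; have /andP[h1 h2] := b_ k y; rewrite ger0_norm.
have LE k : L (fun y => 2^-1 ^+ k * f_ k y) = L f.
  elim: k => [|k IH]; first by under eq_fun do rewrite expr0 mul1r.
  rewrite -[RHS]IH.
  have -> : (fun y => 2^-1 ^+ k.+1 * f_ k.+1 y) =
    (fun y => - (2^-1 ^+ k.+1) * \1_(A (f_ k)) y + 2^-1 ^+ k * f_ k y).
    by apply/funext => y; rewrite fS exprS; field.
  have mAk : measurable (A (f_ k)) by exact: (mA (f_ k) (m_ k)).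
  rewrite (L_lin _ (bdd_meas_indic mAk) (bdd_measM (bdd_meas_cst (2^-1 ^+ k)) (bm_ k))).
  by rewrite (L_indic mAk) mulr0 add0r.
have pow01 k : 0 <= (2^-1 : R) ^+ k <= 1.
  elim: k => [|k /andP[h1 h2]]; first by rewrite expr0 ler01 lexx.
  by rewrite exprS; apply/andP; split; lra.
(* The remainders [2^-1 ^+ k * f_ k] tend to 0 while [L] takes the same value on all of them. *)
apply/esym/(cvg_cst_eq LE); rewrite -L0; apply: (@L_cvg _ _ 1).
- by move=> k; apply: measurable_funM.
- move=> k y; have /andP[h1 h2] := b_ k y; have /andP[h3 h4] := pow01 k.
  by rewrite ger0_norm ?mulr_ge0// mulr_ile1.
- move=> y; apply: (@squeeze_cvgr _ _ _ _ (fun=> 0) (fun k => 2^-1 ^+ k)).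
  + apply: nearW => k; have /andP[h1 h2] := b_ k y; have /andP[h3 h4] := pow01 k.
    by rewrite mulr_ge0//= ler_piMr.
  + exact: cvg_cst.
  + by apply: cvg_expr; rewrite ger0_norm; lra.
Qed.

Theorem bounded_functional_zero f : bdd_meas f -> L f = 0.
Proof.
move=> [mf [M fM]].
pose N := `|M| + 1; have N0 : 0 < N by rewrite ltr_wpDl.
have fN y : `|f y| <= N by rewrite (le_trans (fM y))// (le_trans (ler_norm M))// lerDl.
pose g y := (f y / N + 1) / 2.
have mg : measurable_fun setT g.
  by apply: measurable_funM => //; apply: measurable_funD => //; apply: measurable_funM.
have g01 y : 0 <= g y <= 1.
  have := fN y; rewrite -(ler_pM2r (x := N^-1)) ?invr_gt0// mulfV ?gt_eqF//.
  rewrite -{1}[N^-1]gtr0_norm ?invr_gt0// -normrM ler_norml /g => /andP[h1 h2].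
  by apply/andP; split; lra.
have bg : bdd_meas g.
  by split=> //; exists 1 => y; have /andP[h1 h2] := g01 y; rewrite ger0_norm.
have -> : f = (fun y => 2 * N * g y + - N).
  by apply/funext => y; rewrite /g; field; rewrite gt_eqF.
rewrite L_lin ?(L_unit mg)//; last exact: bdd_meas_cst.
have -> : (fun _ : T => - N) = (fun y => - N * 1 + 0) by apply/funext => y; rewrite mulr1 addr0.
rewrite (L_lin _ (bdd_meas_cst 1) (bdd_meas_cst 0)) L0.
rewrite (_ : L (fun=> 1) = 0) ?mulr0 ?addr0//; apply: L_unit => [|_]; first exact: measurable_cst.
by rewrite ler01 lexx.
Qed.

End bounded_functionals.
Arguments bdd_meas_cst {d T R} c.

(** * Uniqueness of characteristic functions *)

Section sign_iteration.
Variable R : realType.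

(** The Newton-Schulz step for the sign. Being a polynomial, it stays within any algebra of
    functions. *)
Definition sgstep (x : R) := (3 * x - x ^+ 3) / 2.

Lemma sgstep_bound x : `|x| <= 1 -> `|sgstep x| <= 1.
Proof.
rewrite !ler_norml => /andP[h1 h2]; rewrite /sgstep; apply/andP; split.
  have : 0 <= (x + 1) ^+ 2 * (2 - x) by rewrite mulr_ge0 ?sqr_ge0//; lra.
  by nra.
have : 0 <= (x - 1) ^+ 2 * (x + 2) by rewrite mulr_ge0 ?sqr_ge0//; lra.
by nra.
Qed.

Lemma iter_sgstep_bound x k : `|x| <= 1 -> `|iter k sgstep x| <= 1.
Proof. by move=> x1; elim: k => [//|k IH] /=; exact: sgstep_bound. Qed.

(** One step multiplies [1 - y] by [1 - y / 2 - y ^+ 2 / 2], at most [1 - x / 2] because the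
    iterates stay above [x]. *)
Lemma iter_sgstep_pos x k : 0 < x <= 1 ->
  x <= iter k sgstep x <= 1 /\ 1 - iter k sgstep x <= (1 - x / 2) ^+ k.
Proof.
move=> /andP[x0 x1]; elim: k => [|k [/andP[IH1 IH2] IH3]] /=.
  by rewrite expr0; split; [apply/andP; split|lra].
set y := iter k _ _ in IH1 IH2 IH3 *; rewrite /sgstep.
have h1 : 0 <= (1 - y) ^+ 2 * (y + 2) by rewrite mulr_ge0 ?sqr_ge0//; lra.
have h2 : 0 <= y * (1 - y) * (1 + y) by rewrite !mulr_ge0//; lra.
split; first by apply/andP; split; nra.
rewrite [(1 - x / 2) ^+ _]exprS.
have h3 : (1 - y) * (1 - x / 2) <= (1 - x / 2) * (1 - x / 2) ^+ k.
  by rewrite mulrC ler_wpM2l//; lra.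
apply: le_trans h3.
have h4 : 0 <= (1 - y) * ((y - x) / 2 + y ^+ 2 / 2).
  by apply: mulr_ge0; [lra|apply: addr_ge0; [lra|rewrite divr_ge0 ?sqr_ge0]].
have -> : 1 - (3 * y - y ^+ 3) / 2 = (1 - y) * (1 - x / 2) - (1 - y) * ((y - x) / 2 + y ^+ 2 / 2).
  by field.
by rewrite gerBl.
Qed.

Lemma iter_sgstepN x k : iter k sgstep (- x) = - iter k sgstep x.
Proof. by elim: k => [//|k IH] /=; rewrite IH /sgstep; field. Qed.

Lemma iter_sgstep0 k : iter k sgstep 0 = 0.
Proof. by elim: k => [//|k IH] /=; rewrite IH /sgstep; field. Qed.

(* [(3 x - x^3) / 2] fixes -1, 0, 1 and attracts [-1, 1] to the sign of its point. *)
Lemma iter_sgstep_cvg x : `|x| <= 1 -> iter k sgstep x @[k --> \oo] --> Num.sg x.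
Proof.
have pos y : 0 < y <= 1 -> iter k sgstep y @[k --> \oo] --> (1 : R).
  move=> y01; have /andP[y0 y1] := y01.
  apply: (@squeeze_cvgr _ _ _ _ (fun k => 1 - (1 - y / 2) ^+ k) (fun=> 1)).
  - apply: nearW => k; have [/andP[_ h1] h2] := iter_sgstep_pos k y01.
    by rewrite h1 andbT; lra.
  - rewrite -[X in _ --> X]subr0; apply: cvgB; first exact: cvg_cst.
    by apply: cvg_expr; rewrite ger0_norm; lra.
  - exact: cvg_cst.
rewrite ler_norml => /andP[h1 h2].
have [x0|x0|x0] := ltrgtP x 0; last 1 first.
- rewrite x0 sgr0; under eq_fun do rewrite iter_sgstep0.
  exact: cvg_cst.
- rewrite ltr0_sg//.
  have -> : (fun k => iter k sgstep x) = (fun k => - iter k sgstep (- x)).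
    by apply/funext => k; rewrite iter_sgstepN opprK.
  apply: cvgN; apply: pos; lra.
- by rewrite gtr0_sg//; apply: pos; rewrite x0.
Qed.

End sign_iteration.

Section fourier_uniqueness.
Variables (R : realType) (m : nat).
Local Notation V := (vecR R m).

Lemma dotE (u y : 'cV[R]_m) : (u^T *m y) 0 0 = \sum_i u i 0 * y i 0.
Proof. by rewrite mxE; apply: eq_bigr => i _; rewrite mxE. Qed.

Lemma measurable_dot (u : 'cV[R]_m) : measurable_fun setT (fun y : V => u *d y).
Proof.
under eq_fun do rewrite dotE.
by apply: measurable_sum => i; apply: measurable_funM => //; exact: measurable_coord.
Qed.

Lemma bdd_meas_cos (t : 'cV[R]_m) (a : R) : bdd_meas (fun y : V => cos (t *d y + a)).
Proof.
split; last by exists 1 => y; exact: cos_max.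
apply: measurableT_comp; first exact: (continuous_measurable_fun (@continuous_cos R)).
by apply: measurable_funD => //; exact: measurable_dot.
Qed.

(* [L] stands for the difference of the expectations under two laws. *)
Variable L : (V -> R) -> R.
Hypothesis L_lin : forall a (f g : V -> R), bdd_meas f -> bdd_meas g ->
  L (fun y => a * f y + g y) = a * L f + L g.
Hypothesis L_cvg : forall (f_ : nat -> V -> R) f M,
  (forall k, measurable_fun setT (f_ k)) -> (forall k y, `|f_ k y| <= M) ->
  (forall y, f_ k y @[k --> \oo] --> f y) -> L (f_ k) @[k --> \oo] --> L f.
Hypothesis L_cos : forall (t : 'cV[R]_m) (a : R), L (fun y => cos (t *d y + a)) = 0.

(** [D] collects the weights against which [L] kills all cosines, and [G] the multipliers that
    preserve [D]. Defined in this way, [G] is closed under products at once; it is an algebra closed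
    under bounded pointwise limits and contains the cosines, hence eventually all indicators.
    Applying an indicator to the weight 1 shows that [L] vanishes on it. *)
Let D (h : V -> R) := bdd_meas h /\ forall (t : 'cV[R]_m) (a : R), L (fun y => h y * cos (t *d y + a)) = 0.
Let G (g : V -> R) := bdd_meas g /\ forall h, D h -> D (fun y => h y * g y).

Let L0 : L (fun=> 0) = 0.
Proof.
have := L_lin 1 (bdd_meas_cst 0) (bdd_meas_cst 0).
have -> : (fun _ : V => 1 * 0 + 0) = (fun=> 0 : R) by apply/funext => y; rewrite mulr0 addr0.
by rewrite mul1r => /eqP; rewrite -subr_eq subrr eq_sym => /eqP.
Qed.

Let D1 : D (fun=> 1).
Proof.
split; first exact: bdd_meas_cst.
by move=> t a; under eq_fun do rewrite mul1r; exact: L_cos.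
Qed.

Let Dlin c f g : D f -> D g -> D (fun y => c * f y + g y).
Proof.
move=> [bf Df] [bg Dg]; split.
  by apply: bdd_measD => //; apply: bdd_measM => //; exact: bdd_meas_cst.
move=> t a; have -> : (fun y => (c * f y + g y) * cos (t *d y + a)) =
  (fun y => c * (f y * cos (t *d y + a)) + g y * cos (t *d y + a)).
  by apply/funext => y; ring.
rewrite L_lin ?Df ?Dg ?mulr0 ?addr0//; apply: bdd_measM => //; exact: bdd_meas_cos.
Qed.

Let Glin c f g : G f -> G g -> G (fun y => c * f y + g y).
Proof.
move=> [bf Gf] [bg Gg]; split.
  by apply: bdd_measD => //; apply: bdd_measM => //; exact: bdd_meas_cst.
move=> h Dh; have -> : (fun y => h y * (c * f y + g y)) = (fun y => c * (h y * f y) + h y * g y).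
  by apply/funext => y; ring.
by apply: Dlin; [exact: Gf|exact: Gg].
Qed.

Let Gmul f g : G f -> G g -> G (fun y => f y * g y).
Proof.
move=> [bf Gf] [bg Gg]; split; first exact: bdd_measM.
move=> h Dh; under eq_fun do rewrite mulrA.
exact/Gg/Gf.
Qed.

Let Gcst c : G (fun=> c).
Proof.
split; first exact: bdd_meas_cst.
move=> h Dh.
have D0 : D (fun=> 0).
  have := Dlin (-1) D1 D1; congr D; apply/funext => y; ring.
have := Dlin c Dh D0; congr D; apply/funext => y; ring.
Qed.

Let Glim (g_ : nat -> V -> R) g M : (forall k, G (g_ k)) ->
  (forall k y, `|g_ k y| <= M) -> (forall y, g_ k y @[k --> \oo] --> g y) -> G g.
Proof.
move=> Gg bM cg.
have bg : bdd_meas g.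
  split.
    apply: (measurable_fun_cvg (h := g_)) => [k|y _]; last exact: cg.
    by have [[]] := Gg k.
  exists M => y; apply: (cvgr_to_le (cvg_norm (cg y))).
  by apply: nearW => k; exact: bM.
split=> // h [bh Dh]; split; first exact: bdd_measM.
have [N hN] := bh.2; have mh := bh.1.
move=> t a; apply: (cvg_cst_eq (u := fun k => L (fun y => h y * g_ k y * cos (t *d y + a)))).
  by move=> k; exact: ((Gg k).2 h (conj bh Dh)).2.
apply: (@L_cvg _ _ (N * M * 1)) => [k|k y|y].
- have [[mg _] _] := Gg k; apply: measurable_funM; first exact: measurable_funM.
  by have [] := bdd_meas_cos t a.
- by rewrite !normrM !ler_pM ?mulr_ge0// ?cos_max.
- by apply: cvgMr_tmp; apply: cvgMl_tmp; exact: cg.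
Qed.

Let Gcos (s : 'cV[R]_m) (b : R) : G (fun y => cos (s *d y + b)).
Proof.
split; first exact: bdd_meas_cos.
move=> h [bh Dh]; split; first by apply: bdd_measM => //; exact: bdd_meas_cos.
move=> t a.
have -> : (fun y => h y * cos (s *d y + b) * cos (t *d y + a)) =
  (fun y => 2^-1 * (h y * cos ((s + t) *d y + (b + a))) +
     (2^-1 * (h y * cos ((s - t) *d y + (b - a))) + 0)).
  apply/funext => y.
  have E1 : (s + t) *d y + (b + a) = (s *d y + b) + (t *d y + a).
    by rewrite [(s + t)^T]linearD /= mulmxDl mxDE; ring.
  have E2 : (s - t) *d y + (b - a) = (s *d y + b) - (t *d y + a).
    by rewrite [(s - t)^T]linearB /= mulmxBl mxDE mxNE; ring.
  by rewrite E1 E2; move: (s *d y + b) (t *d y + a) => p q; rewrite cosD cosB; field.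
have bm (u : 'cV[R]_m) (c : R) : bdd_meas (fun y : V => h y * cos (u *d y + c)).
  by apply: bdd_measM => //; exact: bdd_meas_cos.
have b0 : bdd_meas (fun _ : V => 0 : R) := bdd_meas_cst 0.
have b1 := bdd_measD (bdd_measM (bdd_meas_cst 2^-1) (bm (s - t) (b - a))) b0.
by rewrite (L_lin _ (bm (s + t) (b + a)) b1) (L_lin _ (bm _ _) b0) !Dh L0 !mulr0 !addr0.
Qed.

Let Gsg g : (forall y, `|g y| <= 1) -> G g -> G (fun y => Num.sg (g y)).
Proof.
move=> g1 Gg; apply: (@Glim (fun k y => iter k (@sgstep R) (g y)) _ 1).
- elim=> [|k IH] //=.
  have -> : (fun y => sgstep (iter k (@sgstep R) (g y))) =
    (fun y => - 2^-1 * (iter k (@sgstep R) (g y) * iter k (@sgstep R) (g y) * iter k (@sgstep R) (g y))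
      + (3 / 2 * iter k (@sgstep R) (g y) + 0)).
    by apply/funext => y; rewrite /sgstep; field.
  by apply: Glin; [exact/Gmul/IH/Gmul|exact: Glin].
- by move=> k y; exact: iter_sgstep_bound.
- by move=> y; exact: iter_sgstep_cvg.
Qed.

Let sg_le1 (x : R) : `|Num.sg x| <= 1.
Proof. by rewrite normr_sg; case: (x != 0). Qed.

(** A sine of small frequency has the sign of its argument as soon as the argument is below [pi] in
    absolute value, so the signs of sines converge to the sign of the coordinate. The sine is a
    cosine of phase [- (pi / 2)]. *)
Let Gsg_coord (i : 'I_m) (b : R) : G (fun y => Num.sg ((y : 'cV[R]_m) i 0 - b)).
Proof.
apply: (@Glim (fun k y => Num.sg (sin (k.+1%:R^-1 * ((y : 'cV[R]_m) i 0 - b)))) _ 1) => //.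
  move=> k; apply: Gsg.
    by move=> y; rewrite -cosBpihalf cos_max.
  have := Gcos (k.+1%:R^-1 *: delta_mx i 0) (- (k.+1%:R^-1 * b) - pi / 2).
  congr G; apply/funext => y; rewrite addrA cosBpihalf; congr sin.
  by rewrite [(_ *: _)^T]linearZ /= -scalemxAl mxZE trmx_delta -rowE mxE mulrBr.
move=> y; set z := y i 0 - b; apply: cvg_near_cst.
have [k hk] := natSinv_lt (divr_gt0 (pi_gt0 R) (ltr_pwDl ltr01 (normr_ge0 z))).
exists k => // j /= kj.
have j0 : 0 < j.+1%:R^-1 :> R by rewrite invr_gt0.
have hz : `|j.+1%:R^-1 * z| < pi.
  rewrite normrM gtr0_norm//.
  have h1 : j.+1%:R^-1 <= k.+1%:R^-1 :> R by rewrite lef_pV2 ?posrE// ler_nat.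
  apply: (@le_lt_trans _ _ (k.+1%:R^-1 * (1 + `|z|))).
    by apply: ler_pM; rewrite ?lerDr// ltW.
  by rewrite -ltr_pdivlMr// ltr_pwDl.
have [z0|z0|->] := ltrgtP z 0; last by rewrite mulr0 sin0 sgr0.
  have jz : j.+1%:R^-1 * z < 0 by rewrite pmulr_rlt0.
  rewrite (ltr0_sg z0) ltr0_sg// -oppr_gt0 -sinN sin_gt0_pi//.
  by rewrite oppr_gt0 jz /= -ltr0_norm.
have jz : 0 < j.+1%:R^-1 * z by rewrite pmulr_rgt0.
rewrite (gtr0_sg z0) gtr0_sg// sin_gt0_pi// jz /=.
by rewrite -(gtr0_norm jz).
Qed.

Let Ghalf (i : 'I_m) (b : R) : G (\1_[set y : V | (y : 'cV[R]_m) i 0 <= b] : V -> R).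
Proof.
(* Thresholds slightly above [b] decrease to it, which puts the boundary on the closed side. *)
pose g (y : V) : R := if (y : 'cV[R]_m) i 0 <= b then -1 else 1.
have Gg : G g.
  apply: (@Glim (fun k y => Num.sg ((y : 'cV[R]_m) i 0 - (b + k.+1%:R^-1))) _ 1) => //.
  move=> y; apply: cvg_near_cst; rewrite /g; case: ifP => hb.
    exists 0%N => // k _ /=; rewrite ltr0_sg// subr_lt0.
    by rewrite (le_lt_trans hb)// ltrDl invr_gt0.
  have h : 0 < y i 0 - b by rewrite subr_gt0 ltNge hb.
  have [k hk] := natSinv_lt h.
  exists k => // j /= kj; rewrite gtr0_sg// subr_gt0 -ltrBrDl.
  by apply: le_lt_trans hk; rewrite lef_pV2 ?posrE// ler_nat.
have := Glin (- 2^-1) Gg (Gcst 2^-1); congr G; apply/funext => y.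
rewrite indicE /g; case: ifPn => h.
  by rewrite mem_set//=; field.
by rewrite memNset /=; [rewrite mulr1 addNr|exact/negP].
Qed.

Let Gindic B : measurable B -> G (\1_B : V -> R).
Proof.
apply: (half_space_generate (G := [set B | G (\1_B : V -> R)])); last first.
  by move=> i b; exact: Ghalf.
split=> /=.
- by rewrite indic0; exact: Gcst.
- move=> A GA; have := Glin (-1) GA (Gcst 1); congr G; apply/funext => y.
  rewrite !indicE; have [Ay|nAy] := boolP (y \in A).
    rewrite memNset ?mulr1 ?addNr// => -[_]; apply; exact: set_mem.
  by rewrite mem_set ?mulr0 ?add0r//; split=> // /mem_set; exact/negP.
- move=> A GA.
  (* Indicators of the partial unions by inclusion and exclusion, which uses products and linear
     combinations only. *)
  pose g := fix g k (y : V) : R := if k is k'.+1 then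
      g k' y + \1_(A k') y - g k' y * \1_(A k') y else 0.
  have gE k y : g k y = \1_(\bigcup_(j < k) A j) y.
    elim: k => [|k IH] /=; first by rewrite II0 bigcup_set0 indic0.
    rewrite IH IIS bigcup_setU bigcup_set1 !indicE in_setU.
    by case: (_ \in _); case: (_ \in _) => /=; ring.
  apply: (@Glim (g) _ 1).
  - elim=> [|k IH]; first exact: Gcst.
    have := Glin (-1) (Gmul IH (GA k)) (Glin 1 IH (GA k)); congr G.
    by apply/funext => y /=; ring.
  - by move=> k y; rewrite gE indicE; case: (_ \in _); rewrite ?normr1 ?normr0.
  - move=> y; apply: cvg_near_cst; have [yA|yA] := boolP (y \in \bigcup_k A k).
      have [k _ Aky] := set_mem yA; exists k.+1 => // j /= kj.
      rewrite gE !indicE yA mem_set//; by exists k.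
    exists 0%N => // j _; rewrite gE !indicE (negPf yA) memNset//.
    move=> [k _ Aky]; move: yA => /negP; apply; apply: mem_set; by exists k.
Qed.

Let Lindic B : measurable B -> L (\1_B : V -> R) = 0.
Proof.
move=> /Gindic [bB /(_ _ D1)[_ /(_ 0 0)]] h; rewrite -[RHS]h; congr L.
by apply/funext => y; rewrite trmx0 mul0mx mxE addr0 cos0 mulr1 mul1r.
Qed.

Theorem fourier_uniqueness f : bdd_meas f -> L f = 0.
Proof.
move=> bf; apply: (bounded_functional_zero (L := L)) => //.
Qed.

End fourier_uniqueness.

(** * Normal laws *)

Section density.
Context d (T : measurableType d) (R : realType).
Variables (mu nu : {measure set T -> \bar R}) (g : T -> R).
Hypotheses (mg : measurable_fun setT g) (g0 : forall x, 0 <= g x).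
Hypothesis nuE : forall A, measurable A -> nu A = (\int[mu]_(x in A) (g x)%:E)%E.

Import HBNNSimple.

Let density_indic E : measurable E ->
  (\int[nu]_x (\1_E x)%:E = \int[mu]_x ((\1_E x)%:E * (g x)%:E))%E.
Proof.
move=> mE; rewrite integral_indic// setIT nuE// integral_mkcond.
apply: eq_integral => x _; rewrite patchE indicE; case: (x \in E).
  by rewrite mul1e.
by rewrite mul0e.
Qed.

Let density_nnsfun (f : {nnsfun T >-> R}) :
  (\int[nu]_x (f x)%:E = \int[mu]_x ((f x)%:E * (g x)%:E))%E.
Proof.
under [LHS]eq_integral do rewrite fimfunE -fsumEFin//.
rewrite [LHS]ge0_integral_fsum//; last 2 first.
  - by move=> r; exact/measurable_EFinP/measurableT_comp.
  - by move=> n x _; rewrite EFinM nnfun_muleindic_ge0.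
under [RHS]eq_integral.
  move=> x xD; rewrite fimfunE -fsumEFin// muleC ge0_mule_fsumr; last first.
    by move=> r; rewrite EFinM nnfun_muleindic_ge0.
  over.
rewrite [RHS]ge0_integral_fsum//; last 2 first.
  - move=> r; apply: emeasurable_funM; first exact/measurable_EFinP.
    by apply/measurable_EFinP; do 2 apply/measurableT_comp => //.
  - move=> n x _; apply: mule_ge0; first by rewrite lee_fin.
    by rewrite EFinM nnfun_muleindic_ge0.
apply: eq_fsbigr => r rf.
have r0 : 0 <= r by move: rf => /set_mem[x _ <-].
under [LHS]eq_integral do rewrite EFinM.
under [RHS]eq_integral do rewrite EFinM muleCA.
rewrite ge0_integralZl//; last exact/measurable_EFinP/measurable_indic.
rewrite ge0_integralZl//; last 2 first.
  - by apply: emeasurable_funM; apply/measurable_EFinP => //; exact: measurable_indic.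
  - by move=> x _; rewrite mule_ge0 ?lee_fin.
by rewrite density_indic//; congr (_ * _)%E; apply: eq_integral => x _; rewrite muleC.
Qed.

Lemma ge0_integral_density (f : T -> \bar R) : measurable_fun setT f ->
  (forall x, 0 <= f x)%E -> (\int[nu]_x f x = \int[mu]_x (f x * (g x)%:E))%E.
Proof.
move=> mf f0; pose f_ := nnsfun_approx measurableT mf.
transitivity (lim (\int[nu]_x (f_ n x)%:E @[n --> \oo])%E).
  rewrite -monotone_convergence//=.
  - by apply: eq_integral => x _; apply/esym/cvg_lim => //=; exact: cvg_nnsfun_approx.
  - by move=> n; exact/measurable_EFinP/measurable_funTS.
  - by move=> n ? _; rewrite lee_fin.
  - by move=> ? _ ? ? mn; rewrite lee_fin; exact/lefP/nd_nnsfun_approx.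
transitivity (lim (\int[mu]_x ((f_ n x)%:E * (g x)%:E) @[n --> \oo])%E).
  by apply: congr_lim; apply/funext => n; exact: density_nnsfun.
rewrite -monotone_convergence//=.
- apply: eq_integral => x _; apply/cvg_lim => //=.
  by apply: cvgeZr => //; exact: cvg_nnsfun_approx.
- by move=> n; apply: emeasurable_funM; apply/measurable_EFinP.
- by move=> n x _; rewrite mule_ge0 ?lee_fin.
- move=> x _ a b ab; rewrite lee_wpmul2r ?lee_fin//; exact/lefP/nd_nnsfun_approx.
Qed.

Lemma integrableR_density (f : T -> R) : measurable_fun setT f ->
  integrableR mu (fun x => f x * g x) -> integrableR nu f.
Proof.
move=> mf /integrableP[_ h]; apply/integrableP; split; first exact/measurable_EFinP.
rewrite ge0_integral_density//; last by apply: measurableT_comp => //; exact/measurable_EFinP.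
apply: le_lt_trans h; rewrite le_eqVlt; apply/orP; left; apply/eqP.
by apply: eq_integral => x _; rewrite /= -EFinM normrM (ger0_norm (g0 x)).
Qed.

Lemma Rint_density (f : T -> R) : measurable_fun setT f ->
  integrableR mu (fun x => f x * g x) -> \int[nu]_x f x = \int[mu]_x (f x * g x).
Proof.
move=> mf hf; have hn := integrableR_density mf hf.
have pos (k : T -> R) : measurable_fun setT k -> (forall x, 0 <= k x) ->
    \int[nu]_x k x = \int[mu]_x (k x * g x).
  move=> mk k0; rewrite /Rintegral (ge0_integral_density (f := EFin \o k))//.
  exact/measurable_EFinP.
have mN : measurable_fun setT (fun x => `|f x|) by exact: measurableT_comp.
have m2 : measurable_fun setT (fun x => `|f x| + f x) by exact: measurable_funD.
have iN : integrableR nu (fun x => `|f x|).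
  by apply: (integrable_norm (f := f)).
have iNm : integrableR mu (fun x => `|f x| * g x).
  have := integrable_norm hf; apply: eq_integrable => // x _.
  by rewrite /= normrM (ger0_norm (g0 x)).
(* Both [|f| + f] and [|f|] are nonnegative, so the signed case follows by cancelling the integral
   of [|f|]. *)
have : \int[nu]_x (`|f x| + f x) = \int[mu]_x ((`|f x| + f x) * g x).
  apply: pos => // x; have := ler_norm (- f x); rewrite normrN; lra.
rewrite RintD// pos//.
under [in RHS]eq_Rintegral do rewrite mulrDl.
by rewrite RintD// => /addrI.
Qed.

End density.

Section normal_moments.
Variables (R : realType) (m s : R).
Hypothesis s0 : 0 < s.
Local Notation leb := (@lebesgue_measure R).
Local Notation N := (normal_prob m s).
Let p : R -> R := normal_pdf m s.

Let s_neq0 : s != 0. Proof. by rewrite gt_eqF. Qed.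

Let pE x : p x = normal_peak s * expR (- ((x - m) ^+ 2 / (s ^+ 2 *+ 2))).
Proof. by rewrite /p normal_pdfE// /normal_fun mulNr. Qed.

Let p_ge0 x : 0 <= p x. Proof. exact: normal_pdf_ge0. Qed.

Let mp : measurable_fun setT p. Proof. exact: measurable_normal_pdf. Qed.

Let u x := (x - m) ^+ 2 / (s ^+ 2 *+ 2).

Let uE x : (x - m) ^+ 2 = 2 * s ^+ 2 * u x.
Proof. by rewrite /u -mulr_natr; field; exact: s_neq0. Qed.

Let u0 x : 0 <= u x.
Proof. by rewrite /u divr_ge0 ?sqr_ge0// mulrn_wge0// sqr_ge0. Qed.

(** With [u] the exponent, [1 + 2 * s ^+ 2 * u <= (1 + 2 * s ^+ 2) * expR u]. The bound makes
    boundary terms vanish in the integration by parts. *)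
Let pdf_tail x : (1 + (x - m) ^+ 2) * p x <= normal_peak s * (1 + 2 * s ^+ 2).
Proof.
rewrite pE mulrCA ler_pM2l ?normal_peak_gt0// -/(u x) uE.
rewrite -ler_pdivlMr ?expR_gt0// expRN invrK.
have w0 := sqr_ge0 s; have wv := mulr_ge0 w0 (u0 x); have v0 := u0 x.
have c0 : 0 <= 1 + 2 * s ^+ 2 by lra.
by apply: le_trans (ler_wpM2l c0 (expR_ge1Dx (u x))); lra.
Qed.

(** Domination by the density of standard deviation [2 * s], whose exponent is [- u + 3 / 4 * u].
    The constant 8/3 makes [(1 + 8 / 3 * s ^+ 2) * (1 + 3 / 4 * u)] at least
    [1 + 2 * s ^+ 2 * u]. *)
Let pdf_moment x : (1 + (x - m) ^+ 2) * p x <=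
  normal_peak s / normal_peak (2 * s) * (1 + 8 / 3 * s ^+ 2) * normal_pdf m (2 * s) x.
Proof.
have s2 : 2 * s != 0 by rewrite mulf_neq0// pnatr_eq0.
rewrite (normal_pdfE _ s2) /normal_fun pE.
rewrite (_ : - (x - m) ^+ 2 / ((2 * s) ^+ 2 *+ 2) = - (u x) + 3 / 4 * u x); last first.
  by rewrite /u -[s ^+ 2 *+ 2]mulr_natr -[(2 * s) ^+ 2 *+ 2]mulr_natr; field.
rewrite expRD -/(u x) uE.
have pk := normal_peak_gt0 s2.
rewrite [leRHS](_ : _ = normal_peak s * expR (- u x) * ((1 + 8 / 3 * s ^+ 2) * expR (3 / 4 * u x))); last first.
  by field; rewrite gt_eqF.
rewrite [leLHS]mulrC ler_pM2l; last by rewrite mulr_gt0 ?expR_gt0// normal_peak_gt0.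
have w0 := sqr_ge0 s; have wv := mulr_ge0 w0 (u0 x); have v0 := u0 x.
have c0 : 0 <= 1 + 8 / 3 * s ^+ 2 by lra.
by apply: le_trans (ler_wpM2l c0 (expR_ge1Dx (3 / 4 * u x))); lra.
Qed.

Lemma normal_quad_lebesgue_integrable (f : R -> R) A : measurable_fun setT f ->
  (forall x, `|f x| <= A * (1 + (x - m) ^+ 2)) ->
  integrableR leb (fun x => f x * p x).
Proof.
move=> mf fA; pose c := A * (normal_peak s / normal_peak (2 * s) * (1 + 8 / 3 * s ^+ 2)).
have A0 : 0 <= A.
  by have := fA m; rewrite subrr expr0n /= addr0 mulr1; apply: le_trans.
apply: (@integrableR_le _ _ R leb (fun x => f x * p x) (fun x => c * normal_pdf m (2 * s) x)).
- exact: measurable_funM.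
- by apply: integrableRZ; exact: integrable_normal_pdf.
- move=> x; rewrite normrM (ger0_norm (p_ge0 x)).
  apply: (le_trans (ler_wpM2r (p_ge0 x) (fA x))).
  by have := ler_wpM2l A0 (pdf_moment x); rewrite /c !mulrA.
Qed.

Let NE A : measurable A -> N A = (\int[leb]_(x in A) (p x)%:E)%E.
Proof. by []. Qed.

Lemma normal_quad_integrable (f : R -> R) A : measurable_fun setT f ->
  (forall x, `|f x| <= A * (1 + (x - m) ^+ 2)) -> integrableR N f.
Proof.
move=> mf fA; have h := normal_quad_lebesgue_integrable mf fA.
exact: (@integrableR_density _ _ R leb N p mp p_ge0 NE f mf h).
Qed.

Let normal_Rint (f : R -> R) A : measurable_fun setT f ->
  (forall x, `|f x| <= A * (1 + (x - m) ^+ 2)) ->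
  \int[N]_x f x = \int[leb]_x (f x * p x).
Proof.
move=> mf fA; have h := normal_quad_lebesgue_integrable mf fA.
exact: (@Rint_density _ _ R leb N p mp p_ge0 NE f mf h).
Qed.

Let p_derive (x : R) : is_derive x (1 : R) p (- ((x - m) / s ^+ 2) * p x).
Proof.
have -> : p = (fun x => normal_peak s * expR (- ((x - m) ^+ 2 / (s ^+ 2 *+ 2)))).
  by apply/funext => y; exact: pE.
apply: is_derive_eq.
by rewrite /GRing.scale /= -[s ^+ 2 *+ 2]mulr_natr; field.
Qed.

(** Stein's identity. It yields the mean, the variance and the differential equation of the
    characteristic function. *)
Lemma normal_ibp (f f' : R -> R) A : (forall x : R, is_derive x (1 : R) f (f' x)) ->
  continuous f' -> (forall x, `|f x| <= A * (1 + `|x - m|)) -> (forall x, `|f' x| <= A) ->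
  \int[N]_x ((x - m) * f x) = s ^+ 2 * \int[N]_x f' x.
Proof.
move=> df cf' fA f'A.
have cf : continuous f.
  by move=> x; apply/differentiable_continuous/derivable1_diffP; have [] := df x.
have mf : measurable_fun setT f by exact: continuous_measurable_fun.
have mf' : measurable_fun setT f' by exact: continuous_measurable_fun.
have A0 : 0 <= A by apply: le_trans (f'A m).
have b1 x : `|(x - m) * f x| <= 2 * A * (1 + (x - m) ^+ 2).
  rewrite normrM; have := ler_wpM2l (normr_ge0 (x - m)) (fA x).
  rewrite -(real_normK (num_real (x - m))); move: (`|x - m|) => z h.
  have hz : z + z ^+ 2 <= 2 * (1 + z ^+ 2).
    by have := sqr_ge0 (z - 1); have := sqr_ge0 z; lra.
  by apply: (le_trans h); have := ler_wpM2l A0 hz; lra.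
have b2 x : `|f' x| <= A * (1 + (x - m) ^+ 2).
  by apply: (le_trans (f'A x)); rewrite ler_peMr// lerDl sqr_ge0.
have m1 : measurable_fun setT (fun x : R => (x - m) * f x).
  by apply: measurable_funM => //; exact: measurable_funB.
have i1 := normal_quad_lebesgue_integrable m1 b1.
have i2 := normal_quad_lebesgue_integrable mf' b2.
rewrite (normal_Rint m1 b1) (normal_Rint mf' b2).
(* The derivative of [f * p]; the identity says that its integral over the line is 0. *)
pose G x := f' x * p x + (- (s ^+ 2)^-1) * ((x - m) * f x * p x).
have iG : integrableR leb G by apply: integrableRD => //; exact: integrableRZ.
suff : \int[leb]_x G x = 0.
  rewrite RintD//; last exact: integrableRZ.
  rewrite RintZ// => h; have s2 : s ^+ 2 != 0 by rewrite expf_neq0.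
  have := congr1 (fun z => s ^+ 2 * z) h; rewrite mulr0 mulrDr mulrA mulrN mulfV// mulN1r.
  by move/eqP; rewrite subr_eq0 => /eqP.
pose F x := f x * p x.
have dF (x : R) : is_derive x (1 : R) F (G x).
  have h1 := df x; have h2 := p_derive x.
  by apply: is_derive_eq; rewrite /G /GRing.scale /=; field.
have cF : continuous F.
  by move=> x; apply/differentiable_continuous/derivable1_diffP; have [] := dF x.
have cp : continuous p by exact: continuous_normal_pdf.
have cG : continuous G.
  move=> x; apply: cvgD; first by apply: cvgM; [exact: cf'|exact: cp].
  apply: cvgMl_tmp; apply: cvgM; last exact: cp.
  apply: cvgM; last exact: cf.
  by apply: cvgB; [exact: cvg_id|exact: cvg_cst].
pose I k := `[m - k.+1%:R, m + k.+1%:R]%classic.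
have FTC k : \int[leb]_x (G \_ (I k)) x = F (m + k.+1%:R) - F (m - k.+1%:R).
  rewrite -Rintegral_mkcond /Rintegral (@continuous_FTC2 _ G F)//.
  - by have : 0 < k.+1%:R :> R by []; lra.
  - exact: continuous_subspaceT.
  - split; first by move=> x _; have [] := dF x.
      by apply: cvg_at_right_filter; exact: cF.
    by apply: cvg_at_left_filter; exact: cF.
  - by move=> x _; rewrite derive1E; have [] := dF x.
have lim1 : \int[leb]_x (G \_ (I k)) x @[k --> \oo] --> \int[leb]_x G x.
  apply: (@Rint_dominated _ _ R leb (fun k => G \_ (I k)) G (fun x => `|G x|)).
  - move=> k; apply: (measurable_restrictT G (measurable_itv `[m - k.+1%:R, m + k.+1%:R])).1.
    by apply: measurable_funTS; exact: continuous_measurable_fun.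
  - exact: integrable_norm iG.
  - by move=> k x; rewrite patchE; case: ifP => // _; rewrite normr0.
  - move=> x; apply: cvg_near_cst.
    exists (Num.truncn `|x - m|) => // k /= hk.
    rewrite patchE mem_set// /I /= in_itv /=.
    have := truncnS_gt `|x - m|; have : (Num.truncn `|x - m|).+1%:R <= k.+1%:R :> R.
      by rewrite ler_nat.
    move=> h1 h2; have := lt_le_trans h2 h1; rewrite ltr_norml => /andP[h3 h4].
    by apply/andP; split; lra.
(* By [pdf_tail], [f * p] decays like the inverse distance to [m], so the boundary terms are at most
   [2 * K / k.+1%:R]. *)
pose K := 2 * A * (normal_peak s * (1 + 2 * s ^+ 2)).
have Fb x : `|x - m| * `|F x| <= K.
  rewrite /F normrM (ger0_norm (p_ge0 x)) mulrA.
  apply: (@le_trans _ _ (2 * A * (1 + (x - m) ^+ 2) * p x)).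
    by rewrite ler_wpM2r// -normrM.
  by rewrite -mulrA ler_wpM2l// mulr_ge0.
have lim2 : \int[leb]_x (G \_ (I k)) x @[k --> \oo] --> (0 : R).
  under eq_fun do rewrite FTC.
  apply/norm_cvg0P; apply: (@squeeze_cvgr _ _ _ _ (fun=> 0) (fun k => 2 * K * k.+1%:R^-1)).
  - apply: nearW => k; rewrite normr_ge0 /=.
    have kp : 0 < k.+1%:R :> R by [].
    rewrite ler_pdivlMr// mulrC.
    have := Fb (m + k.+1%:R); have := Fb (m - k.+1%:R).
    rewrite (_ : m + k.+1%:R - m = k.+1%:R); last by ring.
    rewrite (_ : m - k.+1%:R - m = - k.+1%:R); last by ring.
    rewrite normrN (gtr0_norm kp) => h1 h2.
    apply: (le_trans (ler_wpM2l (ltW kp) (ler_normB _ _))).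
    by rewrite mulrDr; lra.
  - exact: cvg_cst.
  - rewrite -(mulr0 (2 * K)); apply: cvgMl_tmp; exact: cvg_harmonic.
exact: (cvg_unique _ lim1 lim2).
Qed.

End normal_moments.

(** * Moments and characteristic function of the normal law on the line *)

Section normal_characteristic.
Variables (R : realType) (m s : R).
Hypothesis s0 : 0 < s.
Local Notation N := (normal_prob m s).

Lemma measurable_cos_affine (t a : R) : measurable_fun setT (fun x : R => cos (t * x + a)).
Proof.
apply: measurableT_comp; first exact: (continuous_measurable_fun (@continuous_cos R)).
by apply: measurable_funD => //; apply: measurable_funM.
Qed.

Lemma normal_centered_integrable (f : R -> R) A : measurable_fun setT f ->
  (forall x, `|f x| <= A * `|x - m|) -> integrableR N f.
Proof.
move=> mf fA; apply: (@normal_quad_integrable R m s s0 f `|A|) => // x.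
apply: (le_trans (fA x)); apply: (le_trans (ler_norm _)); rewrite normrM normr_id ler_wpM2l//.
rewrite -(real_normK (num_real (x - m))); have := sqr_ge0 (`|x - m| - 1).
by have := normr_ge0 (x - m); move: (`|x - m|) => z; nra.
Qed.

Lemma normal_mean0 : \int[N]_x (x - m) = 0.
Proof.
have := @normal_ibp R m s s0 (fun=> 1) (fun=> 0) 1.
rewrite (_ : \int[N]_x (0 : R) = 0) ?mulr0; last exact: Rint_cst.
move=> <- //.
- by apply: eq_Rintegral => x _; rewrite mulr1.
- by move=> x; exact: cvg_cst.
- by move=> x; rewrite normr1 mul1r lerDl.
- by move=> x; rewrite normr0.
Qed.

Lemma normal_variance : \int[N]_x (x - m) ^+ 2 = s ^+ 2.
Proof.
have -> : s ^+ 2 = s ^+ 2 * \int[N]_x (1 : R).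
  by rewrite (_ : \int[N]_x (1 : R) = 1) ?mulr1//; exact: Rint_cst.
have dx (x : R) : is_derive x (1 : R) (fun x => x - m) 1.
  by apply: is_derive_eq; rewrite subr0.
rewrite -(normal_ibp s0 (A := 1) dx) //.
- by move=> x; exact: cvg_cst.
- by move=> x; rewrite mul1r lerDr.
- by move=> x; rewrite normr1.
Qed.

(** As a function of the frequency [u], the integral [h] satisfies [h' = - s ^+ 2 * u * h]:
    differentiation under the integral produces the factor [x - m], and Stein's identity removes it.
    The phase [a] keeps the argument within real functions. *)
Lemma normal_centered_cf (t a : R) :
  \int[N]_x cos (t * (x - m) + a) = cos a * expR (- (s ^+ 2 * t ^+ 2 / 2)).
Proof.
pose f (u y : R) := cos (u * (y - m) + a).
pose h u := \int[N]_y f u y.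
have mc u : measurable_fun setT (f u).
  have -> : f u = (fun x => cos (u * x + (a - u * m))).
    by apply/funext => y; rewrite /f; congr cos; ring.
  exact: measurable_cos_affine.
have ms u : measurable_fun setT (fun x : R => sin (u * (x - m) + a)).
  have -> : (fun x : R => sin (u * (x - m) + a)) = (fun x => cos (u * x + (a - u * m - pi / 2))).
    by apply/funext => y; rewrite -cosBpihalf; congr cos; ring.
  exact: measurable_cos_affine.
have df u (y : R) : is_derive (u : R) (1 : R) (f ^~ y) (- (y - m) * sin (u * (y - m) + a)).
  by apply: is_derive_eq; rewrite /GRing.scale /=; ring.
have d1f u y : partial1of2 f u y = - (y - m) * sin (u * (y - m) + a).
  by rewrite partial1of2E; have [] := df u y.
have sin1 (x : R) : `|sin x| <= 1 by rewrite -cosBpihalf cos_max.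
have dh u : is_derive (u : R) (1 : R) h (- (s ^+ 2 * u) * h u).
  have Iu : `]u - 1, u + 1[%classic u by rewrite /= in_itv /=; apply/andP; split; lra.
  have intf x : `]u - 1, u + 1[%classic x -> N.-integrable setT (EFin \o f x).
    by move=> _; exact: (@integrableR_bounded _ _ R N (f x) 1 (mc x) (fun y => cos_max _)).
  have der x y : `]u - 1, u + 1[%classic x -> setT y -> derivable (f ^~ y) x 1.
    by move=> _ _; have [] := df x y.
  pose G (y : R) := `|y - m|.
  have G0 y : 0 <= G y by exact: normr_ge0.
  have iG : N.-integrable setT (EFin \o G).
    apply: (@normal_centered_integrable _ 1) => [|x]; last by rewrite mul1r normr_id.
    by apply: measurableT_comp => //; exact: measurable_funB.
  have Gub x y : `]u - 1, u + 1[%classic x -> setT y -> `|partial1of2 f x y| <= G y.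
    by move=> _ _; rewrite d1f normrM normrN /G ler_piMr.
  have h1 := derivable_under_integral measurableT Iu intf der G0 iG Gub.
  have h2 := differentiation_under_integral measurableT Iu intf der G0 iG Gub.
  apply: DeriveDef => //; rewrite -derive1E [LHS]h2.
  have -> : \int[N]_y partial1of2 f u y = \int[N]_y (-1 * ((y - m) * sin (u * (y - m) + a))).
    by apply: eq_Rintegral => y _; rewrite d1f; ring.
  rewrite RintZ; last first.
    apply: (@normal_centered_integrable _ 1) => [|x]; last by rewrite normrM mul1r ler_piMr.
    by apply: measurable_funM => //; exact: measurable_funB.
  have dsin (x : R) : is_derive x (1 : R) (fun x => sin (u * (x - m) + a)) (u * f u x).
    by apply: is_derive_eq; rewrite /GRing.scale /= /f; ring.
  rewrite (normal_ibp s0 (A := 1 + `|u|) dsin); last 3 first.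
  - move=> x; apply: cvgMl_tmp; apply: (@continuous_comp _ _ _ (fun x => u * (x - m) + a) cos).
      by apply: cvgD; [apply: cvgMl_tmp; apply: cvgB; [exact: cvg_id|exact: cvg_cst]|exact: cvg_cst].
    exact: continuous_cos.
  - move=> x; apply: (le_trans (sin1 _)).
    have := normr_ge0 u; have := normr_ge0 (x - m) => h3 h4.
    by have := mulr_ge0 h4 h3; lra.
  - move=> x; rewrite normrM (le_trans (ler_wpM2l (normr_ge0 u) (cos_max _)))//.
    by rewrite mulr1 lerDr.
  rewrite RintZ; last exact: (@integrableR_bounded _ _ R N (f u) 1 (mc u) (fun y => cos_max _)).
  by rewrite /h; ring.
(* The integrating factor makes [g] constant, and [g 0 = cos a]. *)
pose g u := h u * expR (s ^+ 2 * u ^+ 2 / 2).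
have dg (u : R) : is_derive (u : R) (1 : R) g 0.
  have h1 := dh u; apply: is_derive_eq.
  by rewrite /GRing.scale /=; field.
have h0 : h 0 = cos a.
  rewrite /h -[RHS](Rint_cst N); apply: eq_Rintegral => y _.
  by rewrite /f mul0r add0r.
have gt : g t = cos a.
  by rewrite (is_derive_0_is_cst t 0 dg) /g h0 expr0n /= mulr0 mul0r expR0 mulr1.
rewrite -gt /g -/(h t) -[RHS]mulrA -expRD.
by rewrite subrr expR0 mulr1.
Qed.

Lemma normal_cf (t a : R) :
  \int[N]_x cos (t * x + a) = cos (t * m + a) * expR (- (s ^+ 2 * t ^+ 2 / 2)).
Proof.
rewrite -normal_centered_cf; apply: eq_Rintegral => x _; congr cos; ring.
Qed.

End normal_characteristic.

Section expectation_functional.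
Context d (T : measurableType d) (R : realType) (P : {finite_measure set T -> \bar R}).
Context d' (T' : measurableType d').
Variables (h : T -> R) (Y : T -> T').
Hypotheses (ih : integrableR P h) (mY : measurable_fun setT Y).

Let F (f : T' -> R) := \int[P]_x (h x * f (Y x)).

Lemma functional_integrable f : bdd_meas f -> integrableR P (fun x => h x * f (Y x)).
Proof.
move=> [mf [M fM]].
apply: (integrableR_le (g := fun x => M * `|h x|)).
- by apply: measurable_funM; [exact: integrableR_meas ih|exact: measurableT_comp].
- by apply: integrableRZ; exact: integrable_norm ih.
- by move=> x; rewrite normrM mulrC ler_wpM2r.
Qed.

Lemma functional_lin a f g : bdd_meas f -> bdd_meas g ->
  F (fun y => a * f y + g y) = a * F f + F g.
Proof.
move=> bf bg; have i1 := functional_integrable bf; have i2 := functional_integrable bg.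
rewrite /F -RintZ// -RintD//; last exact: integrableRZ.
by apply: eq_Rintegral => x _; ring.
Qed.

Lemma functional_cvg (f_ : nat -> T' -> R) f M :
  (forall k, measurable_fun setT (f_ k)) -> (forall k y, `|f_ k y| <= M) ->
  (forall y, f_ k y @[k --> \oo] --> f y) -> F (f_ k) @[k --> \oo] --> F f.
Proof.
move=> mf fM cf; apply: (@Rint_dominated _ _ R P (fun k x => h x * f_ k (Y x)) _ (fun x => M * `|h x|)).
- by move=> k; apply: measurable_funM; [exact: integrableR_meas ih|exact: measurableT_comp].
- by apply: integrableRZ; exact: integrable_norm ih.
- by move=> k x; rewrite normrM mulrC ler_wpM2r.
- by move=> x; apply: cvgMl_tmp; exact: cf.
Qed.

End expectation_functional.

Lemma Rint_indic d (T : measurableType d) (R : realType) (P : probability T R) (A : set T) :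
  measurable A -> \int[P]_x \1_A x = fine (P A).
Proof.
move=> mA; rewrite /Rintegral; congr fine.
by rewrite integral_indic// setIT.
Qed.

Section equal_laws.
Context d (T : measurableType d) (R : realType) (P : probability T R).
Context d' (T' : measurableType d') (P' : probability T' R).

Lemma cf_law m (X : T -> vecR R m) (X' : T' -> vecR R m) :
  measurable_fun setT X -> measurable_fun setT X' ->
  (forall (t : 'cV[R]_m) a, \int[P]_x cos ((t^T *m (X x : 'cV[R]_m)) 0 0 + a) =
    \int[P']_x cos ((t^T *m (X' x : 'cV[R]_m)) 0 0 + a)) ->
  forall A, measurable A -> P (X @^-1` A) = P' (X' @^-1` A).
Proof.
move=> mX mX' hcos A mA.
have i1 := integrableR_cst P (1 : R); have i1' := integrableR_cst P' (1 : R).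
have mA1 : measurable (X @^-1` A) by rewrite -[_ @^-1` _]setTI; exact: mX.
have mA2 : measurable (X' @^-1` A) by rewrite -[_ @^-1` _]setTI; exact: mX'.
have : \int[P]_x (1 * \1_A (X x)) - \int[P']_x (1 * \1_A (X' x)) = 0.
  (* The functional is the difference of the two expectations; the weight 1 gives it the form of the
     expectation functionals above. *)
  apply: (@fourier_uniqueness R m (fun f => \int[P]_x (1 * f (X x)) - \int[P']_x (1 * f (X' x)))).
  - move=> a f g bf bg; rewrite (functional_lin i1 mX a bf bg) (functional_lin i1' mX' a bf bg).
    by ring.
  - move=> f_ f M mf fM cf; apply: cvgB.
      exact: (functional_cvg i1 mX mf fM cf).
    exact: (functional_cvg i1' mX' mf fM cf).
  - move=> t a; apply/eqP; rewrite subr_eq0; apply/eqP.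
    under eq_Rintegral do rewrite mul1r.
    under [RHS]eq_Rintegral do rewrite mul1r.
    exact: hcos.
  - exact: bdd_meas_indic.
under eq_Rintegral do rewrite mul1r.
under [X in _ - X]eq_Rintegral do rewrite mul1r.
rewrite (Rint_indic P mA1) (Rint_indic P' mA2) => /eqP; rewrite subr_eq0 => /eqP h.
by rewrite -[LHS]fineK ?fin_num_measure// h fineK// fin_num_measure.
Qed.

Lemma cf_law1 (X : T -> R) (X' : T' -> R) :
  measurable_fun setT X -> measurable_fun setT X' ->
  (forall t a, \int[P]_x cos (t * X x + a) = \int[P']_x cos (t * X' x + a)) ->
  forall A, measurable A -> P (X @^-1` A) = P' (X' @^-1` A).
Proof.
move=> mX mX' hcos A mA.
pose Y x : vecR R 1 := const_mx (X x); pose Y' x : vecR R 1 := const_mx (X' x).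
have mY : measurable_fun setT Y by apply: measurable_vecR => i; under eq_fun do rewrite mxE.
have mY' : measurable_fun setT Y' by apply: measurable_vecR => i; under eq_fun do rewrite mxE.
pose B : set (vecR R 1) := [set y | A ((y : 'cV[R]_1) 0 0)].
have mB : measurable B.
  by have := @measurable_coord R 1 0 measurableT _ mA; rewrite setTI.
have -> : X @^-1` A = Y @^-1` B by apply/seteqP; split=> x; rewrite /B /Y /= mxE.
have -> : X' @^-1` A = Y' @^-1` B by apply/seteqP; split=> x; rewrite /B /Y' /= mxE.
apply: cf_law => // t a.
have E (x : R) : (t^T *m const_mx x) 0 0 = t 0 0 * x.
  by rewrite mxE big_ord1 !mxE.
under eq_Rintegral do rewrite E.
under [RHS]eq_Rintegral do rewrite E.
exact: hcos.
Qed.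

Lemma law_eq_Rint d2 (V : measurableType d2) (X : T -> V) (X' : T' -> V) (f : V -> R) :
  measurable_fun setT X -> measurable_fun setT X' ->
  (forall A, measurable A -> P (X @^-1` A) = P' (X' @^-1` A)) ->
  measurable_fun setT f -> integrableR P (fun x => f (X x)) ->
  \int[P]_x f (X x) = \int[P']_x f (X' x).
Proof.
move=> mX mX' XX' mf iP.
have [phi phiE] : exists phi : {mfun T >-> V}, phi = X :> (T -> V) by exists (mfun_Sub (mem_set mX)).
pose nu : probability V R := distribution P phi.
have h A : measurable A -> P (X @^-1` A) = nu A by rewrite -phiE.
have h' A : measurable A -> P' (X' @^-1` A) = nu A by move=> mA; rewrite -h// XX'.
have iF : integrableR nu f.
  apply/integrableP; split; first exact/measurable_EFinP.
  rewrite -(ge0_law_integral mX h (f := fun y => `|(f y)%:E|%E))//.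
    by have /integrableP[] := iP.
  by apply: measurableT_comp => //; exact/measurable_EFinP.
by rewrite (law_Rint mX h iF) (law_Rint mX' h' iF).
Qed.

End equal_laws.

Section normal1_law.
Context d (T : measurableType d) (R : realType) (P : probability T R).
Variables (X : T -> R) (m v : R).
Hypotheses (mX : measurable_fun setT X) (v0 : 0 <= v).

(** One measure covers the Dirac case [v = 0] and the case with a density, so that degenerate
    covariances need no separate treatment later. *)
Let normal1_cf_measure : exists nu : probability (measurableTypeR R) R,
  [/\ (forall A, measurable A -> nu A = normal1 m v A),
   integrableR nu (fun x => x ^+ 2),
   \int[nu]_x x = m, \int[nu]_x (x - m) ^+ 2 = v &
   forall t a, \int[nu]_x cos (t * x + a) = cos (t * m + a) * expR (- (v * t ^+ 2 / 2))].
Proof.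
have [v00|vn0] := eqVneq v 0.
  exists (@dirac _ (measurableTypeR R) m R : probability (measurableTypeR R) R).
  have I (f : R -> R) : measurable_fun setT f -> \int[@dirac _ (measurableTypeR R) m R]_x f x = f m.
    move=> mf; rewrite /Rintegral integral_dirac//; last exact/measurable_EFinP.
    by rewrite diracT mul1e.
  split.
  - by move=> A mA; rewrite /normal1 v00 eqxx.
  - apply/integrableP; split; first by apply/measurable_EFinP; exact: measurable_funX.
    rewrite integral_dirac//; first by rewrite diracT mul1e ltry.
    by apply: measurableT_comp => //; apply/measurable_EFinP; exact: measurable_funX.
  - by rewrite I.
  - rewrite I ?subrr ?expr0n ?v00//; apply: measurable_funX; exact: measurable_funB.
  - move=> t a; rewrite I ?v00 ?mul0r ?oppr0 ?expR0 ?mulr1//; exact: measurable_cos_affine.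
have vp : 0 < v by rewrite lt_def vn0.
have s0 : 0 < Num.sqrt v by rewrite sqrtr_gt0.
exists (normal_prob m (Num.sqrt v) : probability (measurableTypeR R) R).
have i1 : integrableR (normal_prob m (Num.sqrt v)) (fun x => x - m).
  apply: (@normal_centered_integrable _ _ _ s0 _ 1) => [|x]; last by rewrite mul1r.
  exact: measurable_funB.
split.
- by move=> A mA; rewrite /normal1 (negPf vn0).
- apply: (@normal_quad_integrable _ m _ s0 _ (2 * (1 + m ^+ 2))) => [|x]; first exact: measurable_funX.
  rewrite ger0_norm ?sqr_ge0//.
  have := mulr_ge0 (sqr_ge0 m) (sqr_ge0 (x - m)); have := sqr_ge0 (x - 2 * m); have := sqr_ge0 m; nra.
- have -> : \int[normal_prob m (Num.sqrt v)]_x x = \int[normal_prob m (Num.sqrt v)]_x ((x - m) + m).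
    by apply: eq_Rintegral => x _; rewrite subrK.
  rewrite RintD//; last exact: integrableR_cst.
  by rewrite normal_mean0// Rint_cst add0r.
- by rewrite normal_variance// sqr_sqrtr.
- by move=> t a; rewrite normal_cf// sqr_sqrtr.
Qed.

Lemma normal1_law_moments :
  (forall A, measurable A -> P (X @^-1` A) = normal1 m v A) ->
  [/\ integrableR P (fun x => X x ^+ 2),
   \int[P]_x X x = m, \int[P]_x (X x - m) ^+ 2 = v &
   forall t a, \int[P]_x cos (t * X x + a) = cos (t * m + a) * expR (- (v * t ^+ 2 / 2))].
Proof.
move=> law; have [nu [nuE i2 n1 n2 n3]] := normal1_cf_measure.
have lawnu A : measurable A -> P (X @^-1` A) = nu A by move=> mA; rewrite law// nuE.
have m2 : measurable_fun setT (fun x : R => x ^+ 2) by exact: measurable_funX.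
have i1 := integrableR_sqr (@measurable_id _ (measurableTypeR R) setT) i2.
have mX' : @measurable_fun _ _ T (measurableTypeR R) setT X by [].
have iq : integrableR nu (fun x => (x - m) ^+ 2).
  apply: (@integrableR_le _ (measurableTypeR R) R nu (fun x => (x - m) ^+ 2) (fun x => 2 * x ^+ 2 + 2 * m ^+ 2)).
  - by apply: measurable_funX; exact: measurable_funB.
  - by apply: integrableRD; [exact: integrableRZ|exact: integrableR_cst].
  - by move=> x; rewrite ger0_norm ?sqr_ge0//; have := sqr_ge0 (x + m); nra.
split.
- exact: (law_integrableR mX' lawnu m2 i2).
- by rewrite (law_Rint mX' lawnu (f := fun x => x)).
- by rewrite (law_Rint mX' lawnu (f := fun x => (x - m) ^+ 2)).
- move=> t a; rewrite (law_Rint mX' lawnu (f := fun x => cos (t * x + a)))//.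
  apply: (@integrableR_bounded _ (measurableTypeR R) R nu _ 1); first exact: measurable_cos_affine.
  by move=> x; exact: cos_max.
Qed.

Lemma normal1_law_cf :
  (forall t a, \int[P]_x cos (t * X x + a) = cos (t * m + a) * expR (- (v * t ^+ 2 / 2))) ->
  forall A, measurable A -> P (X @^-1` A) = normal1 m v A.
Proof.
move=> hcf A mA; have [nu [nuE _ _ _ n3]] := normal1_cf_measure.
rewrite -nuE// (cf_law1 (P' := nu) (X' := (id : measurableTypeR R -> R)) mX) //.
by move=> t a; rewrite hcf n3.
Qed.

End normal1_law.

(** * Joint normal laws *)

Section independence.
Context d (T : measurableType d) (R : realType) (P : probability T R).
Context d1 d2 (T1 : measurableType d1) (T2 : measurableType d2).
Variables (X1 : T -> T1) (X2 : T -> T2).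
Hypotheses (mX1 : measurable_fun setT X1) (mX2 : measurable_fun setT X2).
Hypothesis indep : forall A B, measurable A -> measurable B ->
  P (X1 @^-1` A `&` X2 @^-1` B) = (P (X1 @^-1` A) * P (X2 @^-1` B))%E.

Let mpre1 A : measurable A -> measurable (X1 @^-1` A).
Proof. by move=> mA; rewrite -[_ @^-1` _]setTI; exact: mX1. Qed.

Let mpre2 A : measurable A -> measurable (X2 @^-1` A).
Proof. by move=> mA; rewrite -[_ @^-1` _]setTI; exact: mX2. Qed.

Let indep_indic A f : measurable A -> bdd_meas f ->
  \int[P]_x (\1_A (X1 x) * f (X2 x)) = fine (P (X1 @^-1` A)) * \int[P]_x (1 * f (X2 x)).
Proof.
move=> mA bf; set c := fine _.
have i1 := integrableR_cst P (1 : R).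
have iA : integrableR P (fun x => \1_A (X1 x) : R).
  apply: (@integrableR_bounded _ _ _ P _ 1).
    by apply: measurableT_comp => //; exact: measurable_indic.
  by move=> x; rewrite indicE; case: (_ \in _); rewrite ?normr1 ?normr0.
apply/eqP; rewrite -subr_eq0; apply/eqP.
apply: (@bounded_functional_zero _ _ _ (fun f =>
  \int[P]_x (\1_A (X1 x) * f (X2 x)) - c * \int[P]_x (1 * f (X2 x)))) => //.
- move=> a g h bg bh; rewrite (functional_lin iA mX2 a bg bh) (functional_lin i1 mX2 a bg bh).
  by ring.
- move=> g_ g M mg gM cg; apply: cvgB; first exact: (functional_cvg iA mX2 mg gM cg).
  apply: cvgMl_tmp; exact: (functional_cvg i1 mX2 mg gM cg).
- move=> B mB.
  have -> : \int[P]_x (1 * \1_B (X2 x)) = fine (P (X2 @^-1` B)).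
    by rewrite -Rint_indic//; [apply: eq_Rintegral => x _; rewrite mul1r|exact: mpre2].
  have -> : \int[P]_x (\1_A (X1 x) * \1_B (X2 x)) = fine (P (X1 @^-1` A `&` X2 @^-1` B)).
    rewrite -Rint_indic//; last by apply: measurableI; [exact: mpre1|exact: mpre2].
    by apply: eq_Rintegral => x _; rewrite indicI.
  by rewrite indep// fineM ?fin_num_measure ?subrr//; [exact: mpre1|exact: mpre2].
Qed.

(** Product sets are extended one factor at a time: [indep_indic] fixes an indicator of [X1] and
    varies the function of [X2]; here that function is fixed and the indicator of [X1] is replaced
    by [f]. *)
Lemma indep_Rint f g : bdd_meas f -> bdd_meas g ->
  \int[P]_x (f (X1 x) * g (X2 x)) = \int[P]_x f (X1 x) * \int[P]_x g (X2 x).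
Proof.
move=> bf bg.
have i1 := integrableR_cst P (1 : R).
have ig : integrableR P (fun x => 1 * g (X2 x)) by exact: (functional_integrable i1 mX2 bg).
have ig' : integrableR P (fun x => g (X2 x)).
  by apply: eq_integrable ig => // x _ /=; rewrite mul1r.
have -> : \int[P]_x g (X2 x) = \int[P]_x (1 * g (X2 x)).
  by apply: eq_Rintegral => x _; rewrite mul1r.
have -> : \int[P]_x f (X1 x) = \int[P]_x (1 * f (X1 x)).
  by apply: eq_Rintegral => x _; rewrite mul1r.
set c := \int[P]_x (1 * g (X2 x)).
have -> : \int[P]_x (f (X1 x) * g (X2 x)) = \int[P]_x (g (X2 x) * f (X1 x)).
  by apply: eq_Rintegral => x _; rewrite mulrC.
apply/eqP; rewrite -subr_eq0; apply/eqP.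
apply: (@bounded_functional_zero _ _ _ (fun f =>
  \int[P]_x (g (X2 x) * f (X1 x)) - \int[P]_x (1 * f (X1 x)) * c)) => //.
- move=> a h k bh bk; rewrite (functional_lin ig' mX1 a bh bk) (functional_lin i1 mX1 a bh bk).
  by ring.
- move=> h_ h M mh hM ch; apply: cvgB; first exact: (functional_cvg ig' mX1 mh hM ch).
  by apply: cvgMr_tmp; exact: (functional_cvg i1 mX1 mh hM ch).
- move=> A mA.
  have -> : \int[P]_x (1 * \1_A (X1 x)) = fine (P (X1 @^-1` A)).
    by rewrite -Rint_indic//; [apply: eq_Rintegral => x _; rewrite mul1r|exact: mpre1].
  apply/eqP; rewrite subr_eq0; apply/eqP; rewrite -indep_indic//.
  by apply: eq_Rintegral => x _; rewrite mulrC.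
Qed.

End independence.

Lemma bdd_meas_cos_affine (R : realType) (t a : R) : bdd_meas (fun x : R => cos (t * x + a)).
Proof. by split; [exact: measurable_cos_affine|exists 1 => x; exact: cos_max]. Qed.

Lemma indep_normal_sum d (T : measurableType d) (R : realType) (P : probability T R)
    (X1 X2 : T -> R) (m1 v1 m2 v2 : R) :
  measurable_fun setT X1 -> measurable_fun setT X2 -> 0 <= v1 -> 0 <= v2 ->
  (forall A B, measurable A -> measurable B ->
    P (X1 @^-1` A `&` X2 @^-1` B) = (P (X1 @^-1` A) * P (X2 @^-1` B))%E) ->
  (forall A, measurable A -> P (X1 @^-1` A) = normal1 m1 v1 A) ->
  (forall A, measurable A -> P (X2 @^-1` A) = normal1 m2 v2 A) ->
  forall A, measurable A -> P [set x | A (X1 x + X2 x)] = normal1 (m1 + m2) (v1 + v2) A.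
Proof.
move=> mX1 mX2 v10 v20 indep l1 l2.
have [_ _ _ cf1] := normal1_law_moments mX1 v10 l1.
have [_ _ _ cf2] := normal1_law_moments mX2 v20 l2.
apply: (@normal1_law_cf _ T R P (fun x => X1 x + X2 x)); [exact: measurable_funD|exact: addr_ge0|].
move=> t a.
have bb (s b s' b' : R) : \int[P]_x (cos (s * X1 x + b) * cos (s' * X2 x + b')) =
    \int[P]_x cos (s * X1 x + b) * \int[P]_x cos (s' * X2 x + b').
  apply: (indep_Rint mX1 mX2 indep (f := fun x => cos (s * x + b)) (g := fun x => cos (s' * x + b')));
    exact: bdd_meas_cos_affine.
have ii (s b s' b' : R) : integrableR P (fun x => cos (s * X1 x + b) * cos (s' * X2 x + b')).
  have [mc1 _] := bdd_meas_cos_affine s b; have [mc2 _] := bdd_meas_cos_affine s' b'.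
  apply: (@integrableR_bounded _ _ _ P _ 1).
    apply: measurable_funM; first exact: (measurableT_comp mc1).
    exact: (measurableT_comp mc2).
  by move=> x; rewrite normrM mulr_ile1// cos_max.
(* Addition formula, with the sines written as cosines of phase shifted by [pi / 2], so that
   independence and the known cosine integrals apply to both products. *)
have -> : \int[P]_x cos (t * (X1 x + X2 x) + a) = \int[P]_x
    (cos (t * X1 x + 0) * cos (t * X2 x + a) + -1 *
      (cos (t * X1 x + - (pi / 2)) * cos (t * X2 x + (a - pi / 2)))).
  apply: eq_Rintegral => x _.
  have -> : t * X2 x + (a - pi / 2) = t * X2 x + a - pi / 2 by ring.
  by rewrite !cosBpihalf addr0 mulN1r -cosD; congr cos; ring.
rewrite RintD ?RintZ// ?bb ?cf1 ?cf2; last exact: integrableRZ.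
have -> : t * m2 + (a - pi / 2) = t * m2 + a - pi / 2 by ring.
have -> : t * (m1 + m2) + a = (t * m1 + 0) + (t * m2 + a) by ring.
have -> : - ((v1 + v2) * t ^+ 2 / 2) = - (v1 * t ^+ 2 / 2) + - (v2 * t ^+ 2 / 2) by ring.
by rewrite !cosBpihalf expRD !addr0 (cosD (t * m1)); ring.
Qed.

Lemma exists_pushforward d d' (T : measurableType d) (T' : measurableType d') (R : realType)
    (P : probability T R) (f : T -> T') : measurable_fun setT f ->
  exists P' : probability T' R, forall A, measurable A -> P' A = P (f @^-1` A).
Proof.
move=> mf.
have [X XE] : exists X : {mfun T >-> T'}, X = f :> (T -> T').
  by exists (mfun_Sub (mem_set mf)).
exists (distribution P X : probability T' R) => A mA.
by rewrite -XE.
Qed.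

Lemma exists_product d1 d2 (T1 : measurableType d1) (T2 : measurableType d2) (R : realType)
    (P1 : probability T1 R) (P2 : probability T2 R) :
  exists P : probability (T1 * T2)%type R, forall A B, measurable A -> measurable B ->
    P (A `*` B) = (P1 A * P2 B)%E.
Proof. exists ((P1 \x P2)%E : probability (T1 * T2)%type R) => A B mA mB.
exact: product_measure1E. Qed.

Section joint_normal.
Variables (R : realType) (n1 n2 : nat).
Local Notation V := (vecR R n1 * vecR R n2)%type.

Lemma dotDr k (u x y : 'cV[R]_k) : u *d (x + y) = u *d x + u *d y.
Proof. by rewrite mulmxDr mxDE. Qed.

Lemma dotZr k (u x : 'cV[R]_k) c : u *d (c *: x) = c * (u *d x).
Proof. by rewrite -scalemxAr mxZE. Qed.

Lemma measurable_dot_pair (u : 'cV[R]_n1) (v : 'cV[R]_n2) :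
  measurable_fun setT (fun z : V => u *d z.1 + v *d z.2).
Proof.
apply: measurable_funD.
  exact: (measurableT_comp (measurable_dot u) measurable_fst).
exact: (measurableT_comp (measurable_dot v) measurable_snd).
Qed.

(** Induction on the list: start from the Dirac law at the mean and add each vector of the list
    times a fresh independent standard normal variable. *)
Lemma exists_joint_normal (s : seq ('cV[R]_n1 * 'cV[R]_n2)) (mx : 'cV[R]_n1) (mw : 'cV[R]_n2) :
  exists Q : probability V R, forall (u : 'cV[R]_n1) (v : 'cV[R]_n2) A, measurable A ->
    Q [set z | A (u *d z.1 + v *d z.2)] =
    normal1 (u *d mx + v *d mw) (\sum_(l <- s) (u *d l.1 + v *d l.2) ^+ 2) A.
Proof.
elim: s => [|l s [Q' IH]].
  exists (@dirac _ V ((mx, mw) : V) R : probability V R) => u v A mA.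
  by rewrite big_nil /normal1 eqxx /= !diracE; congr (_%:R%:E); congr nat_of_bool;
    apply/idP/idP => /set_mem h; apply/mem_set.
have [P0 P0E] := exists_product Q' (normal_prob 0 1 : probability (measurableTypeR R) R).
pose phi (z : V * measurableTypeR R) : V :=
  ((z.1.1 : 'cV[R]_n1) + (z.2 : R) *: l.1, (z.1.2 : 'cV[R]_n2) + (z.2 : R) *: l.2).
have mphi : measurable_fun setT phi.
  apply/measurable_fun_pairP; split.
    apply: (@measurable_vecR R n1) => i; under eq_fun do rewrite /= mxE mxZE mulrC.
    apply: measurable_funD.
      exact: (measurableT_comp (measurable_coord i) (measurableT_comp measurable_fst measurable_fst)).
    by apply: measurable_funM => //; exact: measurable_snd.
  apply: (@measurable_vecR R n2) => i; under eq_fun do rewrite /= mxE mxZE mulrC.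
  apply: measurable_funD.
    exact: (measurableT_comp (measurable_coord i) (measurableT_comp measurable_snd measurable_fst)).
  by apply: measurable_funM => //; exact: measurable_snd.
have [Q QE] := exists_pushforward P0 mphi.
exists Q => u v A mA.
have mset (B : set R) : measurable B -> measurable [set z : V | B (u *d z.1 + v *d z.2)].
  by move=> mB; rewrite -[X in measurable X]setTI; exact: (measurable_dot_pair u v measurableT mB).
rewrite QE; last exact: mset.
pose c := u *d l.1 + v *d l.2.
pose X1 (z : V * measurableTypeR R) : R := u *d z.1.1 + v *d z.1.2.
pose X2 (z : V * measurableTypeR R) : R := c * z.2.
have -> : phi @^-1` [set z | A (u *d z.1 + v *d z.2)] = [set z | A (X1 z + X2 z)].
  apply/seteqP; split=> z /=; rewrite /phi /X1 /X2 /c /= !dotDr !dotZr;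
    by congr A; ring.
rewrite big_cons [X in normal1 _ X]addrC -[X in normal1 X]addr0.
have mX1 : measurable_fun setT X1 by exact: (measurableT_comp (measurable_dot_pair u v) measurable_fst).
have mcx : measurable_fun setT (fun x : R => c * x) by exact: measurable_funM.
have mX2 : measurable_fun setT X2 by exact: (measurableT_comp mcx measurable_snd).
have P1E (B : set V) : measurable B -> P0 (fst @^-1` B) = Q' B.
  by move=> mB; have := P0E B setT mB measurableT; rewrite probability_setT mule1 setXT.
have P2E (B : set (measurableTypeR R)) : measurable B -> P0 (snd @^-1` B) = normal_prob 0 1 B.
  by move=> mB; have := P0E setT B measurableT mB; rewrite probability_setT mul1e setTX.
have mset2 (B : set R) : measurable B -> measurable ((fun x : measurableTypeR R => c * (x : R)) @^-1` B).
  by move=> mB; rewrite -[X in measurable X]setTI; exact: mcx.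
apply: indep_normal_sum => //.
- by apply: sumr_ge0 => p _; exact: sqr_ge0.
- exact: sqr_ge0.
- move=> B C mB mC.
  rewrite (_ : X1 @^-1` B = fst @^-1` [set z : V | B (u *d z.1 + v *d z.2)])//.
  rewrite (_ : X2 @^-1` C = snd @^-1` ((fun x : measurableTypeR R => c * (x : R)) @^-1` C))//.
  rewrite P1E; last exact: mset. rewrite P2E; last exact: mset2.
  by rewrite -P0E; [|exact: mset|exact: mset2].
- by move=> B mB; rewrite -IH// -P1E//; exact: mset.
- move=> B mB; rewrite (_ : X2 @^-1` B = snd @^-1` ((fun x : measurableTypeR R => c * (x : R)) @^-1` B))//.
  rewrite P2E; last exact: mset2.
  apply: (@normal1_law_cf _ (measurableTypeR R) R (normal_prob 0 1)) => //; first exact: sqr_ge0.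
  move=> t a; have := @normal_cf R 0 1 ltr01 (t * c) a.
  rewrite !mulr0 expr1n mul1r exprMn [c ^+ 2 * _]mulrC => <-.
  by apply: eq_Rintegral => x _; rewrite mulrA.
Qed.

End joint_normal.

Lemma dotBr (R : realType) k (u x y : 'cV[R]_k) : u *d (x - y) = u *d x - u *d y.
Proof. by rewrite mulmxBr !mxLE. Qed.

Lemma bformE (R : realType) (d e : nat) (C : 'M[R]_(d, e)) (u : 'cV[R]_d) (v : 'cV[R]_e) :
  (u^T *m C *m v) 0 0 = \sum_i \sum_j (u i 0 * v j 0) * C i j.
Proof.
rewrite -mulmxA mxE; apply: eq_bigr => i _; rewrite !mxE mulr_sumr; apply: eq_bigr => j _.
by ring.
Qed.

Lemma delta_dot (R : realType) k (y : 'cV[R]_k) i : (delta_mx i 0 : 'cV[R]_k) *d y = y i 0.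
Proof. by rewrite trmx_delta -rowE mxE. Qed.

Lemma qform_delta (R : realType) k (A : 'M[R]_k) i :
  ((delta_mx i 0 : 'cV[R]_k)^T *m A *m (delta_mx i 0 : 'cV[R]_k)) 0 0 = A i i.
Proof. by rewrite trmx_delta -rowE -colE !mxE. Qed.

(** * Second moments of couplings with normal marginals *)

Section normal_vectors.
Context d (T : measurableType d) (R : realType) (P : probability T R).

Definition normal_vector n (Z : T -> 'cV[R]_n) mu S :=
  forall (u : 'cV[R]_n) A, measurable A ->
    P ((fun x => u *d Z x) @^-1` A) = normal1 (u *d mu) ((u^T *m S *m u) 0 0) A.

Section one.
Variables (n : nat) (Z : T -> 'cV[R]_n) (mu : 'cV[R]_n) (S : 'M[R]_n).
Hypotheses (mZ : forall i, measurable_fun setT (fun x => Z x i 0)).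
Hypotheses (pS : psd S) (nZ : normal_vector Z mu S).

Lemma measurable_dot_comp (u : 'cV[R]_n) : measurable_fun setT (fun x => u *d Z x).
Proof.
by under eq_fun do rewrite dotE; apply: measurable_sum => i; apply: measurable_funM.
Qed.

Lemma measurable_centered (u : 'cV[R]_n) : measurable_fun setT (fun x => u *d (Z x - mu)).
Proof.
under eq_fun do rewrite dotBr; apply: measurable_funB => //; exact: measurable_dot_comp.
Qed.

Lemma normal_vector_sqr (u : 'cV[R]_n) : integrableR P (fun x => (u *d (Z x - mu)) ^+ 2).
Proof.
have [i2 _ _ _] := normal1_law_moments (measurable_dot_comp u) (pS.2 u) (nZ u).
apply: (integrableR_le (g := fun x => 2 * (u *d Z x) ^+ 2 + 2 * (u *d mu) ^+ 2)).
- by apply: measurable_funX; exact: measurable_centered.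
- by apply: integrableRD; [exact: integrableRZ|exact: integrableR_cst].
- move=> x; rewrite dotBr ger0_norm ?sqr_ge0//; move: (u *d Z x) (u *d mu) => a b.
  by have := sqr_ge0 (a + b); nra.
Qed.

Lemma normal_vector_variance (u : 'cV[R]_n) :
  \int[P]_x (u *d (Z x - mu)) ^+ 2 = (u^T *m S *m u) 0 0.
Proof.
have [_ _ <- _] := normal1_law_moments (measurable_dot_comp u) (pS.2 u) (nZ u).
by apply: eq_Rintegral => x _; rewrite dotBr.
Qed.

End one.

Section two.
Variables (n1 n2 : nat) (Z1 : T -> 'cV[R]_n1) (Z2 : T -> 'cV[R]_n2).
Variables (mu1 : 'cV[R]_n1) (S1 : 'M[R]_n1) (mu2 : 'cV[R]_n2) (S2 : 'M[R]_n2).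
Hypotheses (mZ1 : forall i, measurable_fun setT (fun x => Z1 x i 0)).
Hypotheses (mZ2 : forall i, measurable_fun setT (fun x => Z2 x i 0)).
Hypotheses (pS1 : psd S1) (pS2 : psd S2).
Hypotheses (nZ1 : normal_vector Z1 mu1 S1) (nZ2 : normal_vector Z2 mu2 S2).

Definition cross_cov : 'M[R]_(n1, n2) :=
  \matrix_(i, j) \int[P]_x ((Z1 x - mu1) i 0 * (Z2 x - mu2) j 0).

Lemma cross_integrable (u : 'cV[R]_n1) (v : 'cV[R]_n2) :
  integrableR P (fun x => (u *d (Z1 x - mu1)) * (v *d (Z2 x - mu2))).
Proof.
apply: integrableR_mul; [exact: measurable_centered|exact: measurable_centered| |].
  exact: (normal_vector_sqr mZ1 pS1 nZ1).
exact: (normal_vector_sqr mZ2 pS2 nZ2).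
Qed.

Lemma cross_covE (u : 'cV[R]_n1) (v : 'cV[R]_n2) :
  \int[P]_x ((u *d (Z1 x - mu1)) * (v *d (Z2 x - mu2))) = (u^T *m cross_cov *m v) 0 0.
Proof.
have ii i j : integrableR P (fun x => (Z1 x - mu1) i 0 * (Z2 x - mu2) j 0).
  have := cross_integrable (delta_mx i 0) (delta_mx j 0).
  by under [X in EFin \o X]eq_fun do rewrite !delta_dot.
rewrite bformE.
under [RHS]eq_bigr do under eq_bigr do rewrite [cross_cov _ _]mxE -RintZ//.
have ij i : integrableR P (fun x => \sum_j u i 0 * v j 0 * ((Z1 x - mu1) i 0 * (Z2 x - mu2) j 0)).
  by apply: integrableR_sum => j; exact: integrableRZ.
transitivity (\sum_i \int[P]_x (\sum_j u i 0 * v j 0 * ((Z1 x - mu1) i 0 * (Z2 x - mu2) j 0))).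
  rewrite -Rint_sum//.
  apply: eq_Rintegral => x _.
  rewrite !dotE mulr_suml; apply: eq_bigr => i _.
  by rewrite mulr_sumr; apply: eq_bigr => j _; ring.
by apply: eq_bigr => i _; rewrite Rint_sum// => j; exact: integrableRZ.
Qed.

Lemma coupling_second_moment (u : 'cV[R]_n1) (v : 'cV[R]_n2) :
  integrableR P (fun x => (u *d (Z1 x - mu1) + v *d (Z2 x - mu2)) ^+ 2) /\
  \int[P]_x (u *d (Z1 x - mu1) + v *d (Z2 x - mu2)) ^+ 2 =
  (u^T *m S1 *m u) 0 0 + 2 * (u^T *m cross_cov *m v) 0 0 + (v^T *m S2 *m v) 0 0.
Proof.
have i1 := normal_vector_sqr mZ1 pS1 nZ1 u; have i2 := normal_vector_sqr mZ2 pS2 nZ2 v.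
have i3 := integrableRZ 2 (cross_integrable u v).
have -> : (fun x => (u *d (Z1 x - mu1) + v *d (Z2 x - mu2)) ^+ 2) =
  (fun x => (u *d (Z1 x - mu1)) ^+ 2 + (2 * ((u *d (Z1 x - mu1)) * (v *d (Z2 x - mu2))) +
    (v *d (Z2 x - mu2)) ^+ 2)) by apply/funext => x; ring.
split; first by apply: integrableRD => //; exact: integrableRD.
rewrite RintD//; last exact: integrableRD.
rewrite RintD// RintZ; last exact: cross_integrable.
rewrite cross_covE (normal_vector_variance mZ1 pS1 nZ1) (normal_vector_variance mZ2 pS2 nZ2).
by rewrite addrA.
Qed.

(** The form of the block matrix at [(u, v)] is the second moment of
    [u *d (Z1 - mu1) + v *d (Z2 - mu2)]. The coupling is arbitrary: only the marginals are
    normal. *)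
Lemma coupling_psd : psd (block_mx S1 cross_cov cross_cov^T S2).
Proof.
split=> [|x]; first by rewrite tr_block_mx pS1.1 pS2.1 trmxK.
rewrite -[x]vsubmxK; set u := usubmx x; set v := dsubmx x.
have [i E] := coupling_second_moment u v.
have -> : ((col_mx u v)^T *m block_mx S1 cross_cov cross_cov^T S2 *m col_mx u v) 0 0 =
  (u^T *m S1 *m u) 0 0 + 2 * (u^T *m cross_cov *m v) 0 0 + (v^T *m S2 *m v) 0 0.
  rewrite tr_col_mx mul_row_block mul_row_col !mulmxDl !mxLE.
  have -> : (v^T *m cross_cov^T *m u) 0 0 = (u^T *m cross_cov *m v) 0 0 by rewrite bformC trmxK.
  by ring.
rewrite -E; apply: Rintegral_ge0 => y _; exact: sqr_ge0.
Qed.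

End two.

Section cost.
Variables (n : nat) (Z1 Z2 : T -> 'cV[R]_n) (mu : 'cV[R]_n) (S1 S2 : 'M[R]_n).
Hypotheses (mZ1 : forall i, measurable_fun setT (fun x => Z1 x i 0)).
Hypotheses (mZ2 : forall i, measurable_fun setT (fun x => Z2 x i 0)).
Hypotheses (pS1 : psd S1) (pS2 : psd S2).
Hypotheses (nZ1 : normal_vector Z1 mu S1) (nZ2 : normal_vector Z2 mu S2).

Lemma coupling_cost : (\int[P]_x (sqnorm (Z1 x - Z2 x))%:E =
  (\tr S1 + \tr S2 - 2 * \tr (cross_cov Z1 Z2 mu mu))%:E)%E.
Proof.
pose e i : 'cV[R]_n := delta_mx i 0.
have h i := coupling_second_moment mZ1 mZ2 pS1 pS2 nZ1 nZ2 (e i) (- e i).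
have E x : sqnorm (Z1 x - Z2 x) = \sum_i (e i *d (Z1 x - mu) + (- e i) *d (Z2 x - mu)) ^+ 2.
  apply: eq_bigr => i _; rewrite linearN /= mulNmx mxNE !delta_dot !mxLE.
  by congr (_ ^+ 2); ring.
under eq_integral do rewrite E.
rewrite Rint_EFin; last by apply: integrableR_sum => i; exact: (h i).1.
rewrite Rint_sum; last by move=> i; exact: (h i).1.
congr (_%:E); rewrite (eq_bigr (fun i => S1 i i + S2 i i - 2 * cross_cov Z1 Z2 mu mu i i)).
  by rewrite big_split sumrN big_split -mulr_sumr.
move=> i _; rewrite (h i).2 [(- e i)^T]linearN /= !(mulNmx, mulmxN) !mxLE opprK.
by rewrite !qform_delta; ring.
Qed.

End cost.
End normal_vectors.

Section coordinates.
Variables (R : realType) (n1 n2 : nat).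
Local Notation V := (vecR R n1 * vecR R n2)%type.

Definition proj1 (z : V) : 'cV[R]_n1 := z.1.
Definition proj2 (z : V) : 'cV[R]_n2 := z.2.

Lemma measurable_proj1 i : measurable_fun setT (fun z => proj1 z i 0).
Proof. exact: (measurableT_comp (measurable_coord i) measurable_fst). Qed.

Lemma measurable_proj2 i : measurable_fun setT (fun z => proj2 z i 0).
Proof. exact: (measurableT_comp (measurable_coord i) measurable_snd). Qed.

Lemma is_normal_proj1 (Q : probability V R) mu S :
  is_normal (fun A => Q (A `*` setT)) mu S <-> normal_vector Q proj1 mu S.
Proof.
by split=> h u A mA; have := h u A mA; rewrite setXT.
Qed.

Lemma is_normal_proj2 (Q : probability V R) mu S :
  is_normal (fun A => Q (setT `*` A)) mu S <-> normal_vector Q proj2 mu S.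
Proof.
by split=> h u A mA; have := h u A mA; rewrite setTX.
Qed.

(** The list consists of the columns of the square root [L] of the block matrix, as the squared norm
    of [L^T (u, v)] is the required variance. *)
Lemma exists_joint_normal_cov (S1 : 'M[R]_n1) C (S2 : 'M[R]_n2) mu1 mu2 :
  psd (block_mx S1 C C^T S2) -> exists Q : probability V R,
  forall (u : 'cV[R]_n1) (v : 'cV[R]_n2) A, measurable A ->
    Q [set z | A (u *d proj1 z + v *d proj2 z)] = normal1 (u *d mu1 + v *d mu2)
      ((u^T *m S1 *m u) 0 0 + 2 * (u^T *m C *m v) 0 0 + (v^T *m S2 *m v) 0 0) A.
Proof.
move=> pM; have [pL L2] := sqrtmP pM; set M := block_mx _ _ _ _ in pM pL L2; set L := sqrtm M in pL L2.
have [Q hQ] := exists_joint_normal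
  [seq (col j (usubmx L), col j (dsubmx L)) | j <- enum 'I_(n1 + n2)] mu1 mu2.
have E (u : 'cV[R]_n1) (v : 'cV[R]_n2) :
    \sum_j (u *d col j (usubmx L) + v *d col j (dsubmx L)) ^+ 2 =
    (u^T *m S1 *m u) 0 0 + 2 * (u^T *m C *m v) 0 0 + (v^T *m S2 *m v) 0 0.
  transitivity (sqnorm (L^T *m col_mx u v)).
    apply: eq_bigr => j _; congr (_ ^+ 2).
    rewrite -[in RHS](vsubmxK L) tr_col_mx mul_row_col mxDE.
    by congr (_ + _); rewrite !mxE; apply: eq_bigr => i _; rewrite !mxE mulrC.
  rewrite sqnormE trmx_mul trmxK pL.1 mulmxA -[_ *m L *m L]mulmxA L2.
  rewrite tr_col_mx mul_row_block mul_row_col !mulmxDl !mxLE.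
  have -> : (v^T *m C^T *m u) 0 0 = (u^T *m C *m v) 0 0 by rewrite bformC trmxK.
  by ring.
exists Q => u v A mA; rewrite -E; have := hQ u v A mA.
by rewrite big_map big_enum.
Qed.

End coordinates.

(** * The Wasserstein distance of normal laws *)

Section wasserstein.
Variables (R : realType) (n : nat) (mu : 'cV[R]_n) (S Sh : 'M[R]_n) (rho : R).
Hypotheses (pS : psd S) (pSh : psd Sh) (rho0 : 0 <= rho).
Local Notation V := (vecR R n * vecR R n)%type.

Lemma wass_normal_gelbrich : (wass_normal mu S mu Sh <= rho%:E)%E -> gelbrich_le S Sh rho.
Proof.
pose g := \tr S + \tr Sh - 2 * \tr (sqrtm (sqrtm Sh *m S *m sqrtm Sh)).
have gE : \tr (S + Sh - 2%:R *: sqrtm (sqrtm Sh *m S *m sqrtm Sh)) = g.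
  by rewrite linearB /= linearD /= linearZ.
rewrite /gelbrich_le gE => hW.
have : (sqrte g%:E <= rho%:E)%E.
  apply: le_trans hW; apply: le_ereal_inf_tmp => _ [pi [n1 n2] <-].
  move/is_normal_proj1 in n1; move/is_normal_proj2 in n2.
  have m1 := @measurable_proj1 R n n; have m2 := @measurable_proj2 R n n.
  have := coupling_cost m1 m2 pS pSh n1 n2; rewrite /proj1 /proj2 => ->.
  rewrite lee_fin ler_wsqrtr// /g lerD2l lerN2 ler_pM2l ?ltr0n//.
  exact: (gelbrich_lower pS pSh (coupling_psd m1 m2 pS pSh n1 n2)).
rewrite lee_fin => h.
(* The real square root of a negative number is 0, so squaring recovers [g] only if it is
   nonnegative. *)
have [g0|g0] := leP 0 g; last by rewrite (le_trans (ltW g0))// sqr_ge0.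
by rewrite -(sqr_sqrtr g0) lerXn2r// nnegrE sqrtr_ge0.
Qed.

Lemma gelbrich_wass_normal : gelbrich_le S Sh rho -> (wass_normal mu S mu Sh <= rho%:E)%E.
Proof.
move=> /(gelbrich_sdp rho pS pSh)[C [pM hC]].
have [pi hpi] := exists_joint_normal_cov mu mu pM.
have d0 k (y : 'cV[R]_k) : (0 : 'cV[R]_k) *d y = 0 by rewrite trmx0 mul0mx mxE.
have b0 k l (A : 'M[R]_(k, l)) (y : 'cV[R]_l) : ((0 : 'cV[R]_k)^T *m A *m y) 0 0 = 0.
  by rewrite trmx0 !mul0mx mxE.
have b0' k l (A : 'M[R]_(k, l)) (y : 'cV[R]_k) : (y^T *m A *m (0 : 'cV[R]_l)) 0 0 = 0.
  by rewrite mulmx0 mxE.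
have n1 : normal_vector pi (@proj1 R n n) mu S.
  move=> u A mA; have := hpi u 0 A mA; rewrite !(d0, b0, b0') mulr0 !addr0 => <-.
  by congr (pi _); apply/seteqP; split=> z /=; rewrite d0 addr0.
have n2 : normal_vector pi (@proj2 R n n) mu Sh.
  move=> u A mA; have := hpi 0 u A mA; rewrite !(d0, b0, b0') mulr0 !add0r => <-.
  by congr (pi _); apply/seteqP; split=> z /=; rewrite d0 add0r.
apply: (@le_trans _ _ (sqrte (\int[pi]_z (sqnorm ((z.1 : 'cV[R]_n) - z.2))%:E)%E)).
  apply: ereal_inf_lbound; exists pi; last by [].
  by split; [exact: (is_normal_proj1 pi mu S).2 n1|exact: (is_normal_proj2 pi mu Sh).2 n2].
have m1 := @measurable_proj1 R n n; have m2 := @measurable_proj2 R n n.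
have E : (\int[pi]_z (sqnorm ((z.1 : 'cV[R]_n) - z.2))%:E =
    (\tr S + \tr Sh - 2 * \tr C)%:E)%E.
  have pe i := coupling_second_moment m1 m2 pS pSh n1 n2 (delta_mx i 0) (delta_mx i 0).
  have := coupling_cost m1 m2 pS pSh n1 n2; rewrite {1}/proj1 {1}/proj2 => ->.
  (* The traces of [C] and of the cross covariance of [pi] are compared entry by entry on the
     diagonal, by computing the variance of the sum of the two [i]-th coordinates once from the
     joint law and once from the marginals. *)
  congr (_ - 2 * _)%:E; apply: eq_bigr => i _; set K := cross_cov _ _ _ _ _.
  pose e : 'cV[R]_n := delta_mx i 0.
  have mX : measurable_fun setT (fun z : V => e *d proj1 z + e *d proj2 z).
    exact: measurable_dot_pair.
  have v0 : 0 <= (e^T *m S *m e) 0 0 + 2 * (e^T *m C *m e) 0 0 + (e^T *m Sh *m e) 0 0.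
    have := pM.2 (col_mx e e).
    rewrite tr_col_mx mul_row_block mul_row_col !mulmxDl !mxLE.
    have -> : (e^T *m C^T *m e) 0 0 = (e^T *m C *m e) 0 0 by rewrite bformC trmxK.
    lra.
  have [_ _ h _] := normal1_law_moments mX v0 (hpi e e).
  have [_] := pe i; rewrite -/e -/K !qform_delta.
  have -> : \int[pi]_x (e *d (proj1 x - mu) + e *d (proj2 x - mu)) ^+ 2 =
    \int[pi]_x (e *d proj1 x + e *d proj2 x - (e *d mu + e *d mu)) ^+ 2.
    by apply: eq_Rintegral => x _; rewrite !dotBr; congr (_ ^+ 2); ring.
  rewrite h !qform_delta; lra.
rewrite E lee_fin -(ler_sqr) ?nnegrE ?sqrtr_ge0// sqr_sqrtr//.
have := coupling_cost m1 m2 pS pSh n1 n2; rewrite {1}/proj1 {1}/proj2 E => -[->].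
rewrite -lee_fin -(coupling_cost m1 m2 pS pSh n1 n2).
by apply: integral_ge0 => z _; rewrite lee_fin sqnorm_ge0.
Qed.

End wasserstein.

Lemma exists_normal_vector (R : realType) (n : nat) (mu : 'cV[R]_n) (S : 'M[R]_n) : psd S ->
  exists P : probability (vecR R n) R, is_normal P mu S.
Proof.
move=> pS; have [pL L2] := sqrtmP pS.
(* A single normal vector is a pair whose second component has dimension 0. *)
have [Q hQ] := exists_joint_normal [seq (col j (sqrtm S), 0 : 'cV[R]_0) | j <- enum 'I_n] mu 0.
have [P PE] := exists_pushforward Q measurable_fst.
exists P => u A mA; rewrite PE; last first.
  by rewrite -[X in measurable X]setTI; exact: measurable_dot.
have d0 (y : 'cV[R]_0) : (0 : 'cV[R]_0) *d y = 0 by rewrite trmx0 mul0mx mxE.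
have E : \sum_j (u *d col j (sqrtm S) + (0 : 'cV[R]_0) *d (0 : 'cV[R]_0)) ^+ 2 = (u^T *m S *m u) 0 0.
  transitivity (sqnorm ((sqrtm S)^T *m u)).
    apply: eq_bigr => j _; rewrite d0 addr0; congr (_ ^+ 2); rewrite !mxE.
    by apply: eq_bigr => i _; rewrite !mxE mulrC.
  by rewrite sqnormE trmx_mul trmxK pL.1 mulmxA -[_ *m sqrtm S *m sqrtm S]mulmxA L2.
have := hQ u 0 A mA; rewrite big_map big_enum /= E d0 addr0 => <-.
by congr (Q _); apply/seteqP; split=> z /=; rewrite d0 addr0.
Qed.

Lemma exists_normal_prod (R : realType) (n m : nat) mux (Sx : 'M[R]_n) muw (Sw : 'M[R]_m) :
  psd Sx -> psd Sw ->
  exists Q : probability (vecR R n * vecR R m)%type R, is_normal_prod Q mux Sx muw Sw.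
Proof.
move=> /(exists_normal_vector mux)[P1 h1] /(exists_normal_vector muw)[P2 h2].
have [Q hQ] := exists_product P1 P2.
have Q1 A : measurable A -> Q (A `*` setT) = P1 A.
  by move=> mA; rewrite hQ// probability_setT mule1.
have Q2 A : measurable A -> Q (setT `*` A) = P2 A.
  by move=> mA; rewrite hQ// probability_setT mul1e.
exists Q; split.
- move=> u A mA; rewrite Q1 ?h1//.
  by rewrite -[X in measurable X]setTI; exact: measurable_dot.
- move=> u A mA; rewrite Q2 ?h2//.
  by rewrite -[X in measurable X]setTI; exact: measurable_dot.
- by move=> A B mA mB; rewrite Q1// Q2// hQ.
Qed.

(** * Uncorrelated normal components *)

Section decorrelation.
Context d (T : measurableType d) (R : realType) (P : probability T R).
Variables (k : nat) (Z : T -> 'cV[R]_k) (mu : 'cV[R]_k) (S : 'M[R]_k).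
Hypotheses (mZ : forall i, measurable_fun setT (fun x => Z x i 0)).
Hypotheses (pS : psd S) (nZ : normal_vector P Z mu S).

Lemma normal_vector_cf (u : 'cV[R]_k) a : \int[P]_x cos (u *d Z x + a) =
  cos (u *d mu + a) * expR (- ((u^T *m S *m u) 0 0 / 2)).
Proof.
have [_ _ _ h] := normal1_law_moments (measurable_dot_comp mZ u) (pS.2 u) (nZ u).
have := h 1 a; rewrite expr1n mulr1 mul1r => <-.
by apply: eq_Rintegral => x _; rewrite mul1r.
Qed.

Lemma measurable_mulmx_comp p (A : 'M[R]_(p, k)) i :
  measurable_fun setT (fun x => (A *m Z x) i 0).
Proof.
by under eq_fun do rewrite mxE; apply: measurable_sum => j; apply: measurable_funM.
Qed.

(* The reflection of the component [D (Z - mu)], which is uncorrelated with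
   [G Z], preserves the joint law. *)
Lemma uncorrelated_orthogonal p q (D : 'M[R]_(p, k)) (G : 'M[R]_(q, k)) i (f : vecR R q -> R) :
  D *m S *m G^T = 0 -> measurable_fun setT f ->
  integrableR P (fun x => (D *m (Z x - mu)) i 0 * f (G *m Z x)) ->
  \int[P]_x ((D *m (Z x - mu)) i 0 * f (G *m Z x)) = 0.
Proof.
move=> DG mf iF.
pose W (s : R) x : vecR R (1 + q) := col_mx (const_mx (s * (D *m (Z x - mu)) i 0)) (G *m Z x).
have mE : measurable_fun setT (fun x => (D *m (Z x - mu)) i 0).
  under eq_fun do rewrite mulmxBr !mxLE.
  by apply: measurable_funB => //; exact: measurable_mulmx_comp.
have mW s : measurable_fun setT (W s).
  apply: measurable_vecR => j; case: (split_ordP j) => l ->.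
    by under eq_fun do rewrite col_mxEu mxE; exact: measurable_funM.
  by under eq_fun do rewrite col_mxEd; exact: measurable_mulmx_comp.
pose c : 'cV[R]_k := D^T *m delta_mx i 0.
have cE (y : 'cV[R]_k) : (D *m y) i 0 = c *d y.
  by rewrite /c trmx_mul trmxK trmx_delta -mulmxA -rowE [in RHS]mxE.
have cG (v : 'cV[R]_q) : (c^T *m S *m (G^T *m v)) 0 0 = 0.
  by rewrite /c trmx_mul trmxK -!mulmxA [D *m _]mulmxA [_ *m (G^T *m v)]mulmxA DG mul0mx mulmx0 mxE.
(* The covariance between the two blocks of [W s] vanishes by [cG], so [s] enters through its square
   only, and [W 1] and [W (-1)] have the same law. *)
have cf (t : 'cV[R]_(1 + q)) a s : \int[P]_x cos (t *d W s x + a) =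
    cos ((G^T *m dsubmx t) *d mu + a) * expR (- (((t 0 0 * s) ^+ 2 * (c^T *m S *m c) 0 0 +
      ((G^T *m dsubmx t)^T *m S *m (G^T *m dsubmx t)) 0 0) / 2)).
  set r := t 0 0 * s; set v := G^T *m dsubmx t.
  have rcv : (r *: c + v)^T = r *: c^T + v^T by rewrite linearD linearZ.
  have E x : t *d W s x + a = (r *: c + v) *d Z x + (a - r * (c *d mu)).
    rewrite -{1}(vsubmxK t) tr_col_mx /W mul_row_col mxDE.
    have -> : ((usubmx t)^T *m (const_mx (s * (D *m (Z x - mu)) i 0) : 'cV[R]_1)) 0 0 = r * (c *d (Z x - mu)).
      rewrite -cE; move: ((D *m (Z x - mu)) i 0) => w.
      rewrite dotE big_ord1 [const_mx _ _ _]mxE [usubmx _ _ _]mxE mulrA; congr (t _ _ * s * w).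
      by apply/val_inj.
    rewrite rcv mulmxDl -scalemxAl !mxLE dotBr.
    have -> : ((dsubmx t)^T *m (G *m Z x)) 0 0 = v *d Z x by rewrite /v trmx_mul trmxK mulmxA.
    by ring.
  under eq_Rintegral do rewrite E.
  rewrite normal_vector_cf; congr (cos _ * expR (- (_ / 2))).
    by rewrite rcv mulmxDl -scalemxAl !mxLE; ring.
  rewrite rcv !(mulmxDl, mulmxDr) -!(scalemxAl, scalemxAr) !mxLE.
  rewrite [(v^T *m S *m c) 0 0]bformC pS.1 !cG; ring.
pose F (y : vecR R (1 + q)) : R := (y : 'cV[R]_(1 + q)) 0 0 * f (dsubmx (y : 'cV[R]_(1 + q))).
have mF : measurable_fun setT F.
  apply: measurable_funM; first exact: measurable_coord.
  have md : measurable_fun setT (fun y : vecR R (1 + q) => dsubmx (y : 'cV[R]_(1 + q)) : vecR R q).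
    apply: measurable_vecR => j.
    by under eq_fun do rewrite mxE; exact: measurable_coord.
  exact: (measurableT_comp mf md).
have FW s x : F (W s x) = s * (D *m (Z x - mu)) i 0 * f (G *m Z x).
  rewrite /F /W col_mxKd; congr (_ * _).
  have -> : 0 = lshift q 0 :> 'I_(1 + q) by apply/val_inj.
  by rewrite col_mxEu mxE.
have law A : measurable A -> P (W 1 @^-1` A) = P (W (-1) @^-1` A).
  by apply: cf_law => // t a; rewrite !cf mulr1 mulrN1 sqrrN.
have i1 : integrableR P (fun x => F (W 1 x)).
  by under [X in EFin \o X]eq_fun do rewrite FW mul1r.
have := law_eq_Rint (mW 1) (mW (-1)) law mF i1.
under eq_Rintegral do rewrite FW mul1r.
under [RHS]eq_Rintegral do rewrite FW -mulrA.
by rewrite RintZ// => h; lra.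
Qed.

End decorrelation.

(** * Estimation risk *)

Section growth.
Variable R : realType.

Lemma sqnormD_le d (a b : 'cV[R]_d) : sqnorm (a + b) <= 2 * sqnorm a + 2 * sqnorm b.
Proof.
rewrite /sqnorm !mulr_sumr -big_split /=; apply: ler_sum => i _; rewrite mxE.
move: (a i 0) (b i 0) => x y; have := sqr_ge0 (x - y); lra.
Qed.

Lemma sqnormN d (a : 'cV[R]_d) : sqnorm (- a) = sqnorm a.
Proof. by apply: eq_bigr => i _; rewrite mxE sqrrN. Qed.

Lemma sqnorm_mulmx_le d e (A : 'M[R]_(d, e)) (y : 'cV[R]_e) :
  sqnorm (A *m y) <= \tr (A^T *m A) * sqnorm y.
Proof.
have := psd_le_tr (psd_gram A^T); rewrite trmxK => -[_ /(_ y)].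
rewrite mulmxBr mulmxBl !mxLE subr_ge0 -scalemx1 -scalemxAr mulmx1 -scalemxAl mxZE -sqnormE.
by rewrite [sqnorm (A *m y)]sqnormE trmx_mul !mulmxA.
Qed.

Lemma sqr_coord_le d (y : 'cV[R]_d) i : y i 0 ^+ 2 <= sqnorm y.
Proof. by rewrite /sqnorm (bigD1 i)//= lerDl; apply: sumr_ge0 => j _; exact: sqr_ge0. Qed.

Lemma sqnorm_growth d e (f : 'cV[R]_d -> 'cV[R]_e) :
  (exists C : R, 0 < C /\ forall y, Num.sqrt (sqnorm (f y)) <= C * (1 + Num.sqrt (sqnorm y))) <->
  (exists2 c : R, 0 <= c & forall y, sqnorm (f y) <= c * (1 + sqnorm y)).
Proof.
split=> [[C [C0 h]]|[c c0 h]].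
  exists (2 * C ^+ 2) => [|y]; first by rewrite mulr_ge0// sqr_ge0.
  have := h y; rewrite -ler_sqr ?nnegrE ?sqrtr_ge0//; last first.
    by rewrite mulr_ge0 ?addr_ge0 ?sqrtr_ge0// ltW.
  rewrite sqr_sqrtr ?sqnorm_ge0// => /le_trans; apply.
  rewrite -[X in _ <= _ * (1 + X)](sqr_sqrtr (sqnorm_ge0 y)); move: (Num.sqrt _) => z.
  have := mulr_ge0 (sqr_ge0 C) (sqr_ge0 (1 - z)); lra.
exists (1 + c); split=> [|y]; first by rewrite ltr_pwDl.
have s0 := sqrtr_ge0 (sqnorm y).
rewrite -ler_sqr ?nnegrE ?sqrtr_ge0//; last by rewrite mulr_ge0 ?addr_ge0.
rewrite sqr_sqrtr ?sqnorm_ge0//; apply: (le_trans (h y)).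
rewrite -[X in _ * (1 + X)](sqr_sqrtr (sqnorm_ge0 y)); move: (Num.sqrt _) s0 => z z0.
rewrite exprMn; apply: ler_pM => //; first by rewrite addr_ge0// sqr_ge0.
  by have := sqr_ge0 c; lra.
lra.
Qed.

End growth.

Section normal_risk.
Variables (R : realType) (n m : nat) (H : 'M[R]_(m, n)).
Variables (mux : 'cV[R]_n) (Sx : 'M[R]_n) (muw : 'cV[R]_m) (Sw : 'M[R]_m).
Variable Q : probability (vecR R n * vecR R m)%type R.
Hypotheses (pSx : psd Sx) (pSw : pd Sw) (nQ : is_normal_prod Q mux Sx muw Sw).
Local Notation V := (vecR R n * vecR R m)%type.

Let Z (z : V) : 'cV[R]_(n + m) := col_mx (proj1 z) (proj2 z).
Let mu := col_mx mux muw.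
Let S := block_mx Sx 0 0 Sw.
Let K := gain H Sx Sw.
(** On the stacked vector of signal and noise, [G] returns the observation and [D] the error of the
    optimal affine estimator, both up to the means. *)
Let G : 'M[R]_(m, n + m) := row_mx H 1%:M.
Let D : 'M[R]_(n, n + m) := row_mx (1%:M - K *m H) (- K).

Let mZ i : measurable_fun setT (fun z => Z z i 0).
Proof.
case: (split_ordP i) => j ->.
  by under eq_fun do rewrite col_mxEu; exact: measurable_proj1.
by under eq_fun do rewrite col_mxEd; exact: measurable_proj2.
Qed.

Let SE (u : 'cV[R]_n) (v : 'cV[R]_m) : ((col_mx u v)^T *m S *m col_mx u v) 0 0 =
  (u^T *m Sx *m u) 0 0 + (v^T *m Sw *m v) 0 0.
Proof.
by rewrite tr_col_mx mul_row_block mul_row_col !mulmx0 addr0 add0r mxDE.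
Qed.

Let pS : psd S.
Proof.
split=> [|x]; first by rewrite tr_block_mx !trmx0 pSx.1 pSw.1.
by rewrite -[x]vsubmxK SE addr_ge0// ?pSx.2// (pd_psd pSw).2.
Qed.

(** A projection of the stacked vector is a sum of two independent normal variables. *)
Let nZ : normal_vector Q Z mu S.
Proof.
have [n1 n2 ind] := nQ.
move=> u A mA; rewrite -[u]vsubmxK SE; set u1 := usubmx u; set u2 := dsubmx u.
have dE (x : 'cV[R]_n) (y : 'cV[R]_m) : (col_mx u1 u2) *d (col_mx x y) = u1 *d x + u2 *d y.
  by rewrite tr_col_mx mul_row_col mxDE.
rewrite dE; under eq_fun do rewrite /Z dE.
have m1 := measurable_dot_comp (@measurable_proj1 R n m) u1.
have m2 := measurable_dot_comp (@measurable_proj2 R n m) u2.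
apply: (indep_normal_sum m1 m2) => //; [exact: pSx.2|exact: (pd_psd pSw).2| | |].
- move=> B C mB mC.
  pose B' : set (vecR R n) := [set x | B (u1 *d x)]; pose C' : set (vecR R m) := [set x | C (u2 *d x)].
  have mB' : measurable B' by rewrite -[B']setTI; exact: (measurable_dot u1 measurableT mB).
  have mC' : measurable C' by rewrite -[C']setTI; exact: (measurable_dot u2 measurableT mC).
  by have := ind B' C' mB' mC'; rewrite setXT setTX.
- by move=> B mB; exact: ((is_normal_proj1 Q mux Sx).1 n1 u1 B mB).
- by move=> B mB; exact: ((is_normal_proj2 Q muw Sw).1 n2 u2 B mB).
Qed.

Let GZ z : G *m Z z = H *m proj1 z + proj2 z.
Proof. by rewrite mul_row_col mul1mx. Qed.

Let psi0 (y : vecR R m) : vecR R n := mux + K *m ((y : 'cV[R]_m) - G *m mu).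

Let DZ z : proj1 z - psi0 (G *m Z z) = D *m (Z z - mu).
Proof.
have DE x y : D *m col_mx x y = x - K *m (G *m col_mx x y).
  by rewrite !mul_row_col mul1mx mulmxBl mul1mx mulNmx mulmxDr opprD addrA mulmxA.
rewrite mulmxBr !DE /psi0 mulmxBr.
by rewrite !opprD !opprK !addrA; congr (_ + _); rewrite addrAC.
Qed.

(** The normal equation of the gain: [K] times the covariance of the observation equals
    [Sx *m H^T]. *)
Let DSG : D *m S *m G^T = 0.
Proof.
have -> : G^T = col_mx H^T 1%:M by rewrite tr_row_mx trmx1.
rewrite mul_row_block mul_row_col !mulmx0 addr0 add0r mulmx1 mulNmx.
rewrite !mulmxBl mul1mx -[K *m H *m _ *m _]mulmxA -[K *m H *m _]mulmxA -addrA -opprD -mulmxDr mulmxA.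
by rewrite gain_innovation// subrr.
Qed.

Let trD : \tr (D *m S *m D^T) = mmse_obj H Sx Sw.
Proof.
rewrite -lin_risk_mmse// /lin_risk -/K tr_row_mx mul_row_block mul_row_col.
by rewrite !mulmx0 addr0 add0r mxtraceD linearN /= !mulNmx mulmxN opprK.
Qed.

Lemma affine_estimator : @estimators R n m psi0.
Proof.
have E i (y : 'cV[R]_m) : (psi0 y : 'cV[R]_n) i 0 = (mux - K *m (G *m mu)) i 0 + (K *m y) i 0.
  by rewrite /psi0 mulmxBr !mxLE; ring.
split.
  apply: measurable_vecR => i; under eq_fun do rewrite E [(K *m _) i 0]mxE.
  apply: measurable_funD => //; apply: measurable_sum => j.
  by apply: measurable_funM => //; exact: measurable_coord.
apply/sqnorm_growth.
pose a := sqnorm (mux - K *m (G *m mu)); pose b := \tr (K^T *m K).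
have a0 : 0 <= a by exact: sqnorm_ge0.
have b0 : 0 <= b by rewrite /b -{2}[K]trmxK tr_gram_ge0.
exists (2 * a + 2 * b) => [|y]; first by rewrite addr_ge0// mulr_ge0.
have -> : psi0 y = (mux - K *m (G *m mu)) + K *m y.
  by apply/colP => i; rewrite E [RHS]mxE.
apply: (le_trans (sqnormD_le _ _)); rewrite -/a.
have := sqnorm_mulmx_le K y; rewrite -/b; have := sqnorm_ge0 y.
move: (sqnorm y) (sqnorm (K *m y)) => s s' s0 h.
by have := mulr_ge0 a0 s0; lra.
Qed.

(** Pythagoras: the error of [psi] is the error of [psi0] plus a function of the observation, and
    the two are orthogonal. The growth condition on [psi] makes that function square integrable. *)
Lemma risk_decomposition psi : @estimators R n m psi ->
  risk H psi Q = (mmse_obj H Sx Sw +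
    \sum_i \int[Q]_z ((psi0 (G *m Z z) : 'cV[R]_n) i 0 - (psi (G *m Z z) : 'cV[R]_n) i 0) ^+ 2)%:E.
Proof.
move=> [mpsi /sqnorm_growth[c c0 hc]].
have [mpsi0 /sqnorm_growth[c' c'0 hc']] := affine_estimator.
pose g i (y : vecR R m) : R := (psi0 y : 'cV[R]_n) i 0 - (psi y : 'cV[R]_n) i 0.
have mg i : measurable_fun setT (g i).
  apply: measurable_funB; first exact: (measurableT_comp (measurable_coord i) mpsi0).
  exact: (measurableT_comp (measurable_coord i) mpsi).
pose e i z := (D *m (Z z - mu)) i 0.
have eE i z : e i z = (D^T *m delta_mx i 0 : 'cV[R]_(n + m)) *d (Z z - mu).
  by rewrite /e trmx_mul trmxK trmx_delta -mulmxA -rowE [in RHS]mxE.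
have ie i : integrableR Q (fun z => e i z ^+ 2).
  by under [X in EFin \o X]eq_fun do rewrite eE; exact: (normal_vector_sqr mZ pS nZ).
have me i : measurable_fun setT (e i).
  by rewrite (funext (eE i)); exact: (measurable_centered mu mZ).
have mGZ : measurable_fun setT (fun z => G *m Z z : vecR R m).
  by apply: measurable_vecR => i; exact: measurable_mulmx_comp.
have mgZ i : measurable_fun setT (fun z => g i (G *m Z z)) by exact: (measurableT_comp (mg i) mGZ).
pose N z := sqnorm (Z z - mu).
have iN : integrableR Q N.
  apply: integrableR_sum => i; have := normal_vector_sqr mZ pS nZ (delta_mx i 0).
  by under [X in EFin \o X]eq_fun do rewrite delta_dot.
pose t := \tr (G^T *m G); pose t' := sqnorm (G *m mu).
have ig i : integrableR Q (fun z => g i (G *m Z z) ^+ 2).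
  (* The squared growth bounds of both estimators, with the squared norm of the observation at most
     [2 * (t * N z) + 2 * t']. *)
  apply: (integrableR_le (g := fun z => 2 * (c + c') * (2 * t) * N z + 2 * (c + c') * (1 + 2 * t'))).
  - exact: measurable_funX.
  - by apply: integrableRD; [exact: integrableRZ|exact: integrableR_cst].
  - move=> z; rewrite ger0_norm ?sqr_ge0//; set y := G *m Z z.
    have h1 : g i y ^+ 2 <= 2 * sqnorm (psi0 y) + 2 * sqnorm (psi y).
      have -> : g i y = ((psi0 y : 'cV[R]_n) + - (psi y : 'cV[R]_n)) i 0 by rewrite /g [RHS]mxDE [X in _ = _ + X]mxNE.
      rewrite -[sqnorm (psi y)]sqnormN.
      exact: le_trans (sqr_coord_le _ _) (sqnormD_le _ _).
    have h2 : sqnorm y <= 2 * (t * N z) + 2 * t'.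
      have -> : y = G *m (Z z - mu) + G *m mu by rewrite -mulmxDr subrK.
      apply: (le_trans (sqnormD_le _ _)); rewrite lerD2r ler_pM2l//.
      exact: sqnorm_mulmx_le.
    apply: (le_trans h1); have h3 := hc y; have h4 := hc' y.
    have h5 : (c + c') * (1 + sqnorm y) <= (c + c') * (1 + (2 * (t * N z) + 2 * t')).
      by rewrite ler_wpM2l ?addr_ge0// lerD2l.
    have -> : 2 * (c + c') * (2 * t) * N z + 2 * (c + c') * (1 + 2 * t') =
      2 * ((c + c') * (1 + (2 * (t * N z) + 2 * t'))) by ring.
    apply: (@le_trans _ _ (2 * ((c + c') * (1 + sqnorm y)))); last by rewrite ler_pM2l.
    rewrite [(c + _) * _]mulrDl; move: h3 h4; move: (sqnorm (psi0 y)) (sqnorm (psi y)) (c * _) (c' * _).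
    by move=> ????; lra.
have ieg i : integrableR Q (fun z => e i z * g i (G *m Z z)) by exact: integrableR_mul.
have eg i : \int[Q]_z (e i z * g i (G *m Z z)) = 0.
  exact: (uncorrelated_orthogonal mZ pS nZ DSG (mg i) (ieg i)).
have ieg2 i : integrableR Q (fun z => (e i z + g i (G *m Z z)) ^+ 2).
  apply: (integrableR_le (g := fun z => 2 * e i z ^+ 2 + 2 * g i (G *m Z z) ^+ 2)).
  - by apply: measurable_funX; exact: measurable_funD.
  - by apply: integrableRD; exact: integrableRZ.
  - move=> z; rewrite ger0_norm ?sqr_ge0//; move: (e i z) (g i _) => a b.
    by have := sqr_ge0 (a - b); lra.
transitivity (\int[Q]_z (\sum_i (e i z + g i (G *m Z z)) ^+ 2)%:E)%E.
  apply: eq_integral => z _; congr (_%:E); apply: eq_bigr => i _; congr (_ ^+ 2).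
  rewrite /e -DZ /g GZ !mxLE /proj1 /proj2.
  by ring.
rewrite Rint_EFin; last exact: integrableR_sum.
rewrite Rint_sum// -trD /mxtrace -big_split /=; congr (_%:E); apply: eq_bigr => i _.
have -> : (D *m S *m D^T) i i = \int[Q]_z e i z ^+ 2.
  under eq_Rintegral do rewrite eE.
  by rewrite (normal_vector_variance mZ pS nZ) -(qform_delta _ i) trmx_mul trmxK !mulmxA.
transitivity (\int[Q]_z (e i z ^+ 2 + (2 * (e i z * g i (G *m Z z)) + g i (G *m Z z) ^+ 2))).
  by apply: eq_Rintegral => z _; ring.
rewrite RintD//; last by apply: integrableRD => //; exact: integrableRZ.
rewrite RintD//; last exact: integrableRZ.
by rewrite RintZ// eg mulr0 add0r.
Qed.

Lemma risk_affine : risk H psi0 Q = (mmse_obj H Sx Sw)%:E.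
Proof.
rewrite (risk_decomposition affine_estimator) big1 ?addr0// => i _.
by rewrite -[RHS](Rint_cst Q 0); apply: eq_Rintegral => z _; rewrite subrr expr0n.
Qed.

Lemma inf_risk_normal :
  ereal_inf [set risk H psi Q | psi in @estimators R n m] = (mmse_obj H Sx Sw)%:E.
Proof.
apply/eqP; rewrite eq_le; apply/andP; split.
  rewrite -risk_affine; apply: ereal_inf_lbound; exists psi0; last by [].
  exact: affine_estimator.
apply: le_ereal_inf_tmp => _ [psi /risk_decomposition -> <-]; rewrite lee_fin lerDl.
by apply: sumr_ge0 => i _; apply: Rintegral_ge0 => z _; exact: sqr_ge0.
Qed.

End normal_risk.

Lemma feasible_amb_set (R : realType) (n m : nat) (muhx : 'cV[R]_n) (Shx : 'M[R]_n)
    (muhw : 'cV[R]_m) (Shw : 'M[R]_m) (rhox rhow : R) p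
    (Q : probability (vecR R n * vecR R m)%type R) :
  psd Shx -> psd Shw -> 0 <= rhox -> 0 <= rhow ->
  feasible Shx Shw rhox rhow p -> is_normal_prod Q muhx p.1 muhw p.2 ->
  amb_set muhx Shx muhw Shw rhox rhow Q.
Proof.
move=> pShx pShw rx rw [px pw gx gw] nQ; exists p.1, p.2.
by split=> //; [exact: (gelbrich_wass_normal muhx px)|exact: (gelbrich_wass_normal muhw (pd_psd pw))].
Qed.

Theorem mainTheorem7 (R : realType) (n m : nat) (H : 'M[R]_(m, n))
    (muhx : 'cV[R]_n) (Shx : 'M[R]_n) (muhw : 'cV[R]_m) (Shw : 'M[R]_m)
    (rhox rhow : R) :
  (0 < n)%N -> (0 < m)%N -> psd Shx -> psd Shw -> 0 <= rhox -> 0 <= rhow ->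
  dro_value H muhx Shx muhw Shw rhox rhow = opt_value H Shx Shw rhox rhow /\
  (pd Shw ->
    (exists p : 'M[R]_n * 'M[R]_m,
       [/\ feasible Shx Shw rhox rhow p,
           (mmse_obj H p.1 p.2)%:E = opt_value H Shx Shw rhox rhow,
           psd (p.1 - lambda_min Shx *: 1%:M) &
           psd (p.2 - lambda_min Shw *: 1%:M)]) /\
    (forall p : 'M[R]_n * 'M[R]_m,
       feasible Shx Shw rhox rhow p ->
       (mmse_obj H p.1 p.2)%:E = opt_value H Shx Shw rhox rhow ->
       (exists Q, is_normal_prod Q muhx p.1 muhw p.2) /\
       (forall Q, is_normal_prod Q muhx p.1 muhw p.2 ->
          amb_set muhx Shx muhw Shw rhox rhow Q /\
          ereal_inf [set risk H psi Q | psi in @estimators R n m] =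
          dro_value H muhx Shx muhw Shw rhox rhow))).
Proof.
move=> n0 m0 pShx pShw rx rw.
have exQ p : feasible Shx Shw rhox rhow p -> exists Q, is_normal_prod Q muhx p.1 muhw p.2.
  by move=> [px pw _ _]; apply: exists_normal_prod => //; exact: pd_psd.
have infQ p Q : feasible Shx Shw rhox rhow p -> is_normal_prod Q muhx p.1 muhw p.2 ->
    ereal_inf [set risk H psi Q | psi in @estimators R n m] = (mmse_obj H p.1 p.2)%:E.
  by move=> [px pw _ _] nQ; exact: inf_risk_normal nQ.
(* Both suprema run over the same values: each law of the ambiguity set has a feasible pair of
   covariances, and each feasible pair is realized by a product of normal laws. *)
have E : dro_value H muhx Shx muhw Shw rhox rhow = opt_value H Shx Shw rhox rhow.
  apply/eqP; rewrite eq_le; apply/andP; split; apply: ge_ereal_sup.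
    move=> _ [Q [Sx [Sw [px pw nQ wx ww]]] <-].
    have fp : feasible Shx Shw rhox rhow (Sx, Sw).
      split=> //=; first exact: (wass_normal_gelbrich px pShx rx wx).
      exact: (wass_normal_gelbrich (pd_psd pw) pShw rw ww).
    by rewrite (infQ _ _ fp nQ); apply: ereal_sup_ubound; exists (Sx, Sw).
  move=> _ [p fp <-]; have [Q nQ] := exQ p fp.
  apply: ereal_sup_ubound; exists Q; last exact: infQ.
  exact: feasible_amb_set nQ.
split=> // pdShw; split=> [|p fp optp].
  have [p [fp p1 p2 pmax]] := mmse_maximizer H rhox rhow n0 m0 pShx pdShw.
  exists p; split=> //; rewrite ?scalemx1//.
  apply/eqP; rewrite eq_le; apply/andP; split; first by apply: ereal_sup_ubound; exists p.
  by apply: ge_ereal_sup => _ [q fq <-]; rewrite lee_fin; exact: pmax.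
split=> [|Q nQ]; first exact: exQ.
by split; [exact: feasible_amb_set nQ|rewrite E -optp; exact: infQ].
Qed.
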